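(* Let $\mathcal{A}$ be a semi-abelian category, $\mathcal{E}$ a class of extensions in $\mathcal{A}$ and $\mathcal{B}$ a strongly $\mathcal{E}$-Birkhoff subcategory of $\mathcal{A}$. Let $n\geq1$ and $0\leq i\leq n-1$. For every $n$-fold extension $A$ in $\mathcal{A}$ one has $\iota^1[A]_{n}=[\rho_{i}A]_{n-1}$, where $[\rho_iA]_{n-1}=[\rho_iA]_{n-1,\mathcal{B}_1}$ is computed in $\mathsf{Arr}\,\mathcal{A}$ with class of extensions $\mathcal{E}^1$ and strongly $\mathcal{E}^1$-Birkhoff subcategory $\mathcal{B}_1=\mathsf{CExt}_{\mathcal{B}}\mathcal{A}$; and the square of functors $$\rho_i\circ I_n=(I_1)_{n-1}\circ\rho_i\colon \mathsf{Ext}^n\mathcal{A}\to\mathsf{Ext}^{n-1}(\mathsf{Arr}\,\mathcal{A})$$ commutes. Consequently, for any $n$-fold arrow $A$ in $\mathcal{A}$ the following properties are equivalent: (1) $A$ is an $n$-fold central extension (with respect to $\mathcal{B}$); (2) $\rho_iA$ is an $(n-1)$-fold central extension (with respect to $\mathcal{B}_1$).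
   Context: Semi-abelian means pointed, finitely complete and cocomplete, Barr-exact and Bourn-protomodular. For a class $\mathcal{E}$ of morphisms in $\mathcal{A}$, $\mathcal{E}^-$ is the class of objects that are the domain or the codomain of at least one arrow in $\mathcal{E}$, and $\mathcal{A}_{\mathcal{E}}$ is the full subcategory of $\mathcal{A}$ on $\mathcal{E}^-$. Class of extensions. A class $\mathcal{E}$ of regular epimorphisms in $\mathcal{A}$ with $0\in\mathcal{E}^-$ is a class of extensions (its members are called ($\mathcal{E}$-)extensions) if: (1) $\mathcal{E}$ contains all split epimorphisms $f\colon A\to B$ with $A,B\in\mathcal{E}^-$; (2) for composable $f\colon A\to B$, $g\colon B\to C$: if $f,g\in\mathcal{E}$ then $g\circ f\in\mathcal{E}$, and if $g\circ f\in\mathcal{E}$ and $B\in\mathcal{E}^-$ then $g\in\mathcal{E}$; (3) for $f\colon A\to B$ in $\mathcal{E}$ and $g\colon C\to B$ in $\mathcal{A}$ with $C\in\mathcal{E}^-$, the pullback $g^*f\colon C\times_B A\to C$ is in $\mathcal{E}$; (4) if $0\to K\to A\xrightarrow{f} B\to 0$ is short exact with $A\in\mathcal{E}^-$ and $K\in\mathcal{E}^-$, then $f\in\mathcal{E}$; (5) for every morphism of short exact sequences from $0\to K\to A\xrightarrow{f}B\to 0$ to $0\to L\to C\xrightarrow{g}B\to 0$ with components $k\colon K\to L$, $a\colon A\to C$, $1_B$: if $f,k\in\mathcal{E}$ and $C\in\mathcal{E}^-$, then $a\in\mathcal{E}$. Double extensions. $\mathsf{Arr}\,\mathcal{A}$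 is the category of arrows of $\mathcal{A}$, with commutative squares as morphisms. A morphism $(f_1,f_0)\colon a\to b$ from $a\colon A_1\to A_0$ to $b\colon B_1\to B_0$ (with $f_1\colon A_1\to B_1$, $f_0\colon A_0\to B_0$) is a double $\mathcal{E}$-extension if $a,b,f_0,f_1$, the two projections of the pullback $A_0\times_{B_0}B_1$, and the induced arrow $A_1\to A_0\times_{B_0}B_1$ are all in $\mathcal{E}$. $\mathcal{E}^1$ is the class of double $\mathcal{E}$-extensions; it is a class of extensions in the semi-abelian category $\mathsf{Arr}\,\mathcal{A}$. Higher extensions. Put $0=\varnothing$, $n=\{0,\dots,n-1\}$. An $n$-fold arrow in $\mathcal{A}$ is a functor $A\colon\mathcal{P}(n)^{\mathrm{op}}\to\mathcal{A}$ ($\mathcal{P}(n)$ the powerset ordered by inclusion); $\mathsf{Arr}^n\mathcal{A}$ is the (semi-abelian) category of $n$-fold arrows and natural transformations. Write $A_S=A(S)$ and $a_S^T\colon A_T\to A_S$ for $S\subseteq T$. The isomorphism $\delta_{n-1}\colon \mathsf{Arr}^n\mathcal{A}\to\mathsf{Arr}(\mathsf{Arr}^{n-1}\mathcal{A})$ sends $A$ to $(a_S^{S\cup\{n-1\}})_{S\subseteq n-1}\colon (A_{S\cup\{n-1\}})_{S\subseteq n-1}\to(A_S)_{S\subseteq n-1}$. Put $\mathcal{E}^0=\mathcal{E}$ and, inductively for $n\geq1$, let $\mathcal{E}^n$ be the class of arrows $f\colon A\to B$ in $\mathsf{Arr}^n\mathcal{A}$ whose induced square $\delta_{n-1}A\to\delta_{n-1}B$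 in $\mathsf{Arr}^{n-1}\mathcal{A}$ is a double $\mathcal{E}^{n-1}$-extension; $\mathcal{E}^n$ is a class of extensions in $\mathsf{Arr}^n\mathcal{A}$. For $n\geq 1$ an $n$-fold ($\mathcal{E}$-)extension is an $n$-fold arrow $A$ with $\delta_{n-1}A\in\mathcal{E}^{n-1}$; a $0$-fold extension is an object of $\mathcal{E}^-$. $\mathsf{Ext}^n\mathcal{A}=(\mathsf{Arr}^n\mathcal{A})_{\mathcal{E}^n}$ is the full subcategory of $\mathsf{Arr}^n\mathcal{A}$ on the $n$-fold extensions; $\mathsf{Ext}^{n-1}(\mathsf{Arr}\,\mathcal{A})$ is formed with respect to $\mathcal{E}^1$. Birkhoff subcategories and central extensions. A full replete reflective subcategory $\mathcal{B}$ of $\mathcal{A}_{\mathcal{E}}$, with reflector $I$ and unit $\eta$, is strongly $\mathcal{E}$-Birkhoff in $\mathcal{A}$ if for every extension $f\colon A\to B$ the naturality square with sides $\eta_A,\ f,\ If,\ \eta_B$ is a double $\mathcal{E}$-extension. An extension $f\colon A\to B$ is trivial (w.r.t. $\mathcal{B}$) if this square is a pullback, and central if there is an extension $g\colon C\to B$ such that $g^*f$ is trivial. The full subcategory $\mathsf{CExt}_{\mathcal{B}}\mathcal{A}$ of $\mathsf{Ext}^1\mathcal{A}$ on the central extensions is strongly $\mathcal{E}^1$-Birkhoff in $\mathsf{Arr}\,\mathcal{A}$. Put $\mathcal{B}_0=\mathcal{B}$; a $0$-fold central extension is an object of $\mathcal{B}$. Inductively, for $n\ge1$, an $n$-fold extension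 $A$ is an $n$-fold central extension if $\delta_{n-1}A$ is central with respect to $\mathcal{B}_{n-1}$ (in $\mathsf{Arr}^{n-1}\mathcal{A}$, with class of extensions $\mathcal{E}^{n-1}$), and $\mathcal{B}_n=\mathsf{CExt}^n_{\mathcal{B}}\mathcal{A}$ is the full subcategory of $\mathsf{Ext}^n\mathcal{A}$ on these. It is strongly $\mathcal{E}^n$-Birkhoff in $\mathsf{Arr}^n\mathcal{A}$; $I_n\colon\mathsf{Ext}^n\mathcal{A}\to\mathcal{B}_n$ denotes the reflector (composed with the inclusion into $\mathsf{Ext}^n\mathcal{A}$ when convenient) and $\eta^n$ its unit; $I_0=I$. The functor $(I_1)_{n-1}$ is the corresponding reflector $\mathsf{Ext}^{n-1}(\mathsf{Arr}\,\mathcal{A})\to\mathsf{CExt}^{n-1}_{\mathcal{B}_1}(\mathsf{Arr}\,\mathcal{A})$ obtained by starting from $(\mathsf{Arr}\,\mathcal{A},\mathcal{E}^1,\mathcal{B}_1)$ instead of $(\mathcal{A},\mathcal{E},\mathcal{B})$. The functors $[\cdot]_n$. $\iota^n\colon\mathcal{A}\to\mathsf{Arr}^n\mathcal{A}$ sends $A$ to the $n$-fold arrow with $(\iota^nA)_n=A$ and $(\iota^nA)_S=0$ for $S\subsetneq n$. For every $n$-fold extension $A$, the kernel $[A]_{\mathcal{B}_n}$ of $\eta^n_A$ is of the form $\iota^n[A]_{n,\mathcal{B}}$ with $[A]_{n}=[A]_{n,\mathcal{B}}$ a normal subobject of $A_n$ (for $n=0$: $[A]_0=[A]_{\mathcal{B}}$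 is the kernel of $\eta_A$). Equality is equality as subobjects. The functors $\rho_i$. For $i\geq0$ let $s_i\colon\mathbb{N}\to\mathbb{N}$ be $s_i(k)=k$ if $k<i$ and $s_i(k)=k+1$ if $k\geq i$; for $S\subseteq\mathbb{N}$ put $S^i=s_i(S)$. For $n\ge1$, $0\leq i\leq n-1$, and an $n$-fold arrow $A$ in $\mathcal{A}$, $\rho_iA$ is the $(n-1)$-fold arrow in $\mathsf{Arr}\,\mathcal{A}$ given by $\bigl(a_{S^i}^{S^i\cup\{i\}}\colon A_{S^i\cup\{i\}}\to A_{S^i}\bigr)_{S\subseteq n-1}$. It restricts to a functor $\mathsf{Ext}^n\mathcal{A}\to\mathsf{Ext}^{n-1}(\mathsf{Arr}\,\mathcal{A})$. *)

(* Defs.v *)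
From Stdlib Require List.
From mathcomp Require Import all_boot.
From mathcomp Require Import boolp.

Set Implicit Arguments.
Unset Strict Implicit.
Unset Printing Implicit Defensive.

Declare Scope cat_scope.
Delimit Scope cat_scope with cat.
Local Open Scope cat_scope.

Record category := Category {
  obj :> Type;
  hom : obj -> obj -> Type;
  idm : forall A, hom A A;
  compm : forall A B D, hom B D -> hom A B -> hom A D;
  compm1 : forall A B (f : hom A B), compm f (idm A) = f;
  comp1m : forall A B (f : hom A B), compm (idm B) f = f;
  compmA : forall A B D F (h : hom D F) (g : hom B D) (f : hom A B),
    compm h (compm g f) = compm (compm h g) f }.

Arguments hom {c} A B.
Arguments idm {c} A.
Arguments compm {c A B D} g f.

Notation "g ∘ f" := (compm g f) (at level 40, left associativity) : cat_scope.

Definition op (C : category) : category.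
Proof.
apply: (@Category C (fun A B => @hom C B A) (fun A => idm A)
          (fun A B D g f => f ∘ g)).
- by move=> A B f; exact: comp1m.
- by move=> A B f; exact: compm1.
- by move=> A B D F h g f; rewrite compmA.
Defined.

Record functor (C D : category) := Functor {
  fobj :> C -> D;
  fmap : forall A B : C, hom A B -> hom (fobj A) (fobj B);
  fmap1 : forall A : C, fmap (idm A) = idm (fobj A);
  fmapM : forall (A B E : C) (g : hom B E) (f : hom A B),
    fmap (g ∘ f) = fmap g ∘ fmap f }.

Arguments fmap {C D} F {A B} f : rename.

Definition fcomp (C D E : category) (G : functor D E) (F : functor C D) :
  functor C E.
Proof.
apply: (@Functor C E (fun A => G (F A)) (fun A B f => fmap G (fmap F f))).
- by move=> A; rewrite !fmap1.
- by move=> A B X g f; rewrite !fmapM.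
Defined.

Record nattrans (C D : category) (F G : functor C D) := NatTrans {
  nt_at :> forall A : C, hom (F A) (G A);
  nt_nat : forall (A B : C) (f : hom A B),
    nt_at B ∘ fmap F f = fmap G f ∘ nt_at A }.

Lemma nattransP (C D : category) (F G : functor C D) (s t : nattrans F G) :
  (forall A, s A = t A) -> s = t.
Proof.
case: s t => [s sP] [t tP] /= st.
have {}st : s = t by apply: functional_extensionality_dep.
by subst t; rewrite (Prop_irrelevance sP tP).
Qed.

Definition nt_id (C D : category) (F : functor C D) : nattrans F F.
Proof.
by apply: (@NatTrans C D F F (fun A => idm (F A))) => A B f;
  rewrite comp1m compm1.
Defined.

Definition nt_comp (C D : category) (F G H : functor C D)
  (t : nattrans G H) (s : nattrans F G) : nattrans F H.
Proof.
apply: (@NatTrans C D F H (fun A => t A ∘ s A)) => A B f.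
by rewrite -compmA nt_nat compmA nt_nat compmA.
Defined.

Definition Fun (C D : category) : category.
Proof.
apply: (@Category (functor C D) (@nattrans C D) (@nt_id C D) (@nt_comp C D)).
- by move=> F G s; apply: nattransP => A; exact: compm1.
- by move=> F G s; apply: nattransP => A; exact: comp1m.
- by move=> F G H K u t s; apply: nattransP => A; exact: compmA.
Defined.

Definition full (C : category) (X : C -> Prop) : category.
Proof.
apply: (@Category {A : C | X A} (fun A B => hom (sval A) (sval B))
          (fun A => idm (sval A)) (fun A B D g f => g ∘ f)).
- by move=> A B f; exact: compm1.
- by move=> A B f; exact: comp1m.
- by move=> A B D F h g f; exact: compmA.
Defined.

Definition incl (C : category) (X : C -> Prop) : functor (full X) C :=
  @Functor (full X) C (fun A => sval A) (fun A B f => f)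
    (fun A => erefl) (fun A B D g f => erefl).

Definition restrict (C D : category) (X : C -> Prop) (Y : D -> Prop)
  (F : functor C D) (h : forall A, X A -> Y (F A)) :
  functor (full X) (full Y) :=
  @Functor (full X) (full Y)
    (fun A => exist Y (F (sval A)) (h (sval A) (proj2_sig A)))
    (fun A B f => fmap F f)
    (fun A => fmap1 F (sval A)) (fun A B E g f => fmapM F g f).

Record arrow (C : category) := Arrow {
  adom : C; acod : C; amor :> hom adom acod }.

Record square (C : category) (a b : arrow C) := Square {
  sq1 : hom (adom a) (adom b);
  sq0 : hom (acod a) (acod b);
  sqC : b ∘ sq1 = sq0 ∘ a }.

Lemma squareP (C : category) (a b : arrow C) (s t : square a b) :
  sq1 s = sq1 t -> sq0 s = sq0 t -> s = t.
Proof.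
case: s t => [s1 s0 sP] [t1 t0 tP] /= e1 e0; subst t1 t0.
by rewrite (Prop_irrelevance sP tP).
Qed.

Definition sq_id (C : category) (a : arrow C) : square a a.
Proof.
by apply: (@Square C a a (idm (adom a)) (idm (acod a))); rewrite compm1 comp1m.
Defined.

Definition sq_comp (C : category) (a b c : arrow C)
  (t : square b c) (s : square a b) : square a c.
Proof.
apply: (@Square C a c (sq1 t ∘ sq1 s) (sq0 t ∘ sq0 s)).
by rewrite compmA sqC -compmA sqC compmA.
Defined.

Definition Arr (C : category) : category.
Proof.
apply: (@Category (arrow C) (@square C) (@sq_id C) (@sq_comp C)).
- by move=> a b s; apply: squareP; exact: compm1.
- by move=> a b s; apply: squareP; exact: comp1m.
- by move=> a b c d u t s; apply: squareP; exact: compmA.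
Defined.

Record pcategory := PCategory {
  pcat :> category;
  zero : pcat;
  to0 : forall A : pcat, hom A zero;
  from0 : forall A : pcat, hom zero A;
  to0_uniq : forall (A : pcat) (f : hom A zero), f = to0 A;
  from0_uniq : forall (A : pcat) (f : hom zero A), f = from0 A }.

Arguments zero {p}.
Arguments to0 {p} A.
Arguments from0 {p} A.

Definition zerom (C : pcategory) (A B : C) : hom A B := from0 B ∘ to0 A.
Arguments zerom {C} A B.

Lemma zerom_l (C : pcategory) (A B D : C) (f : hom A B) :
  zerom B D ∘ f = zerom A D.
Proof. by rewrite /zerom -compmA; congr (_ ∘ _); exact: to0_uniq. Qed.

Lemma zerom_r (C : pcategory) (A B D : C) (g : hom B D) :
  g ∘ zerom A B = zerom A D.
Proof. by rewrite /zerom compmA; congr (_ ∘ _); exact: from0_uniq. Qed.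

Definition pArr (C : pcategory) : pcategory.
Proof.
pose z := @Arrow C zero zero (idm zero).
apply: (@PCategory (Arr C) z
  (fun a => @Square C a z (to0 _) (to0 _)
     (etrans (to0_uniq _) (esym (to0_uniq _))))
  (fun a => @Square C z a (from0 _) (from0 _)
     (etrans (from0_uniq _) (esym (from0_uniq _))))).
- by move=> a s; apply: squareP; exact: to0_uniq.
- by move=> a s; apply: squareP; exact: from0_uniq.
Defined.

Definition pFun (J : category) (C : pcategory) : pcategory.
Proof.
pose z := @Functor J C (fun=> zero) (fun _ _ _ => idm zero)
  (fun=> erefl) (fun _ _ _ _ _ => esym (comp1m (idm zero))).
apply: (@PCategory (Fun J C) z
  (fun F => @NatTrans J C F z (fun A => to0 (F A))
     (fun A B f => etrans (to0_uniq _) (esym (to0_uniq _))))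
  (fun F => @NatTrans J C z F (fun A => from0 (F A))
     (fun A B f => etrans (from0_uniq _) (esym (from0_uniq _))))).
- by move=> F s; apply: nattransP => A; exact: to0_uniq.
- by move=> F s; apply: nattransP => A; exact: from0_uniq.
Defined.

Definition is_iso (C : category) (A B : C) (f : hom A B) :=
  exists g : hom B A, g ∘ f = idm A /\ f ∘ g = idm B.

Definition is_mono (C : category) (A B : C) (f : hom A B) :=
  forall (T : C) (u v : hom T A), f ∘ u = f ∘ v -> u = v.

Definition is_split_epi (C : category) (A B : C) (f : hom A B) :=
  exists s : hom B A, f ∘ s = idm B.

Definition is_coequalizer (C : category) (R A B : C)
  (u v : hom R A) (f : hom A B) :=
  f ∘ u = f ∘ v /\
  forall (T : C) (g : hom A T), g ∘ u = g ∘ v -> exists! h : hom B T, h ∘ f = g.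

Definition is_regular_epi (C : category) (A B : C) (f : hom A B) :=
  exists (R : C) (u v : hom R A), is_coequalizer u v f.

Definition is_pullback (C : category) (A B D P : C)
  (f : hom A B) (g : hom D B) (pA : hom P A) (pD : hom P D) :=
  f ∘ pA = g ∘ pD /\
  forall (T : C) (a : hom T A) (d : hom T D), f ∘ a = g ∘ d ->
    exists! t : hom T P, pA ∘ t = a /\ pD ∘ t = d.

Definition is_kernel (C : pcategory) (K A B : C) (k : hom K A) (f : hom A B) :=
  f ∘ k = zerom K B /\
  forall (T : C) (t : hom T A), f ∘ t = zerom T B ->
    exists! u : hom T K, k ∘ u = t.

Definition is_cokernel (C : pcategory) (K A B : C) (k : hom K A) (f : hom A B) :=
  f ∘ k = zerom K B /\
  forall (T : C) (t : hom A T), t ∘ k = zerom K T ->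
    exists! u : hom B T, u ∘ f = t.

Definition is_short_exact (C : pcategory) (K A B : C)
  (k : hom K A) (f : hom A B) := is_kernel k f /\ is_cokernel k f.

Definition is_cone (J C : category) (F : functor J C) (L : C)
  (p : forall j : J, hom L (F j)) :=
  forall (i j : J) (u : hom i j), fmap F u ∘ p i = p j.

Definition is_limit (J C : category) (F : functor J C) (L : C)
  (p : forall j : J, hom L (F j)) :=
  is_cone p /\
  forall (M : C) (q : forall j : J, hom M (F j)), is_cone q ->
    exists! h : hom M L, forall j, p j ∘ h = q j.

Definition finite_type (T : Type) := exists s : seq T, forall x, List.In x s.

Definition finite_category (J : category) :=
  finite_type J /\ forall i j : J, finite_type (hom i j).

Definition finitely_complete (C : category) :=
  forall J : category, finite_category J -> forall F : functor J C,
    exists (L : C) (p : forall j : J, hom L (F j)), is_limit p.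

Definition finitely_cocomplete (C : category) := finitely_complete (op C).

Definition is_kernel_pair (C : category) (R A B : C)
  (d0 d1 : hom R A) (f : hom A B) := is_pullback f f d0 d1.

Record is_equivalence_relation (C : category) (R A : C) (d0 d1 : hom R A) :
  Prop := IsEquivalenceRelation {
  er_mono : forall (T : C) (u v : hom T R),
    d0 ∘ u = d0 ∘ v -> d1 ∘ u = d1 ∘ v -> u = v;
  er_refl : exists r : hom A R, d0 ∘ r = idm A /\ d1 ∘ r = idm A;
  er_sym : exists s : hom R R, d0 ∘ s = d1 /\ d1 ∘ s = d0;
  er_trans : forall (P : C) (p q : hom P R), is_pullback d1 d0 p q ->
    exists t : hom P R, d0 ∘ t = d0 ∘ p /\ d1 ∘ t = d1 ∘ q }.

Record is_regular (C : category) : Prop := IsRegular {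
  reg_lim : finitely_complete C;
  reg_coeq : forall (R A B : C) (d0 d1 : hom R A) (f : hom A B),
    is_kernel_pair d0 d1 f ->
    exists (Q : C) (q : hom A Q), is_coequalizer d0 d1 q;
  reg_stable : forall (A B D P : C)
    (f : hom A B) (g : hom D B) (pA : hom P A) (pD : hom P D),
    is_pullback f g pA pD -> is_regular_epi f -> is_regular_epi pD }.

Definition is_barr_exact (C : category) :=
  is_regular C /\
  forall (R A : C) (d0 d1 : hom R A), is_equivalence_relation d0 d1 ->
    exists (B : C) (f : hom A B), is_kernel_pair d0 d1 f.

(* The change-of-base functors [v^*] between the fibres of the fibration of
   points reflect isomorphisms: [h] is a morphism of points over [B], and
   [h'] its image under [v^*]. *)
Definition is_protomodular (C : category) :=
  forall (B E : C) (v : hom E B)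
    (X Y : C) (p : hom X B) (s : hom B X) (q : hom Y B) (t : hom B Y)
    (h : hom X Y),
    p ∘ s = idm B -> q ∘ t = idm B -> q ∘ h = p -> h ∘ s = t ->
  forall (P Q : C) (pE : hom P E) (pX : hom P X) (qE : hom Q E) (qY : hom Q Y)
    (h' : hom P Q),
    is_pullback v p pE pX -> is_pullback v q qE qY ->
    qE ∘ h' = pE -> qY ∘ h' = h ∘ pX ->
    is_iso h' -> is_iso h.

Record is_semi_abelian (C : pcategory) : Prop := IsSemiAbelian {
  sab_complete : finitely_complete C;
  sab_cocomplete : finitely_cocomplete C;
  sab_exact : is_barr_exact C;
  sab_protomodular : is_protomodular C }.

Definition mclass (C : category) := forall A B : C, hom A B -> Prop.

(* The objects of [E^-]. *)
Definition ends (C : category) (E : mclass C) (A : C) :=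
  (exists (B : C) (f : hom A B), E A B f) \/
  (exists (B : C) (f : hom B A), E B A f).

Record is_class_of_extensions (C : pcategory) (E : mclass C) : Prop :=
  IsClassOfExtensions {
  ce_regular : forall (A B : C) (f : hom A B), E A B f -> is_regular_epi f;
  ce_zero : ends E zero;
  ce_split : forall (A B : C) (f : hom A B),
    ends E A -> ends E B -> is_split_epi f -> E A B f;
  ce_comp : forall (A B D : C) (f : hom A B) (g : hom B D),
    E A B f -> E B D g -> E A D (g ∘ f);
  ce_cancel : forall (A B D : C) (f : hom A B) (g : hom B D),
    E A D (g ∘ f) -> ends E B -> E B D g;
  ce_pullback : forall (A B D P : C) (f : hom A B) (g : hom D B)
    (pA : hom P A) (pD : hom P D),
    E A B f -> ends E D -> is_pullback f g pA pD -> E P D pD;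
  ce_exact : forall (K A B : C) (k : hom K A) (f : hom A B),
    is_short_exact k f -> ends E A -> ends E K -> E A B f;
  ce_five : forall (K A L D B : C) (i : hom K A) (f : hom A B)
    (j : hom L D) (g : hom D B) (k : hom K L) (a : hom A D),
    is_short_exact i f -> is_short_exact j g ->
    a ∘ i = j ∘ k -> g ∘ a = f ->
    E A B f -> E K L k -> ends E D -> E A D a }.

(* Any one pullback will do: a class of extensions is closed under composition
   with isomorphisms. *)
Definition double_ext (C : category) (E : mclass C) : mclass (Arr C) :=
  fun (a b : arrow C) (f : square a b) =>
  [/\ E _ _ (amor a), E _ _ (amor b), E _ _ (sq1 f), E _ _ (sq0 f)
    & exists (P : C) (p0 : hom P (acod a)) (p1 : hom P (adom b))
        (u : hom (adom a) P),
      [/\ is_pullback (sq0 f) (amor b) p0 p1,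
          E _ _ p0, E _ _ p1,
          p0 ∘ u = a /\ p1 ∘ u = sq1 f
        & E _ _ u]].

(* Full subcategories are given by predicates on objects. *)

(* [eta : A -> I] is a universal arrow from [A] to the full subcategory on
   [D]. *)
Definition is_reflection (C : category) (D : C -> Prop) (A I : C)
  (eta : hom A I) :=
  D I /\ forall (Y : C) (f : hom A Y), D Y -> exists! g : hom I Y, g ∘ eta = f.

(* A reflector from the full subcategory on [X] to its full subcategory on
   [D], composed with the inclusion into the ambient category. *)
Record reflector (C : category) (X D : C -> Prop) := Reflector {
  refl_fun :> functor (full X) C;
  refl_unit : nattrans (incl X) refl_fun;
  reflP : forall A : full X, is_reflection D (refl_unit A) }.

Definition unit_square (C : category) (X D : C -> Prop) (I : reflector X D)
  (A B : full X) (f : hom A B) :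
  square (@Arrow C (sval A) (sval B) f) (@Arrow C (I A) (I B) (fmap I f)) :=
  @Square C (@Arrow C (sval A) (sval B) f) (@Arrow C (I A) (I B) (fmap I f))
    (refl_unit I A) (refl_unit I B) (esym (nt_nat (refl_unit I) f)).

Record is_strongly_birkhoff (C : category) (E : mclass C) (D : C -> Prop) :
  Prop := IsStronglyBirkhoff {
  sb_sub : forall A : C, D A -> ends E A;
  sb_replete : forall (A B : C) (f : hom A B),
    ends E B -> is_iso f -> D A -> D B;
  sb_refl : exists I : reflector (ends E) D,
    forall (A B : full (ends E)) (f : hom A B),
      E (sval A) (sval B) f -> double_ext E (unit_square I f) }.

(* [IA], [IB], [etaA], [etaB] and [g] present the naturality square of the
   unit at [f]; it is independent of the choice of reflections up to
   isomorphism. *)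
Definition trivial_ext (C : category) (E : mclass C) (D : C -> Prop) :
  mclass C := fun (A B : C) (f : hom A B) =>
  E A B f /\
  exists (IA IB : C) (etaA : hom A IA) (etaB : hom B IB) (g : hom IA IB),
    [/\ is_reflection D etaA, is_reflection D etaB
      & is_pullback g etaB etaA f].

Definition central_ext (C : category) (E : mclass C) (D : C -> Prop) :
  mclass C := fun (A B : C) (f : hom A B) =>
  E A B f /\
  exists (X : C) (g : hom X B) (P : C) (pA : hom P A) (pX : hom P X),
    [/\ E X B g, is_pullback f g pA pX & trivial_ext E D pX].

Definition CExt (C : category) (E : mclass C) (D : C -> Prop) :
  Arr C -> Prop := fun a : arrow C => central_ext E D (amor a).

Definition powerset_cat (n : nat) : category.
Proof.
apply: (@Category {set 'I_n} (fun S T => S \subset T)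
          (fun S => subxx S) (fun S T U tu st => subset_trans st tu)).
- by move=> S T f; exact: bool_irrelevance.
- by move=> S T f; exact: bool_irrelevance.
- by move=> S T U V h g f; exact: bool_irrelevance.
Defined.

Definition nArr (n : nat) (C : category) : category :=
  Fun (op (powerset_cat n)) C.

Definition pnArr (n : nat) (C : pcategory) : pcategory :=
  pFun (op (powerset_cat n)) C.

(* The map [a_S^T : A_T -> A_S]. When [S = T] holds only propositionally, as
   for [i |: face i setT] and [setT] below, this is the identification of
   [A_T] with [A_S]. *)
Definition nmap (n : nat) (C : category) (A : nArr n C) (S T : {set 'I_n})
  (h : S \subset T) : hom (fobj A T) (fobj A S) :=
  @fmap (op (powerset_cat n)) C A T S h.

(* As [lift i j] has value [s_i j], [face i S] is [S^i]; and
   [face ord_max S] is [S] viewed as a subset of {0, ..., n}. *)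
Definition face (n : nat) (i : 'I_n.+1) (S : {set 'I_n}) : {set 'I_n.+1} :=
  [set lift i j | j in S].

Lemma face_sub (n : nat) (i : 'I_n.+1) (S T : {set 'I_n}) :
  S \subset T -> face i S \subset face i T.
Proof. exact: imsetS. Qed.

Lemma faceU_sub (n : nat) (i : 'I_n.+1) (S T : {set 'I_n}) :
  S \subset T -> i |: face i S \subset i |: face i T.
Proof. by move=> st; apply: setUS; exact: imsetS. Qed.

Lemma face_faceU (n : nat) (i : 'I_n.+1) (S : {set 'I_n}) :
  face i S \subset i |: face i S.
Proof. exact: subsetUr. Qed.

Lemma nmap1 (n : nat) (C : category) (A : nArr n C) (S : {set 'I_n})
  (h : S \subset S) : nmap A h = idm (fobj A S).
Proof.
by rewrite (bool_irrelevance h (subxx S)); exact: (@fmap1 _ _ A S).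
Qed.

Lemma nmapM (n : nat) (C : category) (A : nArr n C) (S T U : {set 'I_n})
  (st : S \subset T) (tu : T \subset U) (su : S \subset U) :
  nmap A su = nmap A st ∘ nmap A tu.
Proof.
rewrite (bool_irrelevance su (subset_trans st tu)).
exact: (@fmapM _ _ A U T S st tu).
Qed.

Definition lower_face (n : nat) (C : category) (i : 'I_n.+1)
  (A : nArr n.+1 C) : nArr n C.
Proof.
apply: (@Functor (op (powerset_cat n)) C (fun S => fobj A (face i S))
  (fun T S h => nmap A (face_sub i h))).
- by move=> S; exact: nmap1.
- by move=> U T S st tu; exact: nmapM.
Defined.

Definition upper_face (n : nat) (C : category) (i : 'I_n.+1)
  (A : nArr n.+1 C) : nArr n C.
Proof.
apply: (@Functor (op (powerset_cat n)) C (fun S => fobj A (i |: face i S))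
  (fun T S h => nmap A (faceU_sub i h))).
- by move=> S; exact: nmap1.
- by move=> U T S st tu; exact: nmapM.
Defined.

Definition face_arrow (n : nat) (C : category) (i : 'I_n.+1)
  (A : nArr n.+1 C) : @hom (nArr n C) (upper_face i A) (lower_face i A).
Proof.
apply: (@NatTrans (op (powerset_cat n)) C (upper_face i A) (lower_face i A)
  (fun S => nmap A (face_faceU i S))) => T S h.
have sub : face i S \subset i |: face i T.
  exact: subset_trans (face_sub i h) (face_faceU i T).
by rewrite /= -(nmapM A _ _ sub) -(nmapM A _ _ sub).
Defined.

Definition delta_obj (n : nat) (C : category) (A : nArr n.+1 C) :
  Arr (nArr n C) :=
  @Arrow (nArr n C) _ _ (face_arrow ord_max A).

Lemma nmap_nat (n : nat) (C : category) (A B : nArr n C) (f : hom A B)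
  (S T : {set 'I_n}) (h : S \subset T) :
  nt_at f S ∘ nmap A h = nmap B h ∘ nt_at f T.
Proof. exact: (@nt_nat _ _ _ _ f T S h). Qed.

Definition lower_face_map (n : nat) (C : category) (i : 'I_n.+1)
  (A B : nArr n.+1 C) (f : hom A B) : hom (lower_face i A) (lower_face i B) :=
  @NatTrans (op (powerset_cat n)) C (lower_face i A) (lower_face i B)
    (fun S => nt_at f (face i S)) (fun T S h => nmap_nat f (face_sub i h)).

Definition upper_face_map (n : nat) (C : category) (i : 'I_n.+1)
  (A B : nArr n.+1 C) (f : hom A B) : hom (upper_face i A) (upper_face i B) :=
  @NatTrans (op (powerset_cat n)) C (upper_face i A) (upper_face i B)
    (fun S => nt_at f (i |: face i S))
    (fun T S h => nmap_nat f (faceU_sub i h)).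

Definition delta_map (n : nat) (C : category) (A B : nArr n.+1 C)
  (f : hom A B) : square (delta_obj A) (delta_obj B).
Proof.
apply: (@Square (nArr n C) (delta_obj A) (delta_obj B)
  (upper_face_map ord_max f) (lower_face_map ord_max f)).
by apply: nattransP => S; exact: (esym (nmap_nat f (face_faceU ord_max S))).
Defined.

Definition delta (n : nat) (C : category) :
  functor (nArr n.+1 C) (Arr (nArr n C)).
Proof.
apply: (@Functor (nArr n.+1 C) (Arr (nArr n C))
  (@delta_obj n C) (@delta_map n C)).
- by move=> A; apply: squareP; apply: nattransP.
- by move=> A B D g f; apply: squareP; apply: nattransP.
Defined.

Definition rho_vertex (n : nat) (C : category) (i : 'I_n.+1)
  (A : nArr n.+1 C) (S : {set 'I_n}) : arrow C :=
  @Arrow C (fobj A (i |: face i S)) (fobj A (face i S))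
    (nmap A (face_faceU i S)).

Definition rho_edge (n : nat) (C : category) (i : 'I_n.+1)
  (A : nArr n.+1 C) (T S : {set 'I_n}) (h : S \subset T) :
  square (rho_vertex i A T) (rho_vertex i A S) :=
  @Square C (rho_vertex i A T) (rho_vertex i A S)
    (nmap A (faceU_sub i h)) (nmap A (face_sub i h))
    (@nt_nat _ _ _ _ (face_arrow i A) T S h).

Definition rho_obj (n : nat) (C : category) (i : 'I_n.+1)
  (A : nArr n.+1 C) : nArr n (Arr C).
Proof.
apply: (@Functor (op (powerset_cat n)) (Arr C) (rho_vertex i A)
  (@rho_edge n C i A)).
- by move=> S; apply: squareP; exact: nmap1.
- by move=> U T S st tu; apply: squareP; exact: nmapM.
Defined.

Definition rho_map (n : nat) (C : category) (i : 'I_n.+1)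
  (A B : nArr n.+1 C) (f : hom A B) : nattrans (rho_obj i A) (rho_obj i B).
Proof.
apply: (@NatTrans (op (powerset_cat n)) (Arr C) (rho_obj i A) (rho_obj i B)
  (fun S => @Square C (rho_vertex i A S) (rho_vertex i B S)
     (nt_at f (i |: face i S)) (nt_at f (face i S))
     (esym (nmap_nat f (face_faceU i S))))) => T S h.
by apply: squareP; exact: nmap_nat.
Defined.

Definition rho (n : nat) (C : category) (i : 'I_n.+1) :
  functor (nArr n.+1 C) (nArr n (Arr C)).
Proof.
apply: (@Functor (nArr n.+1 C) (nArr n (Arr C))
  (@rho_obj n C i) (@rho_map n C i)).
- by move=> A; apply: nattransP => S; apply: squareP.
- by move=> A B D g f; apply: nattransP => S; apply: squareP.
Defined.

Arguments rho {n C} i.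

(* A 0-fold arrow is identified with its value at the empty set. *)
Fixpoint Ecls (C : category) (E : mclass C) (n : nat) : mclass (nArr n C) :=
  match n return mclass (nArr n C) with
  | 0 => fun A B f => E (fobj A set0) (fobj B set0) (nt_at f set0)
  | m.+1 => fun A B f => double_ext (@Ecls C E m) (fmap (delta m C) f)
  end.

Arguments Ecls {C} E n [A B] f.

Definition nExt (C : category) (E : mclass C) (n : nat) : nArr n C -> Prop :=
  match n return nArr n C -> Prop with
  | 0 => fun A => ends E (fobj A set0)
  | m.+1 => fun A => Ecls E m (amor (delta m C A))
  end.

Fixpoint nCExt (C : category) (E : mclass C) (D : C -> Prop) (n : nat) :
  nArr n C -> Prop :=
  match n return nArr n C -> Prop with
  | 0 => fun A => D (fobj A set0)
  | m.+1 => fun A =>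
      nExt E A /\ central_ext (@Ecls C E m) (@nCExt C E D m) (amor (delta m C A))
  end.

Arguments nExt {C} E n A.
Arguments nCExt {C} E D n A.

Definition iota_vertex (n : nat) (C : pcategory) (X : C) (S : {set 'I_n}) : C :=
  if S == setT then X else zero.

Definition iota_edge (n : nat) (C : pcategory) (X : C) (T S : {set 'I_n})
  (h : S \subset T) : hom (iota_vertex X T) (iota_vertex X S) :=
  match T == setT as b, S == setT as b'
    return hom (if b then X else zero) (if b' then X else zero) with
  | true, true => idm X
  | _, _ => zerom _ _
  end.

Definition niota (n : nat) (C : pcategory) (X : C) : nArr n C.
Proof.
apply: (@Functor (op (powerset_cat n)) C (@iota_vertex n C X)
  (@iota_edge n C X)).
- move=> S; rewrite /= /iota_edge /iota_vertex; case: (S == setT) => //.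
  exact: etrans (to0_uniq _) (esym (to0_uniq _)).
- move=> U T S st tu; rewrite /= /iota_edge /iota_vertex.
  have: (S == setT) ==> (T == setT).
    by apply/implyP => /eqP Sfull; rewrite -subTset -Sfull.
  have: (T == setT) ==> (U == setT).
    by apply/implyP => /eqP Tfull; rewrite -subTset -Tfull.
  by case: (U == setT); case: (T == setT); case: (S == setT) => // _ _;
    rewrite ?compm1 ?comp1m ?zerom_l ?zerom_r.
Defined.

(* The identification of [X] with the value at the top of [niota n X]. *)
Definition iota_top (n : nat) (C : pcategory) (X : C) :
  hom X (fobj (niota n X) setT) :=
  match setT == setT :> {set 'I_n} as b
    return hom X (if b then X else zero) with
  | true => idm X
  | false => zerom X zero
  end.

(* [x : X -> A_n] represents the subobject [A]_n: it is the top component of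
   a kernel [niota n X -> A] of the unit of the reflector [I] at [A]. *)
Definition is_bracket (n : nat) (C : pcategory) (Z D : nArr n C -> Prop)
  (I : reflector Z D) (A : full Z) (X : C) (x : hom X (fobj (sval A) setT)) :=
  exists k : @hom (nArr n C) (niota n X) (sval A),
    @is_kernel (pnArr n C) _ _ _ k (refl_unit I A) /\
    nt_at k setT ∘ iota_top n X = x.

(* [iota^1] as a map to [Arr C]. *)
Definition arr_iota (C : pcategory) (X : C) : Arr C :=
  @Arrow C X zero (to0 X).

Definition same_subobject (C : category) (X Y A : C)
  (x : hom X A) (y : hom Y A) :=
  is_mono x /\ is_mono y /\ exists h : hom X Y, is_iso h /\ y ∘ h = x.

(* Main.v *)
Require Import Defs.
From mathcomp Require Import all_boot.
From mathcomp Require Import boolp.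

(** An extension [f], with kernel pair [R] and projections [d0] and [d1], is
central exactly when [d0] and [d1] agree on the bracket of [R], the kernel of the
unit of [R]; equivalently, when an element [(0, y)] of this bracket is zero
([central_projections], [central_of_zero]).  The reflection of an extension
[a : A -> D] to central ones divides [A] by the [y] with [(0, y)] in the bracket
of the kernel pair of [a] ([central_quotient]).  From this description the setting
reproduces itself on arrows: double extensions form a class of extensions
([double_ext_class]) and central extensions are strongly Birkhoff among them
([central_strongly_birkhoff]).

For a square of extensions, applying the criterion twice replaces the kernel pair
by the object [Q] of two-by-two matrices whose rows and columns are related by
the two maps out of the initial vertex.  The square is a double central extension
exactly when a matrix in the bracket of [Q] that vanishes in three corners
vanishes ([central_iff_corner]).  This condition is invariant under transposition,
so centrality does not depend on which of the two directions comes first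
([central_transpose]).

A cube is an iterated arrow, and the recursive definitions of extensions and
central extensions only involve pullbacks, isomorphisms and reflections, so they
can be compared along equivalences of categories ([transports]).  By the symmetry
of squares, every direction of a cube may serve as the last one
([direction_transports]), and the outermost direction may be moved inside
([arrows_inside_transports]).  The functor [rho i] takes direction [i] out and
moves it inside; it is therefore an equivalence that preserves and reflects extensions and
central extensions ([rho_transports]).

Such an equivalence carries reflections to reflections, which gives the square of
functors.  The unit of an extension is invertible at every vertex of the cube but
the initial one ([nArr_reflection_iso]), since the quotient above changes domains
only and elements of a kernel come from the bracket of a kernel pair.  Both
brackets are thus kernels of the unit at the initial vertex ([niota_kernel]), and
they agree because [rho i] preserves units. *)

Set Implicit Arguments.
Unset Strict Implicit.
Unset Printing Implicit Defensive.

Local Open Scope cat_scope.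

(** * Pullbacks, kernels and isomorphisms *)

Section Basics.
Variable C : category.
Implicit Types A B D P T : C.

Lemma comp_eq A B D (g : hom B D) (f : hom A B) (h : hom A D) :
  g ∘ f = h -> forall T (e : hom T A), g ∘ (f ∘ e) = h ∘ e.
Proof. by move=> <- T e; rewrite compmA. Qed.

Lemma pb_comm A B D P (f : hom A B) (g : hom D B) (p : hom P A) (q : hom P D) :
  is_pullback f g p q -> f ∘ p = g ∘ q.
Proof. by case. Qed.

Lemma pb_lift A B D P (f : hom A B) (g : hom D B) (p : hom P A) (q : hom P D) :
  is_pullback f g p q -> forall T (a : hom T A) (d : hom T D),
  f ∘ a = g ∘ d -> exists t : hom T P, p ∘ t = a /\ q ∘ t = d.
Proof. by case=> _ h T a d /h [t [? _]]; exists t. Qed.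

Lemma pb_mono A B D P (f : hom A B) (g : hom D B) (p : hom P A) (q : hom P D) :
  is_pullback f g p q -> forall T (u v : hom T P),
  p ∘ u = p ∘ v -> q ∘ u = q ∘ v -> u = v.
Proof.
case=> e h T u v pu qu; have [|t [_ tU]] := h T (p ∘ u) (q ∘ u).
  by rewrite !compmA e.
by rewrite -(tU u) // -(tU v).
Qed.

Lemma pb_intro A B D P (f : hom A B) (g : hom D B) (p : hom P A) (q : hom P D) :
  f ∘ p = g ∘ q ->
  (forall T (a : hom T A) (d : hom T D), f ∘ a = g ∘ d ->
     exists t : hom T P, p ∘ t = a /\ q ∘ t = d) ->
  (forall T (u v : hom T P), p ∘ u = p ∘ v -> q ∘ u = q ∘ v -> u = v) ->
  is_pullback f g p q.
Proof.
move=> e h m; split=> // T a d /h [t [pt qt]]; exists t; split=> // t' [pt' qt'].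
by apply: m; rewrite ?pt ?qt.
Qed.

Lemma pb_sym A B D P (f : hom A B) (g : hom D B) (p : hom P A) (q : hom P D) :
  is_pullback f g p q -> is_pullback g f q p.
Proof.
move=> pb; apply: pb_intro; first by rewrite (pb_comm pb).
- by move=> T a d /esym/(pb_lift pb) [t [? ?]]; exists t.
- by move=> T u v qu pu; exact: (pb_mono pb).
Qed.

Lemma pb_id A B (f : hom A B) : is_pullback f (idm B) (idm A) f.
Proof.
apply: pb_intro; rewrite ?compm1 ?comp1m //.
- by move=> T a d; rewrite comp1m => <-; exists a; rewrite comp1m.
- by move=> T u v; rewrite !comp1m.
Qed.

Lemma iso_id A : is_iso (idm A).
Proof. by exists (idm A); rewrite comp1m. Qed.

Lemma iso_comp A B D (g : hom B D) (f : hom A B) :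
  is_iso g -> is_iso f -> is_iso (g ∘ f).
Proof.
move=> [g' [gK Kg]] [f' [fK Kf]]; exists (f' ∘ g'); split.
- by rewrite -compmA (comp_eq gK) comp1m.
- by rewrite -compmA (comp_eq Kf) comp1m.
Qed.

Lemma iso_mono A B (f : hom A B) : is_iso f -> is_mono f.
Proof.
by move=> [g [gK _]] T u v e; rewrite -(comp1m u) -gK -compmA e compmA gK comp1m.
Qed.

Lemma iso_epi A B (f : hom A B) : is_iso f ->
  forall T (u v : hom B T), u ∘ f = v ∘ f -> u = v.
Proof.
by move=> [g [_ Kg]] T u v e; rewrite -(compm1 u) -Kg compmA e -compmA Kg compm1.
Qed.

Lemma iso_inv A B (f : hom A B) : is_iso f ->
  exists2 g : hom B A, is_iso g & g ∘ f = idm A /\ f ∘ g = idm B.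
Proof. by case=> g [gf fg]; exists g => //; exists f. Qed.

Lemma regepi_epi A B (f : hom A B) : is_regular_epi f ->
  forall T (u v : hom B T), u ∘ f = v ∘ f -> u = v.
Proof.
move=> [R [x [y [e h]]]] T u v uv.
have [|w [_ wU]] := h T (u ∘ f); first by rewrite -!compmA e.
by rewrite -(wU u) // -(wU v).
Qed.

Lemma regepi_mono_iso A B (f : hom A B) :
  is_regular_epi f -> is_mono f -> is_iso f.
Proof.
move=> fe fm; have [R [x [y [e h]]]] := fe.
have [|g [gf _]] := h A (idm A); first by rewrite !comp1m; exact: fm.
exists g; split=> //; apply: (regepi_epi fe).
by rewrite -compmA gf comp1m compm1.
Qed.

(** A regular epimorphism, being a coequalizer of some pair, is a coequalizer
of its kernel pair, which contains every pair that it coequalizes. *)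
Lemma regepi_kernel_pair R A B (d0 d1 : hom R A) (f : hom A B) :
  is_regular_epi f -> is_kernel_pair d0 d1 f -> is_coequalizer d0 d1 f.
Proof.
move=> fe kp; split; first exact: pb_comm kp.
move=> T g gd; have [S [x [y [e h]]]] := fe.
apply: h; have [t [<- <-]] := pb_lift kp e.
by rewrite !compmA gd.
Qed.

End Basics.

Definition has_pullbacks (C : category) :=
  forall (A B D : C) (f : hom A B) (g : hom D B),
  exists (P : C) (p : hom P A) (q : hom P D), is_pullback f g p q.

Section Pointed.
Variable C : pcategory.
Implicit Types A B D K T : C.

Lemma to0_eq A (f g : hom A (zero : C)) : f = g.
Proof. by rewrite (to0_uniq f) (to0_uniq g). Qed.

Lemma from0_eq A (f g : hom (zero : C) A) : f = g.
Proof. by rewrite (from0_uniq f) (from0_uniq g). Qed.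

Lemma ker_lift K A B (k : hom K A) (f : hom A B) : is_kernel k f ->
  forall T (t : hom T A), f ∘ t = zerom T B -> exists u : hom T K, k ∘ u = t.
Proof. by case=> _ h T t /h [u [? _]]; exists u. Qed.

Lemma ker_mono K A B (k : hom K A) (f : hom A B) : is_kernel k f -> is_mono k.
Proof.
case=> e h T u v uv; have [|w [_ wU]] := h T (k ∘ u).
  by rewrite compmA e zerom_l.
by rewrite -(wU u) // -(wU v).
Qed.

Lemma ker_intro K A B (k : hom K A) (f : hom A B) :
  f ∘ k = zerom K B ->
  (forall T (t : hom T A), f ∘ t = zerom T B -> exists u : hom T K, k ∘ u = t) ->
  is_mono k -> is_kernel k f.
Proof.
move=> e h m; split=> // T t /h [u ku]; exists u; split=> // v kv.
by apply: m; rewrite ku kv.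
Qed.

Lemma ker_exists A B (f : hom A B) : has_pullbacks C ->
  exists (K : C) (k : hom K A), is_kernel k f.
Proof.
move=> hp; have [K [k [z pb]]] := hp _ _ _ f (from0 B).
exists K, k; apply: ker_intro.
- by rewrite (pb_comm pb) (to0_uniq z).
- by move=> T t e; have [u [ku _]] := pb_lift pb (e : _ = _ ∘ to0 T); exists u.
- by move=> T u v e; apply: (pb_mono pb) => //; exact: to0_eq.
Qed.

Lemma pb_kernel K A B (k : hom K A) (f : hom A B) :
  is_kernel k f -> is_pullback f (from0 B) k (to0 K).
Proof.
move=> kf; apply: pb_intro; first exact: (proj1 kf).
- move=> T a d e; have [|u ku] := ker_lift kf (t := a).
    by rewrite e (to0_uniq d).
  by exists u; split=> //; exact: to0_eq.
- by move=> T u v e _; exact: (ker_mono kf).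
Qed.

Lemma pullback_kernel A B D P L (f : hom A B) (g : hom D B) (p : hom P A)
  (q : hom P D) (j : hom L D) :
  is_pullback f g p q -> is_kernel j g ->
  exists w : hom L P, is_kernel w p /\ q ∘ w = j.
Proof.
move=> pb kj; have [|w [w0 w1]] := pb_lift pb (a := zerom L A) (d := j).
  by rewrite zerom_r (proj1 kj).
exists w; split=> //; apply: ker_intro => //.
- move=> T t pt; have [|v jv] := ker_lift kj (t := q ∘ t).
    by rewrite compmA -(pb_comm pb) -compmA pt zerom_r.
  exists v; apply: (pb_mono pb); rewrite compmA ?w1 //.
  by rewrite w0 zerom_l pt.
- by move=> T x y xy; apply: (ker_mono kj); rewrite -w1 -!compmA xy.
Qed.

Lemma kernel_map (a b : arrow C) (f : square a b) K L (i : hom K (adom a))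
  (j : hom L (adom b)) :
  is_kernel i (amor a) -> is_kernel j (amor b) ->
  exists k : hom K L, j ∘ k = sq1 f ∘ i.
Proof.
move=> ki kj; apply: (ker_lift kj).
by rewrite compmA sqC -compmA (proj1 ki) zerom_r.
Qed.

Lemma ker_conj K A B A' B' (k : hom K A) (f : hom A B)
  (f' : hom A' B') (i : hom A A') (j : hom B B') :
  is_iso i -> is_iso j -> f' ∘ i = j ∘ f -> is_kernel k f -> is_kernel (i ∘ k) f'.
Proof.
move=> ii ji e kf; have [i' [i'i ii']] := ii; apply: ker_intro.
- by rewrite compmA e -compmA (proj1 kf) zerom_r.
- move=> T t ft; have [|u ku] := ker_lift kf (t := i' ∘ t).
    apply: (iso_mono ji).
    by rewrite compmA -e -compmA (comp_eq ii') comp1m ft zerom_r.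
  by exists u; rewrite -compmA ku (comp_eq ii') comp1m.
- by move=> T u v; rewrite -!compmA => /(iso_mono ii) /(ker_mono kf).
Qed.

Lemma ker_unique K L A B (k : hom K A) (l : hom L A) (f : hom A B) :
  is_kernel k f -> is_kernel l f ->
  exists h : hom K L, is_iso h /\ l ∘ h = k.
Proof.
move=> kf lf; have [h lh] := ker_lift lf (proj1 kf).
have [g kg] := ker_lift kf (proj1 lf).
exists h; split=> //; exists g; split.
- by apply: (ker_mono kf); rewrite compmA kg lh compm1.
- by apply: (ker_mono lf); rewrite compmA lh kg compm1.
Qed.

End Pointed.

(** * Protomodular categories *)

(** The part of semi-abelianness on which the argument rests; each clause passes
to the category of arrows componentwise. *)
Record exact_protomodular (C : pcategory) : Prop := ExactProtomodular {
  ep_pb : has_pullbacks C;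
  ep_proto : is_protomodular C;
  ep_quot : forall (R A : C) (d0 d1 : hom R A),
    is_equivalence_relation d0 d1 ->
    exists (Q : C) (q : hom A Q), is_kernel_pair d0 d1 q /\ is_coequalizer d0 d1 q }.

Section Protomodular.
Variable C : pcategory.
Hypothesis hC : exact_protomodular C.
Implicit Types A B D K T X Y : C.

Lemma equalizer_exists A T (f g : hom A T) :
  exists (M : C) (m : hom M A), [/\ f ∘ m = g ∘ m, is_mono m
    & forall W (w : hom W A), f ∘ w = g ∘ w -> exists u, m ∘ u = w].
Proof.
have [TT [t1 [t2 pbT]]] := ep_pb hC (to0 T) (to0 T).
have [fg [e1 e2]] := pb_lift pbT (to0_eq (to0 T ∘ f) (to0 T ∘ g)).
have [dd [e3 e4]] := pb_lift pbT (erefl (to0 T ∘ idm T)).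
have [M [m [x pbM]]] := ep_pb hC fg dd.
have e := pb_comm pbM.
have fm : f ∘ m = x by rewrite -e1 -compmA e compmA e3 comp1m.
have gm : g ∘ m = x by rewrite -e2 -compmA e compmA e4 comp1m.
exists M, m; split; first by rewrite fm gm.
- move=> W u v uv; apply: (pb_mono pbM) => //.
  by rewrite -fm -!compmA uv.
- move=> W w fgw; have [|u [mu _]] := pb_lift pbM (a := w) (d := f ∘ w).
    apply: (pb_mono pbT); rewrite !compmA.
    + by rewrite e1 e3 comp1m.
    + by rewrite e2 e4 comp1m.
  by exists u.
Qed.

(** Protomodularity over the zero object: a split epimorphism is generated by
its kernel and its section. *)
Lemma split_ext_strong X B K M (p : hom X B) (s : hom B X) (k : hom K X)
  (m : hom M X) (k' : hom K M) (s' : hom B M) :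
  p ∘ s = idm B -> is_kernel k p -> is_mono m -> m ∘ k' = k -> m ∘ s' = s ->
  is_iso m.
Proof.
move=> ps kp mm mk ms.
have pbK := pb_sym (pb_kernel kp).
have pbM : is_pullback (from0 B) (p ∘ m) (to0 K) k'.
  apply: pb_intro; first by rewrite -compmA mk (proj1 kp).
  - move=> T a d e; have [|u ku] := ker_lift kp (t := m ∘ d).
      by rewrite compmA -e (to0_uniq a).
    exists u; split; first exact: to0_eq.
    by apply: mm; rewrite compmA mk.
  - move=> T u v _ e; apply: (ker_mono kp).
    by rewrite -mk -!compmA e.
apply: (ep_proto hC (v := from0 B) (p := p ∘ m) (s := s') (q := p) (t := s)
  (h := m) _ ps erefl ms pbM pbK (h' := idm K)); last exact: iso_id.
- by rewrite -compmA ms.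
- by rewrite compm1.
- by rewrite compm1 mk.
Qed.

Lemma split_ext_epi X B K T (p : hom X B) (s : hom B X) (k : hom K X)
  (u v : hom X T) :
  p ∘ s = idm B -> is_kernel k p -> u ∘ k = v ∘ k -> u ∘ s = v ∘ s -> u = v.
Proof.
move=> ps kp uk us; have [M [m [em mm lm]]] := equalizer_exists u v.
have [k' mk] := lm _ _ uk; have [s' ms] := lm _ _ us.
exact: iso_epi (split_ext_strong ps kp mm mk ms) _ _ _ em.
Qed.

Lemma kernel_pair_split R A B (d0 d1 : hom R A) (f : hom A B) :
  is_kernel_pair d0 d1 f ->
  exists s : hom A R, d0 ∘ s = idm A /\ d1 ∘ s = idm A.
Proof. by move=> kp; apply: (pb_lift kp). Qed.

Lemma kernel_pair_kernel R A B K (d0 d1 : hom R A) (f : hom A B) (k : hom K A) :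
  is_kernel_pair d0 d1 f -> is_kernel k f ->
  exists k' : hom K R, is_kernel k' d0 /\ d1 ∘ k' = k.
Proof. exact: pullback_kernel. Qed.

(** The kernel pair of [f] is split over [A] and the kernel of its first
projection vanishes, so the diagonal is invertible. *)
Lemma zero_kernel_mono A B (f : hom A B) :
  (forall T (e : hom T A), f ∘ e = zerom T B -> e = zerom T A) -> is_mono f.
Proof.
move=> f0; have [R [d0 [d1 kp]]] := ep_pb hC f f.
have [s [s0 s1]] := kernel_pair_split kp.
have kz : is_kernel (from0 R) d0.
  apply: ker_intro; first by rewrite (from0_uniq (d0 ∘ _)) (from0_uniq (zerom _ _)).
  - move=> T t d0t; exists (to0 T); apply/esym/(pb_mono kp).
      by rewrite d0t -/(zerom T R) zerom_r.
    rewrite -/(zerom T R) zerom_r; apply: f0.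
    by rewrite compmA -(pb_comm kp) -compmA d0t zerom_r.
  - by move=> T u v _; exact: to0_eq.
have sm : is_mono s.
  by move=> T u v e; rewrite -(comp1m u) -(comp1m v) -s0 -!compmA e.
have si : is_iso s.
  by apply: (split_ext_strong s0 kz sm (from0_uniq (s ∘ from0 A)) (compm1 s)).
have d01 : d0 = d1 by apply: (iso_epi si); rewrite s0 s1.
move=> T u v fuv; have [t [<- <-]] := pb_lift kp fuv.
by rewrite d01.
Qed.

Lemma regepi_zero_kernel_iso A B (f : hom A B) : is_regular_epi f ->
  (forall T (e : hom T A), f ∘ e = zerom T B -> e = zerom T A) -> is_iso f.
Proof. by move=> fe /zero_kernel_mono; exact: regepi_mono_iso. Qed.

(** A map vanishing on the kernel of [f] identifies the two projections of the
kernel pair, since it does so on the diagonal and on the kernel of [d0]. *)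
Lemma regepi_cokernel A B K (f : hom A B) (k : hom K A) :
  is_regular_epi f -> is_kernel k f -> is_cokernel k f.
Proof.
move=> fe kf; split; first exact: (proj1 kf).
move=> T t tk; have [R [d0 [d1 kp]]] := ep_pb hC f f.
have [s [s0 s1]] := kernel_pair_split kp.
have [k' [kk' d1k']] := kernel_pair_kernel kp kf.
apply: (proj2 (regepi_kernel_pair fe kp)).
apply: (split_ext_epi s0 kk'); rewrite -!compmA.
- by rewrite (proj1 kk') d1k' tk zerom_r.
- by rewrite s0 s1.
Qed.

Lemma regepi_short_exact A B K (f : hom A B) (k : hom K A) :
  is_regular_epi f -> is_kernel k f -> is_short_exact k f.
Proof. by move=> fe kf; split=> //; exact: regepi_cokernel. Qed.

(** Points over a fixed object form a unital category: a product of two points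
is generated by the factors.  This is protomodularity over [S]. *)
Lemma points_unital X Y S T M (p : hom X S) (s : hom S X) (q : hom Y S)
  (t : hom S Y) (tX : hom T X) (tY : hom T Y) (m : hom M T)
  (x : hom X M) (y : hom Y M) :
  p ∘ s = idm S -> q ∘ t = idm S -> is_pullback p q tX tY -> is_mono m ->
  tX ∘ (m ∘ x) = idm X -> tY ∘ (m ∘ x) = t ∘ p ->
  tX ∘ (m ∘ y) = s ∘ q -> tY ∘ (m ∘ y) = idm Y ->
  is_iso m.
Proof.
move=> ps qt pb mm x1 x2 y1 y2.
have pbT : is_pullback t tY p (m ∘ x).
  apply: pb_intro; first by rewrite x2.
  - move=> W a d e; exists (tX ∘ d).
    have pd : p ∘ (tX ∘ d) = a.
      by rewrite compmA (pb_comm pb) -compmA -e compmA qt comp1m.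
    split=> //; apply: (pb_mono pb).
    + by rewrite compmA x1 comp1m.
    + by rewrite compmA x2 -compmA pd e.
  - by move=> W u v _ e; rewrite -(comp1m u) -(comp1m v) -x1 -!(compmA tX) e.
have pbM : is_pullback t (tY ∘ m) p x.
  apply: pb_intro; first by rewrite -compmA x2.
  - move=> W a d e; have [|u [u1 u2]] := pb_lift pbT (a := a) (d := m ∘ d).
      by rewrite e compmA.
    by exists u; split=> //; apply: mm; rewrite compmA.
  - by move=> W u v e1 e2; apply: (pb_mono pbT) => //; rewrite -!compmA e2.
apply: (ep_proto hC (v := t) (p := tY ∘ m) (s := y) (q := tY)
  (t := m ∘ y) (h := m) _ y2 erefl erefl pbM pbT (h' := idm X)); last exact: iso_id.
- by rewrite -compmA.
- by rewrite compm1.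
- by rewrite compm1.
Qed.

(** Protomodular categories are Mal'tsev: a reflexive relation is difunctional,
by [points_unital] applied to the triples [x S y], [z S y], [z S w] over the
middle pair, and so it is an equivalence relation. *)
Lemma reflexive_equivalence S A (d0 d1 : hom S A) (r : hom A S) :
  (forall T (u v : hom T S), d0 ∘ u = d0 ∘ v -> d1 ∘ u = d1 ∘ v -> u = v) ->
  d0 ∘ r = idm A -> d1 ∘ r = idm A -> is_equivalence_relation d0 d1.
Proof.
move=> sm r0 r1.
have difun : forall T (u v w : hom T S), d1 ∘ u = d1 ∘ v -> d0 ∘ v = d0 ∘ w ->
    exists z : hom T S, d0 ∘ z = d0 ∘ u /\ d1 ∘ z = d1 ∘ w.
  have [X [a [b pbX]]] := ep_pb hC d1 d1.
  have [Y [c [d pbY]]] := ep_pb hC d0 d0.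
  have [T [tX [tY pbT]]] := ep_pb hC b c.
  have [sX [as_ bs]] := pb_lift pbX (erefl (d1 ∘ idm S)).
  have [sY [cs ds]] := pb_lift pbY (erefl (d0 ∘ idm S)).
  have [AA [p1 [p2 pbA]]] := ep_pb hC (to0 A) (to0 A).
  have [j [j1 j2]] := pb_lift pbA (to0_eq (to0 A ∘ d0) (to0 A ∘ d1)).
  have [o [o1 o2]] := pb_lift pbA (to0_eq
    (to0 A ∘ (d0 ∘ (a ∘ tX))) (to0 A ∘ (d1 ∘ (d ∘ tY)))).
  have [M [m [n pbM]]] := ep_pb hC o j.
  have jm : is_mono j.
    by move=> W u v e; apply: sm; rewrite -?j1 -?j2 -!compmA e.
  have mm : is_mono m.
    move=> W u v e; apply: (pb_mono pbM) => //; apply: jm.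
    by rewrite !compmA -(pb_comm pbM) -!compmA e.
  have lm : forall W (w : hom W T) (z : hom W S), d0 ∘ z = d0 ∘ (a ∘ (tX ∘ w)) ->
      d1 ∘ z = d1 ∘ (d ∘ (tY ∘ w)) -> exists u, m ∘ u = w.
    move=> W w z e0 e1; have [|u [mu _]] := pb_lift pbM (a := w) (d := z).
      apply: (pb_mono pbA); rewrite !compmA ?o1 ?o2 ?j1 ?j2 -!compmA.
      + by rewrite e0.
      + by rewrite e1.
    by exists u.
  have [|gx [gx1 gx2]] := pb_lift pbT (a := idm X) (d := sY ∘ b).
    by rewrite compm1 compmA cs comp1m.
  have [|gy [gy1 gy2]] := pb_lift pbT (a := sX ∘ c) (d := idm Y).
    by rewrite compm1 compmA bs comp1m.
  have [||x mx] := lm _ gx a.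
  - by rewrite gx1 compm1.
  - by rewrite gx2 (comp_eq ds) comp1m (pb_comm pbX).
  have [||y my] := lm _ gy d.
  - by rewrite gy1 (comp_eq as_) comp1m (pb_comm pbY).
  - by rewrite gy2 compm1.
  have [m' [_ mK]] : is_iso m.
    have pu := points_unital (x := x) (y := y) bs cs pbT mm.
    by apply: pu; rewrite ?mx ?my ?gx1 ?gx2 ?gy1 ?gy2.
  move=> W u v w uv vw.
  have [ux [ux1 ux2]] := pb_lift pbX uv; have [wy [wy1 wy2]] := pb_lift pbY vw.
  have [|t [t1 t2]] := pb_lift pbT (a := ux) (d := wy); first by rewrite ux2 wy1.
  exists (n ∘ (m' ∘ t)).
  have e : j ∘ (n ∘ (m' ∘ t)) = o ∘ t.
    by rewrite compmA -(pb_comm pbM) -compmA (comp_eq mK) comp1m.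
  rewrite -{1}j1 -{1}j2 -!compmA e !compmA o1 o2 -!compmA t1 t2.
  by rewrite ux1 wy2.
split=> //.
- by exists r.
- have [||z [z0 z1]] := difun _ (r ∘ d1) (idm S) (r ∘ d0).
  + by rewrite compmA r1 comp1m compm1.
  + by rewrite compmA r0 comp1m compm1.
  exists z; rewrite z0 z1.
  by rewrite !compmA r0 r1 !comp1m.
- move=> P p q pb; have [||z [z0 z1]] := difun _ p (r ∘ (d1 ∘ p)) q.
  + by rewrite (comp_eq r1) comp1m.
  + by rewrite (comp_eq r0) comp1m (pb_comm pb).
  by exists z.
Qed.

End Protomodular.

(** * The category of arrows *)

Section ArrCategory.
Variable C : category.
Implicit Types a b d : arrow C.

Lemma sq1_congr a b (s t : square a b) : s = t -> sq1 s = sq1 t.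
Proof. by move->. Qed.

Lemma sq0_congr a b (s t : square a b) : s = t -> sq0 s = sq0 t.
Proof. by move->. Qed.

Lemma arr_pb_intro a b d p (f : square a b) (g : square d b)
  (pa : square p a) (pd : square p d) :
  is_pullback (sq1 f) (sq1 g) (sq1 pa) (sq1 pd) ->
  is_pullback (sq0 f) (sq0 g) (sq0 pa) (sq0 pd) ->
  @is_pullback (Arr C) a b d p f g pa pd.
Proof.
move=> pb1 pb0; apply: pb_intro.
- by apply: squareP; [exact: pb_comm pb1 | exact: pb_comm pb0].
- move=> t x y e; have e1 := sq1_congr e; have e0 := sq0_congr e.
  have [u1 [xu1 yu1]] := pb_lift pb1 e1.
  have [u0 [xu0 yu0]] := pb_lift pb0 e0.
  have uC : p ∘ u1 = u0 ∘ t.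
    apply: (pb_mono pb0); rewrite !compmA.
    + by rewrite xu0 -(sqC pa) -(sqC x) -compmA xu1.
    + by rewrite yu0 -(sqC pd) -(sqC y) -compmA yu1.
  by exists (Square uC); split; exact: squareP.
- move=> t u v e e'; apply: squareP.
  + exact: (pb_mono pb1 (sq1_congr e) (sq1_congr e')).
  + exact: (pb_mono pb0 (sq0_congr e) (sq0_congr e')).
Qed.

Lemma arr_pb_build a b d (f : square a b) (g : square d b)
  P1 (p1 : hom P1 (adom a)) (q1 : hom P1 (adom d))
  P0 (p0 : hom P0 (acod a)) (q0 : hom P0 (acod d)) :
  is_pullback (sq1 f) (sq1 g) p1 q1 -> is_pullback (sq0 f) (sq0 g) p0 q0 ->
  exists (c : hom P1 P0) (pa : square (Arrow c) a) (pd : square (Arrow c) d),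
  [/\ sq1 pa = p1, sq0 pa = p0, sq1 pd = q1, sq0 pd = q0
    & @is_pullback (Arr C) a b d (Arrow c) f g pa pd].
Proof.
move=> pb1 pb0; have [|c [pc qc]] := pb_lift pb0 (a := a ∘ p1) (d := d ∘ q1).
  by rewrite !compmA -!sqC -!compmA (pb_comm pb1).
exists c, (@Square _ (Arrow c) a p1 p0 (esym pc)),
  (@Square _ (Arrow c) d q1 q0 (esym qc)).
by split=> //; exact: arr_pb_intro.
Qed.

Lemma arr_has_pullbacks : has_pullbacks C -> has_pullbacks (Arr C).
Proof.
move=> hp a b d f g; have [P1 [p1 [q1 pb1]]] := hp _ _ _ (sq1 f) (sq1 g).
have [P0 [p0 [q0 pb0]]] := hp _ _ _ (sq0 f) (sq0 g).
have [c [pa [pd [_ _ _ _ pb]]]] := arr_pb_build pb1 pb0.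
by exists (Arrow c), pa, pd.
Qed.

(** Maps from the identity arrow on [T] represent the domain functor. *)
Definition dom_test a T (x : hom T (adom a)) : square (Arrow (idm T)) a :=
  @Square C (Arrow (idm T)) a x (a ∘ x) (esym (compm1 _)).

Lemma dom_testE a b (f : square a b) T (x : hom T (adom a)) :
  @compm (Arr C) _ _ _ f (dom_test x) = dom_test (sq1 f ∘ x).
Proof. by apply: squareP => //=; rewrite !compmA sqC. Qed.

Lemma arr_pb_sq1 a b d p (f : square a b) (g : square d b)
  (pa : square p a) (pd : square p d) :
  @is_pullback (Arr C) a b d p f g pa pd ->
  is_pullback (sq1 f) (sq1 g) (sq1 pa) (sq1 pd).
Proof.
move=> pb; apply: pb_intro; first exact: (sq1_congr (pb_comm pb)).
- move=> T x y e.
  have [|u [xu yu]] := pb_lift pb (a := dom_test x) (d := dom_test y).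
    by rewrite !dom_testE e.
  by exists (sq1 u); split; [exact: (sq1_congr xu) | exact: (sq1_congr yu)].
- move=> T u v e e'; apply: (sq1_congr (s := dom_test u) (t := dom_test v)).
  by apply: (pb_mono pb); rewrite !dom_testE ?e ?e'.
Qed.

Lemma arr_iso_intro a b (f : square a b) :
  is_iso (sq1 f) -> is_iso (sq0 f) -> @is_iso (Arr C) a b f.
Proof.
move=> [g1 [gf1 fg1]] [g0 [gf0 fg0]].
have gC : a ∘ g1 = g0 ∘ b.
  by rewrite -(comp1m (_ ∘ g1)) -gf0 -!compmA (comp_eq (esym (sqC f))) -!compmA
    fg1 compm1.
by exists (Square gC); split; exact: squareP.
Qed.

Lemma arr_iso_sq1 a b (f : square a b) : @is_iso (Arr C) a b f -> is_iso (sq1 f).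
Proof.
by move=> [g [gf fg]]; exists (sq1 g);
  split; [exact: (sq1_congr gf) | exact: (sq1_congr fg)].
Qed.

Lemma arr_iso_sq0 a b (f : square a b) : @is_iso (Arr C) a b f -> is_iso (sq0 f).
Proof.
by move=> [g [gf fg]]; exists (sq0 g);
  split; [exact: (sq0_congr gf) | exact: (sq0_congr fg)].
Qed.

Lemma arr_epi_intro a b (f : square a b) :
  (forall T (u v : hom (adom b) T), u ∘ sq1 f = v ∘ sq1 f -> u = v) ->
  (forall T (u v : hom (acod b) T), u ∘ sq0 f = v ∘ sq0 f -> u = v) ->
  forall d (u v : @hom (Arr C) b d),
  u ∘ (f : @hom (Arr C) a b) = v ∘ (f : @hom (Arr C) a b) -> u = v.
Proof.
move=> e1 e0 d u v e; apply: squareP.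
- exact: e1 (sq1_congr e).
- exact: e0 (sq0_congr e).
Qed.

Lemma arr_coequalizer_intro r a b (u v : square r a) (f : square a b) :
  is_coequalizer (sq1 u) (sq1 v) (sq1 f) ->
  is_coequalizer (sq0 u) (sq0 v) (sq0 f) ->
  @is_coequalizer (Arr C) r a b u v f.
Proof.
move=> c1 c0; have r1 : is_regular_epi (sq1 f) by exists (adom r), (sq1 u), (sq1 v).
have r0 : is_regular_epi (sq0 f) by exists (acod r), (sq0 u), (sq0 v).
split; first by apply: squareP; [exact: (proj1 c1) | exact: (proj1 c0)].
move=> t g e; have [h1 [h1E _]] := proj2 c1 _ _ (sq1_congr e).
have [h0 [h0E _]] := proj2 c0 _ _ (sq0_congr e).
have hC : t ∘ h1 = h0 ∘ b.
  by apply: (regepi_epi r1); rewrite -!compmA h1E (sqC f) compmA h0E sqC.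
exists (Square hC); split; first exact: squareP.
move=> h' h'E; apply: (arr_epi_intro (f := f)).
- exact: regepi_epi.
- exact: regepi_epi.
- by rewrite h'E; apply: squareP.
Qed.

End ArrCategory.

Section ArrPointed.
Variable C : pcategory.
Implicit Types a b d : arrow C.

(** Maps from the arrow [0 -> T] represent the codomain functor. *)
Definition cod_test a T (x : hom T (acod a)) : square (Arrow (from0 T)) a :=
  @Square C (Arrow (from0 T)) a (from0 _) x (from0_eq _ _).

Lemma cod_testE a b (f : square a b) T (x : hom T (acod a)) :
  @compm (Arr C) _ _ _ f (cod_test x) = cod_test (sq0 f ∘ x).
Proof. by apply: squareP => //=; exact: from0_eq. Qed.

Lemma arr_pb_sq0 a b d p (f : square a b) (g : square d b)
  (pa : square p a) (pd : square p d) :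
  @is_pullback (Arr C) a b d p f g pa pd ->
  is_pullback (sq0 f) (sq0 g) (sq0 pa) (sq0 pd).
Proof.
move=> pb; apply: pb_intro; first exact: (sq0_congr (pb_comm pb)).
- move=> T x y e.
  have [|u [xu yu]] := pb_lift pb (a := cod_test x) (d := cod_test y).
    by rewrite !cod_testE e.
  by exists (sq0 u); split; [exact: (sq0_congr xu) | exact: (sq0_congr yu)].
- move=> T u v e e'; apply: (sq0_congr (s := cod_test u) (t := cod_test v)).
  by apply: (pb_mono pb); rewrite !cod_testE ?e ?e'.
Qed.

Lemma dom_test0 a T : dom_test (zerom T (adom a)) = zerom _ _ :> @hom (pArr C) _ a.
Proof. by apply: squareP => //=; rewrite zerom_r. Qed.

Lemma cod_test0 a T : cod_test (zerom T (acod a)) = zerom _ _ :> @hom (pArr C) _ a.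
Proof. by apply: squareP => //=; exact: from0_eq. Qed.

Lemma arr_ker_intro k a b (i : square k a) (f : square a b) :
  is_kernel (sq1 i) (sq1 f) -> is_kernel (sq0 i) (sq0 f) ->
  @is_kernel (pArr C) k a b i f.
Proof.
move=> k1 k0; apply: ker_intro.
- by apply: squareP; [exact: (proj1 k1) | exact: (proj1 k0)].
- move=> t x e; have [u1 u1E] := ker_lift k1 (sq1_congr e).
  have [u0 u0E] := ker_lift k0 (sq0_congr e).
  have uC : k ∘ u1 = u0 ∘ t.
    by apply: (ker_mono k0); rewrite !compmA -sqC u0E -sqC -compmA u1E.
  by exists (Square uC); exact: squareP.
- move=> t u v e; apply: squareP.
  + exact: (ker_mono k1 (sq1_congr e)).
  + exact: (ker_mono k0 (sq0_congr e)).
Qed.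

Lemma arr_ker_sq1 k a b (i : square k a) (f : square a b) :
  @is_kernel (pArr C) k a b i f -> is_kernel (sq1 i) (sq1 f).
Proof.
move=> kf; apply: ker_intro; first exact: (sq1_congr (proj1 kf)).
- move=> T x e; have [|u iu] := ker_lift kf (t := dom_test x).
    by rewrite dom_testE e; exact: dom_test0.
  by exists (sq1 u); exact: (sq1_congr iu).
- move=> T u v e; apply: (sq1_congr (s := dom_test u) (t := dom_test v)).
  by apply: (ker_mono kf); rewrite !dom_testE e.
Qed.

Lemma arr_ker_sq0 k a b (i : square k a) (f : square a b) :
  @is_kernel (pArr C) k a b i f -> is_kernel (sq0 i) (sq0 f).
Proof.
move=> kf; apply: ker_intro; first exact: (sq0_congr (proj1 kf)).
- move=> T x e; have [|u iu] := ker_lift kf (t := cod_test x).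
    by rewrite cod_testE e; exact: cod_test0.
  by exists (sq0 u); exact: (sq0_congr iu).
- move=> T u v e; apply: (sq0_congr (s := cod_test u) (t := cod_test v)).
  by apply: (ker_mono kf); rewrite !cod_testE e.
Qed.

(** Maps to [T -> 0] and to the identity arrow on [T] test the domain and the
codomain of a cokernel. *)
Lemma arr_coker_sq1 k a b (i : square k a) (f : square a b) :
  @is_cokernel (pArr C) k a b i f -> is_cokernel (sq1 i) (sq1 f).
Proof.
move=> [e h]; split; first exact: (sq1_congr e).
move=> T t ti; pose s c (x : hom (adom c) T) :=
  @Square C c (Arrow (to0 T)) x (to0 _) (to0_eq _ _).
have [|u [uE uU]] := h (Arrow (to0 T)) (s _ t).
  by apply: squareP => /=; [exact: ti | exact: to0_eq].
exists (sq1 u); split; first exact: (sq1_congr uE).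
move=> v vE; rewrite (uU (s _ v)) //.
by apply: squareP => /=; [exact: vE | exact: to0_eq].
Qed.

Lemma arr_coker_sq0 k a b (i : square k a) (f : square a b) :
  @is_cokernel (pArr C) k a b i f -> is_cokernel (sq0 i) (sq0 f).
Proof.
move=> [e h]; split; first exact: (sq0_congr e).
move=> T t ti; pose s c (x : hom (acod c) T) :=
  @Square C c (Arrow (idm T)) (x ∘ c) x (comp1m _).
have [|u [uE uU]] := h (Arrow (idm T)) (s _ t).
  apply: squareP => /=; last exact: ti.
  by rewrite -compmA sqC compmA ti zerom_l.
exists (sq0 u); split; first exact: (sq0_congr uE).
move=> v vE; rewrite (uU (s _ v)) //.
by apply: squareP => /=; [rewrite -compmA sqC compmA vE | exact: vE].
Qed.

Lemma arr_exact_protomodular :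
  exact_protomodular C -> exact_protomodular (pArr C).
Proof.
move=> hC; split.
- exact: (arr_has_pullbacks (ep_pb hC)).
- move=> b e v x y p s q t h ps qt qh hs x' y' pe px qe qy h' pbx pby h'e h'y h'i.
  apply: arr_iso_intro.
  + apply: (ep_proto hC (sq1_congr ps) (sq1_congr qt) (sq1_congr qh)
      (sq1_congr hs) (arr_pb_sq1 pbx) (arr_pb_sq1 pby) (sq1_congr h'e)
      (sq1_congr h'y)).
    exact: arr_iso_sq1.
  + apply: (ep_proto hC (sq0_congr ps) (sq0_congr qt) (sq0_congr qh)
      (sq0_congr hs) (arr_pb_sq0 pbx) (arr_pb_sq0 pby) (sq0_congr h'e)
      (sq0_congr h'y)).
    exact: arr_iso_sq0.
- move=> r a d0 d1 [rm [rr [rr0 rr1]] _ _].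
  have [|Q1 [q1 [kp1 co1]]] := ep_quot hC (d0 := sq1 d0) (d1 := sq1 d1).
    apply: (reflexive_equivalence hC _ (sq1_congr rr0) (sq1_congr rr1)).
    move=> T u v e0 e1; apply: (sq1_congr (s := dom_test u) (t := dom_test v)).
    by apply: rm; rewrite !dom_testE ?e0 ?e1.
  have [|Q0 [q0 [kp0 co0]]] := ep_quot hC (d0 := sq0 d0) (d1 := sq0 d1).
    apply: (reflexive_equivalence hC _ (sq0_congr rr0) (sq0_congr rr1)).
    move=> T u v e0 e1; apply: (sq0_congr (s := cod_test u) (t := cod_test v)).
    by apply: rm; rewrite !cod_testE ?e0 ?e1.
  have [|c [cE _]] := proj2 co1 _ (q0 ∘ a).
    by rewrite -!compmA !sqC !compmA (proj1 co0).
  exists (Arrow c), (@Square _ a (Arrow c) q1 q0 cE); split.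
  + exact: arr_pb_intro.
  + exact: arr_coequalizer_intro.
Qed.

End ArrPointed.

(** * Double extensions *)

Definition transpose (C : category) (a b : arrow C) (f : square a b) :
  square (Arrow (sq1 f)) (Arrow (sq0 f)) :=
  @Square C (Arrow (sq1 f)) (Arrow (sq0 f)) a b (esym (sqC f)).

Section Extensions.
Variable C : pcategory.
Hypothesis hC : exact_protomodular C.
Variable E : mclass C.
Hypothesis hE : is_class_of_extensions E.
Implicit Types A B D K P T : C.

Lemma ends_dom A B (f : hom A B) : E f -> ends E A.
Proof. by move=> Ef; left; exists B, f. Qed.

Lemma ends_cod A B (f : hom A B) : E f -> ends E B.
Proof. by move=> Ef; right; exists A, f. Qed.

Lemma ext_epi A B (f : hom A B) : E f ->
  forall T (u v : hom B T), u ∘ f = v ∘ f -> u = v.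
Proof. by move/(ce_regular hE); exact: regepi_epi. Qed.

Lemma ext_zero_kernel_iso A B (f : hom A B) : E f ->
  (forall T (e : hom T A), f ∘ e = zerom T B -> e = zerom T A) -> is_iso f.
Proof. by move/(ce_regular hE); exact: regepi_zero_kernel_iso. Qed.

Lemma ext_id A : ends E A -> E (idm A).
Proof. by move=> eA; apply: (ce_split hE) => //; exists (idm A); rewrite comp1m. Qed.

Lemma ext_to0 A : ends E A -> E (to0 A).
Proof.
move=> eA; apply: (ce_split hE) => //; first exact: ce_zero hE.
by exists (from0 A); exact: to0_eq.
Qed.

(** An isomorphism is the cokernel of a zero map, so the axiom on short exact
sequences applies. *)
Lemma ext_iso A B (f : hom A B) : is_iso f -> ends E A -> E f.
Proof.
move=> fi eA; have [g [gf fg]] := fi.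
apply: (ce_exact hE (k := from0 A)) => //; last exact: ce_zero hE.
split; first apply: ker_intro.
- exact: from0_eq.
- move=> T t ft; exists (to0 T); apply: (iso_mono fi).
  by rewrite ft -/(zerom T A) zerom_r.
- by move=> T u v _; exact: to0_eq.
- split; first exact: from0_eq.
  move=> T t _; exists (t ∘ g); split; first by rewrite -compmA gf compm1.
  by move=> u <-; rewrite -compmA fg compm1.
Qed.

Lemma ends_iso A B (f : hom A B) : is_iso f -> ends E A -> ends E B.
Proof. by move=> fi eA; exact: ends_cod (ext_iso fi eA). Qed.

Lemma ext_conj A B A' B' (f : hom A B) (f' : hom A' B') (i : hom A A')
  (j : hom B B') :
  is_iso i -> is_iso j -> f' ∘ i = j ∘ f -> E f -> E f'.
Proof.
move=> ii ji e Ef; have [i' ii' [i'i ii'E]] := iso_inv ii.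
have -> : f' = j ∘ (f ∘ i').
  by rewrite compmA -e -compmA ii'E compm1.
have Ei' : E i' by apply: ext_iso => //; exact: ends_iso ii (ends_dom Ef).
apply: (ce_comp hE) (ext_iso ji (ends_cod Ef)).
exact: (ce_comp hE).
Qed.

Lemma ext_ker K A B (k : hom K A) (f : hom A B) :
  E f -> is_kernel k f -> ends E K.
Proof.
move=> Ef kf; apply: ends_dom (ce_pullback hE Ef (ce_zero hE) (pb_kernel kf)).
Qed.

Lemma double_ext_intro (a b : arrow C) (f : square a b) P
  (p0 : hom P (acod a)) (p1 : hom P (adom b)) (u : hom (adom a) P) :
  E (amor a) -> E (amor b) -> E (sq1 f) -> E (sq0 f) ->
  is_pullback (sq0 f) (amor b) p0 p1 -> p0 ∘ u = a -> p1 ∘ u = sq1 f -> E u ->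
  double_ext E f.
Proof.
move=> Ea Eb E1 E0 pb e0 e1 Eu; split=> //; exists P, p0, p1, u; split=> //.
- exact: (ce_pullback hE Eb (ends_dom E0) (pb_sym pb)).
- exact: (ce_pullback hE E0 (ends_dom Eb) pb).
Qed.

Lemma transpose_double_ext (a b : arrow C) (f : square a b) :
  double_ext E f -> double_ext E (transpose f).
Proof.
move=> [Ea Eb E1 E0 [P [p0 [p1 [u [pb _ _ [e0 e1] Eu]]]]]].
exact: (@double_ext_intro _ _ (transpose f) P p1 p0 u E1 E0 Ea Eb (pb_sym pb)).
Qed.

(** The comparison map to the pullback and the induced map of kernels are
extensions together: the latter is a pullback of the former, and the former is
an extension by the short five axiom. *)
Lemma double_ext_of_ker (a b : arrow C) (f : square a b) K L
  (i : hom K (adom a)) (j : hom L (adom b)) (k : hom K L) :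
  E (amor a) -> E (amor b) -> E (sq1 f) -> E (sq0 f) ->
  is_kernel i (amor a) -> is_kernel j (amor b) -> j ∘ k = sq1 f ∘ i -> E k ->
  double_ext E f.
Proof.
move=> Ea Eb E1 E0 ki kj e Ek.
have [P [p0 [p1 pb]]] := ep_pb hC (sq0 f) (amor b).
have [u [u0 u1]] := pb_lift pb (esym (sqC f)).
have Ep0 : E p0 := ce_pullback hE Eb (ends_dom E0) (pb_sym pb).
apply: (double_ext_intro Ea Eb E1 E0 pb u0 u1).
have [w [kw w1]] := pullback_kernel pb kj.
apply: (ce_five hE (i := i) (f := amor a) (j := w) (g := p0) (k := k)) => //.
- exact: (regepi_short_exact hC (ce_regular hE Ea)).
- exact: (regepi_short_exact hC (ce_regular hE Ep0)).
- apply: (pb_mono pb); rewrite !compmA ?u0 ?u1 ?(proj1 kw) ?w1 ?zerom_l //.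
  exact: (proj1 ki).
- exact: ends_dom Ep0.
Qed.

Lemma double_ext_ker (a b : arrow C) (f : square a b) K L
  (i : hom K (adom a)) (j : hom L (adom b)) (k : hom K L) :
  double_ext E f ->
  is_kernel i (amor a) -> is_kernel j (amor b) -> j ∘ k = sq1 f ∘ i -> E k.
Proof.
move=> [Ea Eb E1 E0 [P [p0 [p1 [u [pb Ep0 Ep1 [u0 u1] Eu]]]]]] ki kj e.
have [w [kw w1]] := pullback_kernel pb kj; have w0 := proj1 kw.
have eL : ends E L := ext_ker Eb kj.
apply: (ce_pullback hE (f := u) (g := w) (pA := i)) => //.
apply: pb_intro.
- apply: (pb_mono pb); rewrite !compmA ?u0 ?u1 ?w0 ?w1 ?zerom_l //.
  exact: (proj1 ki).
- move=> T x y xy; have [|z iz] := ker_lift ki (t := x).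
    by rewrite -u0 -compmA xy compmA w0 zerom_l.
  exists z; split=> //; apply: (ker_mono kj).
  by rewrite compmA e -compmA iz -u1 -compmA xy compmA w1.
- by move=> T x y xy _; exact: (ker_mono ki).
Qed.

Lemma ends_double_ext (a : arrow C) :
  ends (C := Arr C) (double_ext E) a <-> E (amor a).
Proof.
split=> [[[b [f [Ea _ _ _ _]]]|[b [f [_ Ea _ _ _]]]] //|Ea]; left.
exists a, (idm (a : Arr C)).
apply: (double_ext_intro (f := idm (a : Arr C)) Ea Ea (ext_id (ends_dom Ea))
  (ext_id (ends_cod Ea)) (pb_sym (pb_id (amor a))) (u := idm _)).
- exact: compm1.
- exact: compm1.
- exact: ext_id (ends_dom Ea).
Qed.

(** The first projections of the kernel pairs have the same kernels as [a] and
[b].  Hence the comparison map from [R] to the pullback of [e0] along [sq1 f] is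
an extension, and [r] is that map followed by a pullback of [sq1 f]. *)
Lemma double_ext_kernel_pair (a b : arrow C) (f : square a b) R S
  (d0 d1 : hom R (adom a)) (e0 e1 : hom S (adom b)) (r : hom R S) :
  double_ext E f -> is_kernel_pair d0 d1 (amor a) ->
  is_kernel_pair e0 e1 (amor b) ->
  e0 ∘ r = sq1 f ∘ d0 -> e1 ∘ r = sq1 f ∘ d1 -> E r.
Proof.
move=> fD kpa kpb r0 r1; have [Ea Eb E1 E0 _] := fD.
have [K [i ki]] := ker_exists (amor a) (ep_pb hC).
have [L [j kj]] := ker_exists (amor b) (ep_pb hC).
have [k jk] := kernel_map f ki kj.
have Ek := double_ext_ker fD ki kj jk.
have [i' [ki' i'1]] := kernel_pair_kernel kpa ki.
have [j' [kj' j'1]] := kernel_pair_kernel kpb kj.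
have Ed0 : E d0 by apply: (ce_pullback hE Ea (ends_dom Ea) (pb_sym kpa)).
have Ee0 : E e0 by apply: (ce_pullback hE Eb (ends_dom Eb) (pb_sym kpb)).
have [P [p0 [p1 pb]]] := ep_pb hC (sq1 f) e0.
have [u [u0 u1]] := pb_lift pb (esym r0).
have Ep0 : E p0 := ce_pullback hE Ee0 (ends_dom E1) (pb_sym pb).
have Ep1 : E p1 := ce_pullback hE E1 (ends_dom Ee0) pb.
have [w [kw w1]] := pullback_kernel pb kj'.
rewrite -u1; apply: (ce_comp hE) Ep1.
apply: (ce_five hE (i := i') (f := d0) (j := w) (g := p0) (k := k)) => //.
- exact: (regepi_short_exact hC (ce_regular hE Ed0)).
- exact: (regepi_short_exact hC (ce_regular hE Ep0)).
- apply: (pb_mono pb).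
  + by rewrite !compmA u0 (proj1 kw) zerom_l (proj1 ki').
  + rewrite !compmA u1 w1; apply: (pb_mono kpb); rewrite !compmA.
    * by rewrite r0 (proj1 kj') zerom_l -compmA (proj1 ki') zerom_r.
    * by rewrite r1 j'1 -compmA i'1 jk.
- exact: ends_dom Ep0.
Qed.

Lemma double_ext_regepi (a b : arrow C) (f : square a b) :
  double_ext E f -> @is_regular_epi (Arr C) a b f.
Proof.
move=> [_ _ E1 E0 _].
have [R1 [p1 [q1 kp1]]] := ep_pb hC (sq1 f) (sq1 f).
have [R0 [p0 [q0 kp0]]] := ep_pb hC (sq0 f) (sq0 f).
have [c [p [q [e1 e2 e3 e4 pb]]]] := arr_pb_build kp1 kp0.
exists (Arrow c), p, q; apply: arr_coequalizer_intro.
- by rewrite e1 e3; exact: regepi_kernel_pair (ce_regular hE E1) kp1.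
- by rewrite e2 e4; exact: regepi_kernel_pair (ce_regular hE E0) kp0.
Qed.

(** The section restricts to kernels, so the map of kernels is a split
epimorphism between objects of [ends E] and therefore an extension. *)
Lemma double_ext_split (a b : arrow C) (f : square a b) :
  E (amor a) -> E (amor b) -> @is_split_epi (Arr C) a b f -> double_ext E f.
Proof.
move=> Ea Eb [s fs].
have [K [i ki]] := ker_exists (amor a) (ep_pb hC).
have [L [j kj]] := ker_exists (amor b) (ep_pb hC).
have [k jk] := kernel_map f ki kj.
have [l il] := kernel_map s kj ki.
apply: (double_ext_of_ker Ea Eb _ _ ki kj jk).
- apply: (ce_split hE (ends_dom Ea) (ends_dom Eb)).
  by exists (sq1 s); exact: (sq1_congr fs).
- apply: (ce_split hE (ends_cod Ea) (ends_cod Eb)).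
  by exists (sq0 s); exact: (sq0_congr fs).
- apply: (ce_split hE (ext_ker Ea ki) (ext_ker Eb kj)).
  exists l; apply: (ker_mono kj).
  have fs1 : sq1 f ∘ sq1 s = idm _ := sq1_congr fs.
  by rewrite compmA jk -compmA il compmA fs1 compm1 comp1m.
Qed.

(** The closure properties are those of [E], applied to both components and to
the map of kernels. *)
Lemma double_ext_class :
  is_class_of_extensions (C := pArr C) (double_ext E).
Proof.
split.
- exact: double_ext_regepi.
- by apply/(ends_double_ext (Arrow (idm zero))); apply: ext_id (ce_zero hE).
- move=> a b f /(ends_double_ext a) Ea /(ends_double_ext b) Eb.
  exact: double_ext_split.
- move=> a b d f g fD gD; have [Ea Eb f1 f0 _] := fD; have [_ Ed g1 g0 _] := gD.
  have [K [i ki]] := ker_exists (amor a) (ep_pb hC).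
  have [L [j kj]] := ker_exists (amor b) (ep_pb hC).
  have [M [l kl]] := ker_exists (amor d) (ep_pb hC).
  have [k jk] := kernel_map f ki kj.
  have [m lm] := kernel_map g kj kl.
  apply: (double_ext_of_ker (f := sq_comp g f) (k := m ∘ k) Ea Ed _ _ ki kl).
  + exact: (ce_comp hE f1).
  + exact: (ce_comp hE f0).
  + by rewrite compmA lm -compmA jk compmA.
  + apply: (ce_comp hE (double_ext_ker fD ki kj jk) (double_ext_ker gD kj kl lm)).
- move=> a b d f g gfD /(ends_double_ext b) Eb; have [Ea Ed gf1 gf0 _] := gfD.
  have [K [i ki]] := ker_exists (amor a) (ep_pb hC).
  have [L [j kj]] := ker_exists (amor b) (ep_pb hC).
  have [M [l kl]] := ker_exists (amor d) (ep_pb hC).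
  have [k jk] := kernel_map f ki kj.
  have [m lm] := kernel_map g kj kl.
  apply: (double_ext_of_ker (k := m) Eb Ed _ _ kj kl lm).
  + exact: (ce_cancel hE gf1 (ends_dom Eb)).
  + exact: (ce_cancel hE gf0 (ends_cod Eb)).
  + apply: (ce_cancel hE (f := k) _ (ext_ker Eb kj)).
    apply: (double_ext_ker gfD ki kl).
    by rewrite /= compmA lm -compmA jk compmA.
- move=> a b d p f g pa pd fD /(ends_double_ext d) Ed pb.
  have [Ea Eb f1 f0 [P [p0 [p1 [u [pbP _ _ [u0 u1] Eu]]]]]] := fD.
  have pb1 := arr_pb_sq1 pb; have pb0 := arr_pb_sq0 pb.
  have Epd1 := ce_pullback hE f1 (ends_dom Ed) pb1.
  have Epd0 := ce_pullback hE f0 (ends_cod Ed) pb0.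
  have [Q [q0 [q1 pbQ]]] := ep_pb hC (sq0 pd) (amor d).
  have Eq0 := ce_pullback hE Ed (ends_dom Epd0) (pb_sym pbQ).
  have [v [v0 v1]] := pb_lift pbQ (esym (sqC pd)).
  (* The comparison map of the pullback square is a pullback of that of [f]. *)
  have [|w [w0 w1]] := pb_lift pbP (a := sq0 pa ∘ q0) (d := sq1 g ∘ q1).
    by rewrite !compmA (pb_comm pb0) -compmA (pb_comm pbQ) compmA -sqC.
  have Ev : E v.
    apply: (ce_pullback hE Eu (g := w) (pA := sq1 pa) (ends_dom Eq0)).
    apply: pb_intro.
    + apply: (pb_mono pbP); rewrite !compmA ?u0 ?u1 ?w0 ?w1 -!compmA ?v0 ?v1.
      * exact: sqC.
      * exact: pb_comm pb1.
    + move=> T x y xy; have [|z [z0 z1]] := pb_lift pb1 (a := x) (d := q1 ∘ y).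
        by rewrite -u1 -compmA xy !compmA w1.
      exists z; split=> //; apply: (pb_mono pbQ).
      * rewrite compmA v0; apply: (pb_mono pb0); rewrite !compmA.
        - by rewrite -sqC -compmA z0 -u0 -compmA xy compmA w0.
        - by rewrite -sqC -compmA z1 compmA -(pb_comm pbQ).
      * by rewrite compmA v1.
    + move=> T x y x1 y1; apply: (pb_mono pb1) => //.
      by rewrite -v1 -!compmA y1.
  apply: (double_ext_intro _ Ed Epd1 Epd0 pbQ v0 v1 Ev).
  by rewrite -v0; exact: (ce_comp hE).
- move=> k a b i f [ki co] /(ends_double_ext a) Ea /(ends_double_ext k) Ek.
  have k1 := arr_ker_sq1 ki; have k0 := arr_ker_sq0 ki.
  have E1 : E (sq1 f).
    by apply: (ce_exact hE (conj k1 (arr_coker_sq1 co)));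
      [exact: ends_dom Ea | exact: ends_dom Ek].
  have E0 : E (sq0 f).
    by apply: (ce_exact hE (conj k0 (arr_coker_sq0 co)));
      [exact: ends_cod Ea | exact: ends_cod Ek].
  have Eb : E (amor b).
    by apply: (ce_cancel hE (f := sq1 f)); [rewrite sqC; exact: (ce_comp hE) |
      exact: ends_cod E1].
  apply: (transpose_double_ext (f := transpose f)).
  apply: (double_ext_of_ker (f := transpose f) E1 E0 Ea Eb k1 k0 (esym (sqC i)) Ek).
- move=> k a l d b i f j g x y [ki cf] [kj cg] e yf fD xD /(ends_double_ext d) Ed.
  have [Ea Eb f1 f0 _] := fD; have [Ek El x1 x0 _] := xD.
  have E1 : E (sq1 y).
    apply: (ce_five hE (conj (arr_ker_sq1 ki) (arr_coker_sq1 cf))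
      (conj (arr_ker_sq1 kj) (arr_coker_sq1 cg)) (sq1_congr e) (sq1_congr yf) f1 x1).
    exact: ends_dom Ed.
  have E0 : E (sq0 y).
    apply: (ce_five hE (conj (arr_ker_sq0 ki) (arr_coker_sq0 cf))
      (conj (arr_ker_sq0 kj) (arr_coker_sq0 cg)) (sq0_congr e) (sq0_congr yf) f0 x0).
    exact: ends_cod Ed.
  (* The kernel of [y] is that of [x], as [y] lies over the identity of [b]. *)
  have kery : forall m (t : @hom (pArr C) m k), @is_kernel (pArr C) _ _ _ t x ->
      @is_kernel (pArr C) _ _ _ (i ∘ t) y.
    move=> m t tx; apply: ker_intro.
    + by rewrite compmA e -compmA (proj1 tx) zerom_r.
    + move=> T z yz; have [|z' iz'] := ker_lift ki (t := z).
        by rewrite -yf -compmA yz zerom_r.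
      have [|z'' tz''] := ker_lift tx (t := z').
        by apply: (ker_mono kj); rewrite compmA -e -compmA iz' yz zerom_r.
      by exists z''; rewrite -compmA tz''.
    + move=> T u v uv; apply: (ker_mono tx); apply: (ker_mono ki).
      by rewrite !compmA.
  have [m [t tx]] := ker_exists (C := pArr C) x (arr_has_pullbacks (ep_pb hC)).
  have ty := kery _ _ tx.
  have Em : E (amor m).
    apply: (double_ext_ker (transpose_double_ext xD) (arr_ker_sq1 tx) (arr_ker_sq0 tx)).
    exact: (esym (sqC t)).
  apply: (transpose_double_ext (f := transpose y)).
  apply: (double_ext_of_ker (f := transpose y) E1 E0 Ea Ed
    (arr_ker_sq1 ty) (arr_ker_sq0 ty) _ Em).
  exact: (esym (sqC (i ∘ t))).
Qed.

End Extensions.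

(** * Central extensions *)

(** That [e] factors through the bracket of [R], the kernel of its unit.  With
generalized elements no choice of a reflection or a kernel has to be fixed. *)
Definition in_bracket (C : pcategory) (B : C -> Prop) (T R : C) (e : hom T R) :=
  exists (I : C) (eta : hom R I), is_reflection B eta /\ eta ∘ e = zerom T I.

Lemma reflection_iso (C : category) (B : C -> Prop) (A I J : C) (eta : hom A I)
  (zeta : hom A J) :
  is_reflection B eta -> is_reflection B zeta ->
  exists2 h : hom I J, is_iso h & h ∘ eta = zeta.
Proof.
move=> [BI uI] [BJ uJ].
have [h [he hU]] := uI _ zeta BJ; have [g [ge gU]] := uJ _ eta BI.
exists h => //; exists g; split.
- have [i [_ iU]] := uI _ eta BI.
  by rewrite -(iU (idm I)) ?comp1m // -(iU (g ∘ h)) // -compmA he.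
- have [i [_ iU]] := uJ _ zeta BJ.
  by rewrite -(iU (idm J)) ?comp1m // -(iU (h ∘ g)) // -compmA ge.
Qed.

Definition reflector_of_choice (C : category) (X B : C -> Prop)
  (R : full X -> C) (eta : forall A : full X, hom (sval A) (R A))
  (h : forall A : full X, is_reflection B (eta A)) : reflector X B.
Proof.
have ex (A A' : full X) (f : hom A A') :
    exists g : hom (R A) (R A'), g ∘ eta A = eta A' ∘ f.
  by have [g [e _]] := proj2 (h A) _ (eta A' ∘ f) (proj1 (h A')); exists g.
have un (A A' : full X) (u v : hom (R A) (R A')) :
    u ∘ eta A = v ∘ eta A -> u = v.
  move=> uv; have [g [_ gU]] := proj2 (h A) _ (u ∘ eta A) (proj1 (h A')).
  by rewrite -(gU u) // -(gU v).
pose F := @Functor (full X) C R (fun A A' f => sval (cid (ex A A' f))).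
have F1 A : sval (cid (ex A A (idm A))) = idm (R A).
  by apply: un; case: cid => g /= ->; rewrite comp1m; exact: compm1.
have FM A A' A'' (g : hom A' A'') (f : hom A A') :
    sval (cid (ex _ _ (g ∘ f))) = sval (cid (ex _ _ g)) ∘ sval (cid (ex _ _ f)).
  apply: un; case: cid => x /= ->; case: cid => y /= ye; case: cid => z /= ze.
  by rewrite -[y ∘ z ∘ _]compmA ze [y ∘ _]compmA ye; exact: compmA.
have nat (A A' : full X) (f : hom A A') :
    eta A' ∘ fmap (incl X) f = fmap (F F1 FM) f ∘ eta A.
  by rewrite /=; case: cid => g /= ->.
exact: (@Reflector C X B (F F1 FM) (@NatTrans _ _ (incl X) (F F1 FM) eta nat) h).
Defined.

Section Birkhoff.
Variable C : pcategory.
Hypothesis hC : exact_protomodular C.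
Variable E : mclass C.
Hypothesis hE : is_class_of_extensions E.
Variable B : C -> Prop.
Hypothesis hB : is_strongly_birkhoff E B.
Implicit Types A D K P Q R S T : C.

Lemma in_bracket_reflection R I (eta : hom R I) T (e : hom T R) :
  is_reflection B eta -> in_bracket B e -> eta ∘ e = zerom T I.
Proof.
move=> re [J [zeta [rz ze]]]; have [h _ <-] := reflection_iso rz re.
by rewrite -compmA ze zerom_r.
Qed.

Lemma reflection_exists A : ends E A ->
  exists (I : C) (eta : hom A I), is_reflection B eta.
Proof.
move=> eA; have [I _] := sb_refl hB.
exists (I (exist _ A eA)), (refl_unit I (exist _ A eA)).
exact: (@reflP _ _ _ I).
Qed.

Lemma in_bracket_map R R' (f : hom R R') T (e : hom T R) :
  ends E R' -> in_bracket B e -> in_bracket B (f ∘ e).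
Proof.
move=> eR' [I [eta [re ee]]]; have [J [zeta rz]] := reflection_exists eR'.
exists J, zeta; split=> //.
have [g [ge _]] := proj2 re _ (zeta ∘ f) (proj1 rz).
by rewrite compmA -ge -compmA ee zerom_r.
Qed.

Lemma in_bracket_comp R T (e : hom T R) T' (t : hom T' T) :
  in_bracket B e -> in_bracket B (e ∘ t).
Proof.
by move=> [I [eta [re ee]]]; exists I, eta; rewrite compmA ee zerom_l.
Qed.

Lemma reflection_kernel K A I J (eta : hom A I) (zeta : hom A J) (k : hom K A) :
  is_reflection B eta -> is_reflection B zeta ->
  is_kernel k eta -> is_kernel k zeta.
Proof.
move=> re rz ke; apply: ker_intro; last exact: ker_mono ke.
- by apply: in_bracket_reflection => //; exists I, eta; split=> //; exact: (proj1 ke).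
- move=> T t zt; apply: (ker_lift ke).
  by apply: in_bracket_reflection => //; exists J, zeta.
Qed.

(** The naturality square of the units at [f] is a double extension, and in the
direction of the units the map of kernels of a double extension is an
extension. *)
Lemma bracket_ext A D IA ID (etaA : hom A IA) (etaD : hom D ID) K L
  (i : hom K A) (j : hom L D) (f : hom A D) (k : hom K L) :
  E f -> is_reflection B etaA -> is_reflection B etaD ->
  is_kernel i etaA -> is_kernel j etaD -> j ∘ k = f ∘ i -> E k.
Proof.
move=> Ef rA rD ki kj e; have [R hR] := sb_refl hB.
pose A' : full (ends E) := exist _ A (ends_dom Ef).
pose D' : full (ends E) := exist _ D (ends_cod Ef).
have := transpose_double_ext hE (hR A' D' f Ef).
move/(double_ext_ker hE); apply.
- exact: (reflection_kernel rA (@reflP _ _ _ R A')) ki.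
- exact: (reflection_kernel rD (@reflP _ _ _ R D')) kj.
- exact: e.
Qed.

(** The comparison map of the naturality square at [f] is an extension.  Its
kernel consists of the elements of the bracket of [A] that [f] kills, so it is
invertible when these vanish. *)
Lemma trivial_of_zero A D (f : hom A D) : E f ->
  (forall T (e : hom T A), in_bracket B e -> f ∘ e = zerom T D -> e = zerom T A) ->
  trivial_ext E B f.
Proof.
move=> Ef f0; split=> //; have [R hR] := sb_refl hB.
pose A' : full (ends E) := exist _ A (ends_dom Ef).
pose D' : full (ends E) := exist _ D (ends_cod Ef).
have [_ _ _ _ [P [p0 [p1 [u [pb _ _ [u0 u1] Eu]]]]]] := hR A' D' f Ef.
have [v [vu uv]] : is_iso u.
  apply: (ext_zero_kernel_iso hC hE Eu) => T e ue; apply: f0.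
  - exists (R A'), (refl_unit R A'); split; first exact: (@reflP _ _ _ R A').
    by rewrite -[refl_unit R A']u1 -compmA ue zerom_r.
  - by rewrite -[f]u0 -compmA ue zerom_r.
exists (R A'), (R D'), (refl_unit R A'), (refl_unit R D'), (fmap R (f : hom A' D')).
split; [exact: (@reflP _ _ _ R A') | exact: (@reflP _ _ _ R D') |].
apply: pb_intro.
- by rewrite -(nt_nat (refl_unit R) (f : hom A' D')).
- move=> T x y e; have [t [t0 t1]] := pb_lift pb (esym e).
  exists (v ∘ t); split.
  + by rewrite -[refl_unit R A']u1 -compmA (comp_eq uv) comp1m.
  + by rewrite -[f]u0 -compmA (comp_eq uv) comp1m.
- move=> T x y e1 e0; have um : is_mono u by apply: iso_mono; exists v.
  apply: um; apply: (pb_mono pb); rewrite !compmA ?u0 ?u1 //.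
Qed.

(** Triviality of a pullback [P -> X] of [f] says that elements of the bracket of
[P] are determined by their images in [X], so the projections of its kernel pair
agree on the bracket of that kernel pair; and the latter bracket covers that of
the kernel pair of [f]. *)
Lemma central_projections A D R (f : hom A D) (d0 d1 : hom R A) T (e : hom T R) :
  central_ext E B f -> is_kernel_pair d0 d1 f -> in_bracket B e ->
  d0 ∘ e = d1 ∘ e.
Proof.
move=> [Ef [X [g [P [pA [pX [Eg pb [EpX [IP [IX [etaP [etaX [h [rP rX pbP]]]]]]]]]]]]]].
move=> kp [IR [etaR [rR etaRe]]].
have [R' [c0 [c1 kp']]] := ep_pb hC pX pX.
have EpA : E pA := ce_pullback hE Eg (ends_dom Ef) (pb_sym pb).
have [|r [r0 r1]] := pb_lift kp (a := pA ∘ c0) (d := pA ∘ c1).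
  by rewrite !compmA (pb_comm pb) -!compmA (pb_comm kp').
have Ed0 : E d0 := ce_pullback hE Ef (ends_dom Ef) (pb_sym kp).
have Er : E r.
  apply: (ce_pullback hE EpA (g := d0) (pA := c0) (ends_dom Ed0)).
  apply: pb_intro => //.
  - move=> W p s pd; have [|q [q0 q1]] := pb_lift pb (a := d1 ∘ s) (d := pX ∘ p).
      by rewrite !compmA -(pb_comm kp) -(pb_comm pb) -!compmA pd.
    have [|t [t0 t1]] := pb_lift kp' (a := p) (d := q); first by rewrite q1.
    exists t; split=> //; apply: (pb_mono kp); rewrite compmA ?r0 ?r1 -compmA.
    + by rewrite t0.
    + by rewrite t1.
  - move=> W u v uv ruv; apply: (pb_mono kp') => //; apply: (pb_mono pb).
    + by rewrite !compmA -r1 -!compmA ruv.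
    + by rewrite !compmA -(pb_comm kp') -!compmA uv.
have Ec0 : E c0 := ce_pullback hE EpX (ends_dom EpX) (pb_sym kp').
have [I' [eta' r']] := reflection_exists (ends_dom Ec0).
have [K [k kk]] := ker_exists etaR (ep_pb hC).
have [K' [k' kk']] := ker_exists eta' (ep_pb hC).
have brk' : in_bracket B k' by exists I', eta'; split=> //; exact: (proj1 kk').
have [|m km] := ker_lift kk (t := r ∘ k').
  by apply: in_bracket_reflection rR _; apply: in_bracket_map brk'; exact: ends_dom Ed0.
have Em : E m := bracket_ext Er r' rR kk' kk km.
have ck : c0 ∘ k' = c1 ∘ k'.
  apply: (pb_mono pbP); last by rewrite !compmA (pb_comm kp').
  by rewrite !(in_bracket_reflection rP) //; apply: in_bracket_map brk';
    exact: ends_dom EpX.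
have dk : d0 ∘ k = d1 ∘ k.
  apply: (ext_epi hE Em).
  by rewrite -!compmA km !compmA r0 r1 -!compmA ck.
by have [u <-] := ker_lift kk etaRe; rewrite !compmA dk.
Qed.

(** The condition makes the first projection of the kernel pair trivial, and
this projection is the pullback of [f] along itself. *)
Lemma central_of_zero A D R (f : hom A D) (d0 d1 : hom R A) :
  E f -> is_kernel_pair d0 d1 f ->
  (forall T (e : hom T R), in_bracket B e -> d0 ∘ e = zerom T A ->
     d1 ∘ e = zerom T A) ->
  central_ext E B f.
Proof.
move=> Ef kp f0; split=> //; exists A, f, R, d1, d0; split=> //; first exact: pb_sym kp.
apply: trivial_of_zero; first exact: (ce_pullback hE Ef (ends_dom Ef) (pb_sym kp)).
move=> T e be d0e; apply: (pb_mono kp); rewrite zerom_r //.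
exact: f0.
Qed.

Lemma central_iff_zero A D R (f : hom A D) (d0 d1 : hom R A) :
  E f -> is_kernel_pair d0 d1 f ->
  central_ext E B f <->
  (forall T (e : hom T R), in_bracket B e -> d0 ∘ e = zerom T A ->
     d1 ∘ e = zerom T A).
Proof.
move=> Ef kp; split; last exact: central_of_zero.
by move=> cf T e be <-; rewrite (central_projections cf kp be).
Qed.

Lemma central_ext_iso (a b : arrow C) (f : square a b) :
  @is_iso (Arr C) a b f -> CExt E B a -> CExt E B b.
Proof.
move=> fi ca; have [g [gf fg]] := fi.
have gi : @is_iso (Arr C) b a g by exists f.
have Eb : E (amor b).
  apply: (ext_conj hE (arr_iso_sq1 fi) (arr_iso_sq0 fi) (sqC f)).
  exact: (proj1 ca).
have [R [d0 [d1 kp]]] := ep_pb hC (amor b) (amor b).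
have g1m := iso_mono (arr_iso_sq1 gi).
apply: (central_of_zero Eb kp) => T e be <-; apply: (g1m); rewrite !compmA.
apply/esym/(central_projections ca _ be); apply: pb_intro.
- by rewrite !compmA sqC -!compmA (pb_comm kp).
- move=> W x y xy; have [|t [t0 t1]] := pb_lift kp (a := sq1 f ∘ x) (d := sq1 f ∘ y).
    by rewrite !compmA sqC -!compmA xy.
  have gf1 : sq1 g ∘ sq1 f = idm _ := sq1_congr gf.
  by exists t; rewrite -!compmA t0 t1 !compmA gf1 !comp1m.
- move=> W u v e0 e1; apply: (pb_mono kp); apply: (g1m); rewrite !compmA //.
Qed.

(** The relation [S] of those [(x, y)] in [R] that the unit of [R] identifies
with [(x, x)] is reflexive, hence the kernel pair of a quotient [q], whose
kernel consists of the [y] with [(0, y)] in the bracket of [R]. *)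
Lemma central_quotient A D R (a : hom A D) (d0 d1 : hom R A) :
  E a -> is_kernel_pair d0 d1 a ->
  exists (Q : C) (q : hom A Q) (c : hom Q D),
  [/\ c ∘ q = a, E q, central_ext E B c &
   forall T (x : hom T A), q ∘ x = zerom T Q <->
     exists e : hom T R, [/\ in_bracket B e, d0 ∘ e = zerom T A & d1 ∘ e = x]].
Proof.
move=> Ea kp; have [I hI] := sb_refl hB.
have Ed0 : E d0 := ce_pullback hE Ea (ends_dom Ea) (pb_sym kp).
pose R' : full (ends E) := exist _ R (ends_dom Ed0).
pose A' : full (ends E) := exist _ A (ends_dom Ea).
pose eta : hom R _ := refl_unit I R'.
have reta : is_reflection B eta := @reflP _ _ _ I R'.
have [_ _ _ _ [P [p0 [p1 [u [pb _ _ [u0 u1] Eu]]]]]] := hI R' A' d0 Ed0.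
have {}u0 : p0 ∘ u = d0 := u0; have {}u1 : p1 ∘ u = eta := u1.
have [s [s0 s1]] := kernel_pair_split kp.
have [S [x [y pbS]]] := ep_pb hC u (u ∘ s).
have Ey : E y := ce_pullback hE Eu (ends_dom Ea) pbS.
have xy : d0 ∘ x = y.
  by rewrite -u0 -compmA (pb_comm pbS) !compmA u0 s0 comp1m.
have lS T (e : hom T R) : eta ∘ e = eta ∘ (s ∘ (d0 ∘ e)) ->
    exists t, x ∘ t = e /\ y ∘ t = d0 ∘ e.
  move=> ee; apply: (pb_lift pbS); apply: (pb_mono pb); rewrite !compmA.
  - by rewrite u0 s0 comp1m.
  - by rewrite u1 -!compmA.
have bS T (e : hom T R) : in_bracket B e -> exists t, x ∘ t = e /\ y ∘ t = d0 ∘ e.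
  move=> be; apply: lS; rewrite (in_bracket_reflection reta be).
  rewrite (in_bracket_reflection reta) // !compmA.
  by apply: in_bracket_map be; exact: ends_dom Ed0.
have [|r [xr yr]] := lS _ s; first by rewrite s0 compm1.
have er : is_equivalence_relation (d0 ∘ x) (d1 ∘ x).
  apply: (reflexive_equivalence hC (r := r)); last by rewrite -compmA xr.
  - move=> T v w e0 e1; apply: (pb_mono pbS); last by rewrite -xy.
    by apply: (pb_mono kp); rewrite !compmA.
  - by rewrite -compmA xr.
have [Q [q [kpq coq]]] := ep_quot hC er.
have qre : is_regular_epi q by exists S, (d0 ∘ x), (d1 ∘ x).
have [N [n nq]] := ker_exists q (ep_pb hC).
have Eq : E q.
  have [n' [n'k _]] := kernel_pair_kernel kpq nq.
  apply: (ce_exact hE (regepi_short_exact hC qre nq) (ends_dom Ea)).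
  by apply: (ext_ker hE (k := n') Ey); rewrite -xy.
have [|c [cq _]] := proj2 coq _ a; first by rewrite !compmA (pb_comm kp).
have Ec : E c by apply: (ce_cancel hE (f := q)); [rewrite cq | exact: ends_cod Eq].
exists Q, q, c; split=> //; last first.
  move=> T z; split=> [qz|[e [be e0 <-]]].
  - have [|t [t0 t1]] := pb_lift kpq (a := zerom T A) (d := z).
      by rewrite zerom_r.
    exists (x ∘ t); rewrite !compmA; split=> //.
    exists (I R'), eta; split=> //.
    have : p1 ∘ (u ∘ (x ∘ t)) = p1 ∘ (u ∘ (s ∘ (y ∘ t))).
      by rewrite (compmA u) (pb_comm pbS) !compmA.
    by rewrite !(comp_eq u1) -xy t0 !zerom_r.
  - have [t [xt yt]] := bS _ _ be.
    rewrite -xt (compmA d1) compmA -(pb_comm kpq) -!compmA (compmA d0) xy yt e0.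
    by rewrite zerom_r.
have [R1 [c0 [c1 kpc]]] := ep_pb hC c c.
have [|m [m0 m1]] := pb_lift kpc (a := q ∘ d0) (d := q ∘ d1).
  by rewrite !compmA cq (pb_comm kp).
have cqE : c ∘ q = idm D ∘ a by rewrite comp1m.
(* The bracket of the kernel pair of [c] is covered by that of [R], which is
   contained in [S], so that [q] identifies its projections. *)
pose sq := @Square C (Arrow a) (Arrow c) q (idm D) cqE.
have sqD : double_ext E sq.
  exact: (double_ext_intro hE (f := sq) Ea Ec Eq (ext_id hE (ends_cod Ea))
    (pb_sym (pb_id c)) cq (comp1m q) Eq).
have Em : E m := double_ext_kernel_pair hC hE sqD kp kpc m0 m1.
have Ec0 : E c0 := ce_pullback hE Ec (ends_dom Ec) (pb_sym kpc).
have [I1 [eta1 reta1]] := reflection_exists (ends_dom Ec0).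
have [K [k kk]] := ker_exists eta (ep_pb hC).
have [K1 [k1 kk1]] := ker_exists eta1 (ep_pb hC).
have bk : in_bracket B k by exists (I R'), eta; split=> //; exact: (proj1 kk).
have [|v kv] := ker_lift kk1 (t := m ∘ k).
  by apply: in_bracket_reflection reta1 _; apply: in_bracket_map bk; exact: ends_dom Ec0.
have Ev : E v := bracket_ext Em reta reta1 kk kk1 kv.
have ck : c0 ∘ k1 = c1 ∘ k1.
  apply: (ext_epi hE Ev); rewrite -!compmA kv !compmA m0 m1.
  have [t [<- _]] := bS _ _ bk.
  by rewrite !compmA -(compmA q d0) -(compmA q d1) (pb_comm kpq).
apply: (central_of_zero Ec kpc) => T e be.
have [w <-] := ker_lift kk1 (in_bracket_reflection reta1 be).
by rewrite !compmA ck.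
Qed.

(** A map from [a] to a central extension sends the bracket of [R] to the
bracket of a kernel pair with equal projections, so it kills the kernel of
[q]. *)
Lemma central_quotient_reflection A D Q R (a : hom A D) (d0 d1 : hom R A)
  (q : hom A Q) (c : hom Q D) (qc : c ∘ q = idm D ∘ a) :
  E a -> is_kernel_pair d0 d1 a -> E q -> central_ext E B c ->
  (forall T (x : hom T A), q ∘ x = zerom T Q ->
     exists e : hom T R, [/\ in_bracket B e, d0 ∘ e = zerom T A & d1 ∘ e = x]) ->
  @is_reflection (Arr C) (CExt E B) (Arrow a) (Arrow c)
    (@Square C (Arrow a) (Arrow c) q (idm D) qc).
Proof.
move=> Ea kp Eq cc qk; split=> // y f cy; have [Ey _] := cy.
have [N [n nq]] := ker_exists q (ep_pb hC).
have [_ co] := regepi_short_exact hC (ce_regular hE Eq) nq.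
have [|h [hq _]] := proj2 co _ (sq1 f).
  have [e [be e0 <-]] := qk _ _ (proj1 nq).
  have [S [y0 [y1 kpy]]] := ep_pb hC (amor y) (amor y).
  have [|g [g0 g1]] := pb_lift kpy (a := sq1 f ∘ d0) (d := sq1 f ∘ d1).
    by rewrite !compmA (sqC f) -!compmA (pb_comm kp).
  have Ey0 : E y0 := ce_pullback hE Ey (ends_dom Ey) (pb_sym kpy).
  have bg : in_bracket B (g ∘ e) by apply: in_bracket_map be; exact: ends_dom Ey0.
  rewrite compmA -g1 -compmA -(central_projections cy kpy bg).
  by rewrite compmA g0 -compmA e0 zerom_r.
have hC' : y ∘ h = sq0 f ∘ c.
  apply: (ext_epi hE Eq); rewrite -!compmA hq qc comp1m.
  exact: sqC f.
exists (@Square C (Arrow c) y h (sq0 f) hC'); split.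
  by apply: squareP => //=; exact: compm1.
move=> g gE; apply: squareP => /=.
- by apply: (ext_epi hE Eq); rewrite hq -gE.
- by rewrite -gE /= compm1.
Qed.

(** Up to an isomorphism the unit is that of [central_quotient_reflection]. *)
Lemma central_reflection_kernel (a c : arrow C) R (d0 d1 : hom R (adom a))
  (s : square a c) :
  E (amor a) -> is_kernel_pair d0 d1 (amor a) ->
  @is_reflection (Arr C) (CExt E B) a c s ->
  [/\ E (sq1 s), is_iso (sq0 s) &
   forall T (x : hom T (adom a)), sq1 s ∘ x = zerom T _ <->
   exists e : hom T R, [/\ in_bracket B e, d0 ∘ e = zerom T _ & d1 ∘ e = x]].
Proof.
case: a d0 d1 s => A D a d0 d1 s /= Ea kp rs.
have [Q [q [z [zq Eq cz qk]]]] := central_quotient Ea kp.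
have zqE : z ∘ q = idm D ∘ a by rewrite comp1m.
have rq := central_quotient_reflection zqE Ea kp Eq cz (fun T x => proj1 (qk T x)).
have [h hi he] := reflection_iso rq rs.
have h1 : sq1 h ∘ q = sq1 s := sq1_congr he.
have h0 : sq0 h ∘ idm D = sq0 s := sq0_congr he.
split.
- rewrite -h1; apply: (ce_comp hE Eq).
  by apply: (ext_iso hE (arr_iso_sq1 hi)); exact: ends_cod Eq.
- by rewrite -h0 compm1; exact: (arr_iso_sq0 hi).
- move=> T x; rewrite -qk -h1 -compmA; split=> [hqx|->]; last exact: zerom_r.
  by apply: (iso_mono (arr_iso_sq1 hi)); rewrite hqx zerom_r.
Qed.

(** The kernel of a unit is also the kernel of the split epimorphism that the
first projection induces from the bracket of the kernel pair to that of the
domain; and a split epimorphism of extensions is a double extension. *)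
Lemma central_kernel_ext (a b : arrow C) (f : square a b) (c d : arrow C)
  (s : square a c) (t : square b d) K L (i : hom K (adom a))
  (j : hom L (adom b)) (k : hom K L) :
  double_ext E f ->
  @is_reflection (Arr C) (CExt E B) a c s ->
  @is_reflection (Arr C) (CExt E B) b d t ->
  is_kernel i (sq1 s) -> is_kernel j (sq1 t) -> j ∘ k = sq1 f ∘ i -> E k.
Proof.
move=> fD rs rt ki kj jk; have [Ea Eb E1 _ _] := fD.
(* For each of the two extensions: the bracket of its kernel pair, split over
   that of its domain, with kernel the kernel of the unit. *)
have bd (x z : arrow C) (v : square x z) M (m : hom M (adom x)) :
    E (amor x) -> @is_reflection (Arr C) (CExt E B) x z v -> is_kernel m (sq1 v) ->
    exists (R : C) (d0 d1 : hom R (adom x)) (I J : C) (eta : hom R I)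
      (zeta : hom (adom x) J) (G H : C) (g : hom G R) (h : hom H (adom x)),
    [/\ is_kernel_pair d0 d1 (amor x),
        is_reflection B eta /\ is_reflection B zeta,
        is_kernel g eta /\ is_kernel h zeta, ends E R
      & exists (p : hom G H) (l : hom M G),
        [/\ h ∘ p = d0 ∘ g, is_kernel l p & d1 ∘ (g ∘ l) = m]].
  move=> Ex rv km; have [R [d0 [d1 kp]]] := ep_pb hC (amor x) (amor x).
  have Ed0 : E d0 := ce_pullback hE Ex (ends_dom Ex) (pb_sym kp).
  have [I [eta reta]] := reflection_exists (ends_dom Ed0).
  have [J [zeta rzeta]] := reflection_exists (ends_dom Ex).
  have [G [g kg]] := ker_exists eta (ep_pb hC).
  have [H [h kh]] := ker_exists zeta (ep_pb hC).
  have [_ _ vk] := central_reflection_kernel Ex kp rv.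
  have bg : in_bracket B g by exists I, eta; split=> //; exact: (proj1 kg).
  have [|p hp] := ker_lift kh (t := d0 ∘ g).
    by apply: in_bracket_reflection rzeta _; apply: in_bracket_map bg; exact: ends_dom Ex.
  have [e [be e0 e1]] := proj1 (vk _ _) (proj1 km).
  have [l gl] := ker_lift kg (in_bracket_reflection reta be).
  exists R, d0, d1, I, J, eta, zeta, G, H, g, h; split=> //; first exact: ends_dom Ed0.
  exists p, l; split=> //; last by rewrite gl.
  apply: ker_intro.
  - apply: (ker_mono kh).
    by rewrite compmA hp -compmA gl e0 zerom_r.
  - move=> T w pw; have d0gw : d0 ∘ (g ∘ w) = zerom T _.
      by rewrite compmA -hp -compmA pw zerom_r.
    have [|w' mw'] := ker_lift km (t := d1 ∘ (g ∘ w)).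
      by apply/vk; exists (g ∘ w); split=> //; exact: in_bracket_comp.
    exists w'; apply: (ker_mono kg); rewrite compmA gl.
    apply: (pb_mono kp); rewrite compmA ?e0 ?e1 ?zerom_l //.
  - move=> T w w' ww'; apply: (ker_mono km).
    by rewrite -e1 -gl -!compmA ww'.
have [R [d0 [d1 [I [J [eta [zeta [G [H [g [h [kp [reta rzeta] [kg kh] eR
  [p [l [hp lp le]]]]]]]]]]]]]]] := bd _ _ _ _ _ Ea rs ki.
have [R' [d0' [d1' [I' [J' [eta' [zeta' [G' [H' [g' [h' [kp' [reta' rzeta']
  [kg' kh'] eR' [p' [l' [hp' lp' le']]]]]]]]]]]]]]] := bd _ _ _ _ _ Eb rt kj.
have [|r [r0 r1]] := pb_lift kp' (a := sq1 f ∘ d0) (d := sq1 f ∘ d1).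
  by rewrite !compmA (sqC f) -!compmA (pb_comm kp).
have Er := double_ext_kernel_pair hC hE fD kp kp' r0 r1.
have bg : in_bracket B g by exists I, eta; split=> //; exact: (proj1 kg).
have bh : in_bracket B h by exists J, zeta; split=> //; exact: (proj1 kh).
have bg' : in_bracket B g' by exists I', eta'; split=> //; exact: (proj1 kg').
have bh' : in_bracket B h' by exists J', zeta'; split=> //; exact: (proj1 kh').
have [|rG rGE] := ker_lift kg' (t := r ∘ g).
  by apply: in_bracket_reflection reta' _; exact: in_bracket_map.
have [|rH rHE] := ker_lift kh' (t := sq1 f ∘ h).
  by apply: in_bracket_reflection rzeta' _; apply: in_bracket_map bh; exact: ends_dom Eb.
have ErG : E rG := bracket_ext Er reta reta' kg kg' rGE.
have ErH : E rH := bracket_ext E1 rzeta rzeta' kh kh' rHE.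
have pE : rH ∘ p = p' ∘ rG.
  apply: (ker_mono kh'); rewrite !compmA rHE hp' -!compmA hp rGE !compmA.
  by rewrite r0.
have [z [z0 z1]] := kernel_pair_split kp; have [z' [z0' z1']] := kernel_pair_split kp'.
have [|y yE] := ker_lift kg (t := z ∘ h).
  by apply: in_bracket_reflection reta _; exact: in_bracket_map.
have [|y' yE'] := ker_lift kg' (t := z' ∘ h').
  by apply: in_bracket_reflection reta' _; exact: in_bracket_map.
have yC : rG ∘ y = y' ∘ rH.
  apply: (ker_mono kg'); rewrite !compmA rGE yE' -!compmA yE rHE !compmA.
  congr (_ ∘ h); apply: (pb_mono kp'); rewrite !compmA ?r0 ?r1 ?z0' ?z1' -!compmA
    ?z0 ?z1 comp1m compm1 //.
pose sp := @Square C (Arrow rG) (Arrow rH) p p' pE.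
have spD : double_ext E sp.
  apply: (double_ext_split hC hE (f := sp) ErG ErH).
  exists (@Square C (Arrow rH) (Arrow rG) y y' yC); apply: squareP => /=.
  + by apply: (ker_mono kh); rewrite compmA hp -compmA yE compmA z0 comp1m compm1.
  + by apply: (ker_mono kh'); rewrite compmA hp' -compmA yE' compmA z0' comp1m compm1.
apply: (double_ext_ker hE (transpose_double_ext hE spD) lp lp') => /=.
apply: (ker_mono kg'); apply: (pb_mono kp').
- have z0l : d0 ∘ (g ∘ l) = zerom _ _.
    by rewrite compmA -hp -compmA (proj1 lp) zerom_r.
  have z0l' : d0' ∘ (g' ∘ l') = zerom _ _.
    by rewrite compmA -hp' -compmA (proj1 lp') zerom_r.
  rewrite (compmA g' l') (compmA d0') z0l' zerom_l (compmA g') rGE !compmA r0.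
  by rewrite -!compmA z0l zerom_r.
- rewrite (compmA g' l') (compmA d1') le' (compmA g') rGE !compmA r1 -!compmA le.
  exact: jk.
Qed.

Lemma central_reflection_exists (a : arrow C) : E (amor a) ->
  exists (c : arrow C) (s : square a c), @is_reflection (Arr C) (CExt E B) a c s.
Proof.
case: a => A D a /= Ea; have [R [d0 [d1 kp]]] := ep_pb hC a a.
have [Q [q [z [zq Eq cz qk]]]] := central_quotient Ea kp.
have zqE : z ∘ q = idm D ∘ a by rewrite comp1m.
exists (Arrow z), (@Square C (Arrow a) (Arrow z) q (idm D) zqE).
exact: (central_quotient_reflection zqE Ea kp Eq cz (fun T x => proj1 (qk T x))).
Qed.

(** The units are double extensions whose kernels are concentrated in the
domains, and [central_kernel_ext] makes the map between these kernels a double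
extension; hence so is the unit square. *)
Theorem central_strongly_birkhoff :
  is_strongly_birkhoff (C := Arr C) (double_ext E) (CExt E B).
Proof.
have hD := double_ext_class hC hE; have hAC := arr_exact_protomodular hC.
split.
- by move=> a [Ea _]; apply/ends_double_ext.
- by move=> a b f _; exact: central_ext_iso.
have ch (a : full (ends (C := Arr C) (double_ext E))) :
    {x : {c : Arr C & hom (sval a) c} |
      @is_reflection (Arr C) (CExt E B) _ _ (projT2 x)}.
  apply: cid; have /(ends_double_ext hE) Ea := proj2_sig a.
  have [c [s r]] := central_reflection_exists Ea.
  by exists (existT _ c s).
pose I := @reflector_of_choice (Arr C) _ (CExt E B) (fun a => projT1 (sval (ch a)))
  (fun a => projT2 (sval (ch a))) (fun a => proj2_sig (ch a)).
exists I => a b f fD; have [Ea Eb _ _ _] := fD.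
set u := refl_unit I a; set v := refl_unit I b.
have ru : @is_reflection (Arr C) (CExt E B) _ _ u := @reflP _ _ _ I a.
have rv : @is_reflection (Arr C) (CExt E B) _ _ v := @reflP _ _ _ I b.
have uD (x z : arrow C) (w : square x z) : E (amor x) ->
    @is_reflection (Arr C) (CExt E B) x z w -> double_ext E w.
  move=> Ex rw; have [R [d0 [d1 kp]]] := ep_pb hC (amor x) (amor x).
  have [E1 i0 _] := central_reflection_kernel Ex kp rw.
  have E0 : E (sq0 w) by apply: (ext_iso hE i0); exact: ends_cod Ex.
  have Ez : E (amor z) := proj1 (proj1 rw).
  have [g i0g [g0 g1]] := iso_inv i0.
  apply: (double_ext_intro hE Ex Ez E1 E0 (p0 := g ∘ z) (p1 := idm _) (u := sq1 w)).
  - apply: pb_intro; first by rewrite compm1 compmA g1 comp1m.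
    + move=> T m n mn; exists n; rewrite comp1m -compmA -mn compmA g0 comp1m //.
    + by move=> T m n _; rewrite !comp1m.
  - by rewrite -compmA sqC compmA g0 comp1m.
  - exact: comp1m.
  - exact: E1.
have Du := uD _ _ _ Ea ru; have Dv := uD _ _ _ Eb rv.
have If_nat : fmap I f ∘ u = v ∘ (f : @hom (Arr C) _ _).
  by rewrite -(nt_nat (refl_unit I) f).
have DI : double_ext E (fmap I f).
  apply: (ce_cancel hD (f := u)); last first.
    by apply/(ends_double_ext hE); case: Du.
  by rewrite If_nat; exact: (ce_comp hD fD Dv).
(* The kernels of the units are concentrated in the domains. *)
have [K [i ki]] := ker_exists (sq1 u) (ep_pb hC).
have [L [j kj]] := ker_exists (sq1 v) (ep_pb hC).
have [|k jk] := ker_lift kj (t := sq1 f ∘ i).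
  have e : sq1 v ∘ sq1 f = sq1 (fmap I f) ∘ sq1 u := sq1_congr (esym If_nat).
  by rewrite compmA e -compmA (proj1 ki) zerom_r.
have Ek : E k := central_kernel_ext fD ru rv ki kj jk.
have kz (x z : arrow C) (w : square x z) M (m : hom M (adom x)) :
    E (amor x) -> @is_reflection (Arr C) (CExt E B) x z w -> is_kernel m (sq1 w) ->
    exists m' : square (Arrow (to0 M)) x, sq1 m' = m /\
      @is_kernel (pArr C) (Arrow (to0 M)) x z m' w.
  move=> Ex rw km; have [R [d0 [d1 kp]]] := ep_pb hC (amor x) (amor x).
  have [_ i0 _] := central_reflection_kernel Ex kp rw.
  have e : x ∘ m = from0 _ ∘ to0 M.
    apply: (iso_mono i0); rewrite compmA -sqC -compmA (proj1 km) -/(zerom M (acod x)).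
    by rewrite !zerom_r.
  exists (@Square C (Arrow (to0 M)) x m (from0 _) e); split=> //.
  apply: arr_ker_intro => //=; apply: ker_intro; first exact: from0_eq.
  - move=> T t wt; exists (to0 T); apply: (iso_mono i0).
    by rewrite wt -/(zerom T (acod x)) zerom_r.
  - by move=> T t t' _; exact: to0_eq.
have [i' [i'1 ki']] := kz _ _ _ _ _ Ea ru ki.
have [j' [j'1 kj']] := kz _ _ _ _ _ Eb rv kj.
pose k' := @Square C (Arrow (to0 K)) (Arrow (to0 L)) k (idm _) (to0_eq _ _).
have Dk' : double_ext E k'.
  apply: (@double_ext_intro _ _ hE _ _ k' L (to0 L) (idm L) k) => //=.
  - exact: (ext_to0 hE (ends_dom Ek)).
  - exact: (ext_to0 hE (ends_cod Ek)).
  - exact: (ext_id hE (ce_zero hE)).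
  - exact: (pb_sym (pb_id _)).
  - exact: to0_eq.
  - exact: comp1m.
apply: (transpose_double_ext hD (f := transpose (unit_square I f))).
apply: (double_ext_of_ker hAC hD (f := transpose (unit_square I f)) Du Dv fD DI
  ki' kj' (k := k') _ Dk').
apply: squareP => /=; first by rewrite i'1 j'1.
exact: from0_eq.
Qed.

End Birkhoff.

(** * Symmetry of double central extensions *)

Section Symmetry.
Variable C : pcategory.
Hypothesis hC : exact_protomodular C.
Variable E : mclass C.
Hypothesis hE : is_class_of_extensions E.
Variable B : C -> Prop.
Hypothesis hB : is_strongly_birkhoff E B.
Implicit Types Q R S T : C.

(** With [Q] the object of two-by-two matrices of elements of [adom a] with
rows in the kernel pair of [sq1 f] and columns in the kernel pair of [a], a
double extension is central when a matrix in the bracket of [Q] that vanishes in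
three corners vanishes.  This is [central_iff_zero] in the category of arrows:
there, the bracket of [r] consists of the [y] with [(0, y)] in the bracket of
[Q]. *)
Lemma central_iff_corner (a b : arrow C) (f : square a b) R1 R0
  (p q : hom R1 (adom a)) (p0 q0 : hom R0 (acod a)) (r : hom R1 R0) Q
  (d0 d1 : hom Q R1) :
  double_ext E f -> is_kernel_pair p q (sq1 f) -> is_kernel_pair p0 q0 (sq0 f) ->
  p0 ∘ r = a ∘ p -> q0 ∘ r = a ∘ q -> is_kernel_pair d0 d1 r ->
  central_ext (C := Arr C) (double_ext E) (CExt E B) f <->
  (forall T (e : hom T Q), in_bracket B e -> d0 ∘ e = zerom T R1 ->
     p ∘ (d1 ∘ e) = zerom T (adom a) -> q ∘ (d1 ∘ e) = zerom T (adom a)).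
Proof.
move=> fD kp1 kp0 pr qr kpr.
have hAC := arr_exact_protomodular hC; have hD := double_ext_class hC hE.
have hAB := central_strongly_birkhoff hC hE hB.
pose P := @Square C (Arrow r) a p p0 (esym pr).
pose P' := @Square C (Arrow r) a q q0 (esym qr).
have kpA : @is_kernel_pair (Arr C) (Arrow r) a b P P' f by exact: arr_pb_intro.
have Er : E r.
  have : double_ext E P by apply: (ce_pullback hD fD _ (pb_sym kpA));
    apply/ends_double_ext => //; case: fD.
  by case.
have [c [s rs]] := central_reflection_exists hC hE hB (a := Arrow r) Er.
have [_ s0i sk] := central_reflection_kernel hC hE hB (a := Arrow r) Er kpr rs.
rewrite (central_iff_zero hAC hD hAB fD kpA); split.
- move=> h T e be d0e pe.
  have e0 : sq1 s ∘ (d1 ∘ e) = zerom _ _ by apply/sk; exists e.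
  pose z := @dom_test C (Arrow r) _ (d1 ∘ e).
  have bz : in_bracket (C := pArr C) (CExt E B) z.
    by exists c, s; split=> //; rewrite dom_testE e0; exact: dom_test0.
  have Pz : @compm (Arr C) _ _ _ P z = @zerom (pArr C) _ a.
    by rewrite dom_testE /= pe; exact: dom_test0.
  exact: (sq1_congr (h _ z bz Pz)).
- move=> h t e be Pe; have se := in_bracket_reflection (C := pArr C) rs be.
  have [x [bx d0x d1x]] := proj1 (sk _ _) (sq1_congr se).
  have pe : p ∘ sq1 e = zerom _ _ := sq1_congr Pe.
  apply: squareP => /=.
  + by rewrite -d1x; apply: h => //; rewrite d1x.
  + have -> : sq0 e = zerom _ _.
      apply: (iso_mono s0i); rewrite zerom_r; exact: (sq0_congr se).
    exact: zerom_r.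
Qed.

(** The corner condition does not change when the matrices are transposed. *)
Lemma central_transpose (a b : arrow C) (f : square a b) :
  central_ext (C := Arr C) (double_ext E) (CExt E B) f ->
  central_ext (C := Arr C) (double_ext E) (CExt E B) (transpose f).
Proof.
move=> cf; have [fD _] := cf; have ftD := transpose_double_ext hE fD.
have [R1 [p [q kp1]]] := ep_pb hC (sq1 f) (sq1 f).
have [R0 [p0 [q0 kp0]]] := ep_pb hC (sq0 f) (sq0 f).
have [|r [pr qr]] := pb_lift kp0 (a := a ∘ p) (d := a ∘ q).
  by rewrite !compmA -(sqC f) -!compmA (pb_comm kp1).
have [Q [d0 [d1 kpr]]] := ep_pb hC r r.
have corner := proj1 (central_iff_corner fD kp1 kp0 pr qr kpr) cf.
have [S1 [x [y kpa]]] := ep_pb hC (amor a) (amor a).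
have [S0 [x0 [y0 kpb]]] := ep_pb hC (amor b) (amor b).
have [|s [xs ys]] := pb_lift kpb (a := sq1 f ∘ x) (d := sq1 f ∘ y).
  by rewrite !compmA (sqC f) -!compmA (pb_comm kpa).
have [|v [xv yv]] := pb_lift kpa (a := p ∘ d0) (d := p ∘ d1).
  by rewrite !compmA -pr -!compmA (pb_comm kpr).
have [|w [xw yw]] := pb_lift kpa (a := q ∘ d0) (d := q ∘ d1).
  by rewrite !compmA -qr -!compmA (pb_comm kpr).
have kps : is_kernel_pair v w s.
  apply: pb_intro.
  - apply: (pb_mono kpb); rewrite !compmA ?xs ?ys -!compmA ?xv ?xw ?yv ?yw.
    + by rewrite !compmA (pb_comm kp1).
    + by rewrite !compmA (pb_comm kp1).
  - move=> T t u stu.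
    have [|m [pm qm]] := pb_lift kp1 (a := x ∘ t) (d := x ∘ u).
      by rewrite !compmA -xs -!compmA stu.
    have [|n [pn qn]] := pb_lift kp1 (a := y ∘ t) (d := y ∘ u).
      by rewrite !compmA -ys -!compmA stu.
    have [|z [z0 z1]] := pb_lift kpr (a := m) (d := n).
      apply: (pb_mono kp0); rewrite !compmA ?pr ?qr -!compmA ?pm ?qm ?pn ?qn.
      + by rewrite !compmA (pb_comm kpa).
      + by rewrite !compmA (pb_comm kpa).
    exists z; split; apply: (pb_mono kpa); rewrite !compmA ?xv ?yv ?xw ?yw -!compmA.
    + by rewrite z0.
    + by rewrite z1.
    + by rewrite z0.
    + by rewrite z1.
  - move=> T t u vtu wtu; apply: (pb_mono kpr); apply: (pb_mono kp1).
    + by rewrite !compmA -xv -!compmA vtu.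
    + by rewrite !compmA -xw -!compmA wtu.
    + by rewrite !compmA -yv -!compmA vtu.
    + by rewrite !compmA -yw -!compmA wtu.
apply/(central_iff_corner (f := transpose f) ftD kpa kpb xs ys kps).
move=> T e be ve xwe; rewrite compmA yw -compmA; apply: corner => //.
- apply: (pb_mono kp1).
  + by rewrite compmA -xv -compmA ve !zerom_r.
  + by rewrite compmA -xw -compmA xwe zerom_r.
- by rewrite compmA -yv -compmA ve zerom_r.
Qed.

End Symmetry.

Definition transpose_obj (C : category) (f : Arr (Arr C)) : Arr (Arr C) :=
  @Arrow (Arr C) _ _ (transpose (amor f)).

Definition transpose_map (C : category) (f g : Arr (Arr C)) (s : hom f g) :
  hom (transpose_obj f) (transpose_obj g).
Proof.
apply: (@Square (Arr C) (transpose_obj f) (transpose_obj g)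
  (@Square C (Arrow (sq1 (amor f))) (Arrow (sq1 (amor g)))
     (sq1 (sq1 s)) (sq1 (sq0 s)) (sq1_congr (sqC s)))
  (@Square C (Arrow (sq0 (amor f))) (Arrow (sq0 (amor g)))
     (sq0 (sq1 s)) (sq0 (sq0 s)) (sq0_congr (sqC s)))).
by apply: squareP => /=; [exact: sqC (sq1 s) | exact: sqC (sq0 s)].
Defined.

Definition transposition (C : category) : functor (Arr (Arr C)) (Arr (Arr C)).
Proof.
apply: (@Functor (Arr (Arr C)) (Arr (Arr C))
  (@transpose_obj C) (@transpose_map C)).
- by move=> f; apply: squareP; apply: squareP.
- by move=> f g h t s; apply: squareP; apply: squareP.
Defined.

(** The kernels in the direction of [s] form a square, a double extension because
[s] is one.  Transposing [s] transposes this square, which keeps it a double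
extension. *)
Lemma transpose_map_ext (C : pcategory) (E : mclass C) (f g : Arr (Arr C))
  (s : hom f g) :
  exact_protomodular C -> is_class_of_extensions E ->
  double_ext (double_ext E) s ->
  double_ext (double_ext E) (transpose_map s).
Proof.
move=> hC hE sD; have hAC := arr_exact_protomodular hC.
have hD := double_ext_class hC hE; have [fD gD s1D s0D _] := sD.
have [k [i ki]] := ker_exists (C := pArr C) (sq1 s) (ep_pb hAC).
have [l [j kj]] := ker_exists (C := pArr C) (sq0 s) (ep_pb hAC).
have fgs : sq0 s ∘ amor f = amor g ∘ sq1 s := esym (sqC s).
have [|m jm] := ker_lift kj (t := (amor f : @hom (pArr C) _ _) ∘ i).
  by rewrite compmA fgs -compmA (proj1 ki) zerom_r.
have mD : double_ext E m.
  exact: (double_ext_ker hD (transpose_double_ext hD sD) ki kj jm).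
have [Ek El Em1 Em0 _] := mD.
have [Ea Eb Es11 Es10 _] := s1D; have [Ea' Eb' Es01 Es00 _] := s0D.
have [_ _ Ef1 Ef0 _] := fD; have [_ _ Eg1 Eg0 _] := gD.
have ftD := transpose_double_ext hE fD; have gtD := transpose_double_ext hE gD.
have tD1 : double_ext E (sq1 (transpose_map s)).
  apply: (transpose_double_ext hE (f := transpose (sq1 (transpose_map s)))).
  exact: (double_ext_of_ker hC hE (f := transpose (sq1 (transpose_map s)))
    Es11 Es01 Ef1 Eg1 (arr_ker_sq1 ki) (arr_ker_sq1 kj) (sq1_congr jm) Em1).
have tD0 : double_ext E (sq0 (transpose_map s)).
  apply: (transpose_double_ext hE (f := transpose (sq0 (transpose_map s)))).
  exact: (double_ext_of_ker hC hE (f := transpose (sq0 (transpose_map s)))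
    Es10 Es00 Ef0 Eg0 (arr_ker_sq0 ki) (arr_ker_sq0 kj) (sq0_congr jm) Em0).
pose i' := @Square C (Arrow (sq1 m)) (Arrow (sq1 (amor f))) (sq1 i) (sq1 j)
  (esym (sq1_congr jm)).
pose j' := @Square C (Arrow (sq0 m)) (Arrow (sq0 (amor f))) (sq0 i) (sq0 j)
  (esym (sq0_congr jm)).
have ki' : @is_kernel (pArr C) _ _ _ i' (sq1 (transpose_map s)).
  by apply: arr_ker_intro; [exact: arr_ker_sq1 ki | exact: arr_ker_sq1 kj].
have kj' : @is_kernel (pArr C) _ _ _ j' (sq0 (transpose_map s)).
  by apply: arr_ker_intro; [exact: arr_ker_sq0 ki | exact: arr_ker_sq0 kj].
apply: (transpose_double_ext hD (f := transpose (transpose_map s))).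
apply: (double_ext_of_ker hAC hD (f := transpose (transpose_map s))
  tD1 tD0 ftD gtD ki' kj' (k := transpose m)).
- by apply: squareP => /=; [exact: esym (sqC i) | exact: esym (sqC j)].
- exact: transpose_double_ext.
Qed.

(** * Iterated categories of arrows *)

Definition birkhoff_setting (C : pcategory) (E : mclass C) (B : C -> Prop) :=
  [/\ exact_protomodular C, is_class_of_extensions E & is_strongly_birkhoff E B].

Lemma setting_arr (C : pcategory) (E : mclass C) (B : C -> Prop) :
  birkhoff_setting E B -> birkhoff_setting (C := pArr C) (double_ext E) (CExt E B).
Proof.
move=> [hC hE hB]; split; first exact: arr_exact_protomodular.
- exact: double_ext_class.
- exact: central_strongly_birkhoff.
Qed.

Fixpoint iter_arr (n : nat) (C : pcategory) : pcategory :=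
  if n is m.+1 then pArr (iter_arr m C) else C.

Fixpoint iter_ext (C : pcategory) (E : mclass C) (n : nat) : mclass (iter_arr n C) :=
  match n return mclass (iter_arr n C) with
  | 0 => E
  | m.+1 => double_ext (@iter_ext C E m)
  end.

Fixpoint iter_central (C : pcategory) (E : mclass C) (B : C -> Prop) (n : nat) :
  iter_arr n C -> Prop :=
  match n return iter_arr n C -> Prop with
  | 0 => B
  | m.+1 => CExt (@iter_ext C E m) (@iter_central C E B m)
  end.

Lemma setting_iterated (C : pcategory) (E : mclass C) (B : C -> Prop) (n : nat) :
  birkhoff_setting E B -> birkhoff_setting (@iter_ext C E n) (@iter_central C E B n).
Proof. by move=> h; elim: n => [|n IHn] //; exact: setting_arr. Qed.

(** The first components lead to the initial vertex of the cube; every other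
vertex lies below one of the second components. *)
Fixpoint iso_off_top (C : pcategory) (n : nat) :
  forall A A' : iter_arr n C, hom A A' -> Prop :=
  match n return forall A A' : iter_arr n C, hom A A' -> Prop with
  | 0 => fun _ _ _ => True
  | m.+1 => fun (A A' : Arr (iter_arr m C)) (f : square A A') =>
      is_iso (sq0 f) /\ @iso_off_top C m _ _ (sq1 f)
  end.

Arguments iso_off_top {C} n [A A'] f.

(** If the kernel of [g] covers that of [f] and [g] has zero kernels off the
initial vertex, then so has [f].  Elements of the two ends of an arrow are maps
to it from [T = T] and from [0 -> T]. *)
Lemma iso_off_top_kernel (C : pcategory) (E : mclass C) (B : C -> Prop) (n : nat)
  (A A' R R' : iter_arr n C) (f : hom A A') (g : hom R R') (p : hom R A) :
  birkhoff_setting E B -> @iter_ext C E n _ _ f -> iso_off_top n g ->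
  (forall (T : iter_arr n C) (x : hom T A), f ∘ x = zerom T A' ->
     exists2 y : hom T R, g ∘ y = zerom T R' & p ∘ y = x) ->
  iso_off_top n f.
Proof.
move=> hG; elim: n A A' R R' f g p => [|n IHn] //= A A' R R' f g p.
move=> [_ _ f1E f0E _] [g0i g1o] h; have [hC hE _] := setting_iterated n hG; split.
- apply: (ext_zero_kernel_iso hC hE f0E) => T x fx.
  have [|y gy py] := h _ (cod_test x).
    by apply: etrans (cod_testE f x) _; rewrite fx; exact: cod_test0.
  have y0 : sq0 y = zerom _ _.
    apply: (iso_mono g0i); rewrite zerom_r; exact: (sq0_congr gy).
  by rewrite -(sq0_congr py : sq0 p ∘ sq0 y = x) y0 zerom_r.
- apply: (IHn _ _ _ _ _ _ (sq1 p) f1E g1o) => T x fx.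
  have [|y gy py] := h _ (dom_test x).
    by apply: etrans (dom_testE f x) _; rewrite fx; exact: dom_test0.
  by exists (sq1 y); [exact: (sq1_congr gy) | exact: (sq1_congr py)].
Qed.

(** The kernel of the unit for central extensions is covered by the bracket of
a kernel pair, to which the induction hypothesis applies. *)
Lemma reflection_iso_off_top (C : pcategory) (E : mclass C) (B : C -> Prop)
  (n : nat) (A I : iter_arr n C) (eta : hom A I) :
  birkhoff_setting E B -> ends (@iter_ext C E n) A -> is_reflection (@iter_central C E B n) eta ->
  iso_off_top n eta.
Proof.
move=> hG; elim: n A I eta => [|n IHn] //= A I eta.
have [hC hE hB] := setting_iterated n hG.
move/(ends_double_ext hE) => EA r.
have [R [d0 [d1 kp]]] := ep_pb hC (amor A) (amor A).
have [E1 i0 rk] := central_reflection_kernel hC hE hB EA kp r; split=> //.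
have eR : ends (@iter_ext C E n) R.
  exact: ends_dom (ce_pullback hE EA (ends_dom EA) (pb_sym kp)).
have [J [zeta rz]] := reflection_exists hB eR.
apply: (iso_off_top_kernel hG E1 (IHn _ _ _ eR rz) (p := d1)) => T x /rk.
move=> [e [be _ e1]]; exists e => //.
exact: in_bracket_reflection rz be.
Qed.

(** * Transport along equivalences of categories *)

Record is_equivalence (X Y : category) (F : functor X Y) : Prop := IsEquivalence {
  eqv_full : forall (A B : X) (g : hom (F A) (F B)), exists f, fmap F f = g;
  eqv_faithful : forall (A B : X) (f g : hom A B), fmap F f = fmap F g -> f = g;
  eqv_surj : forall Z : Y, exists (A : X) (h : hom (F A) Z), is_iso h }.

Definition iso_invariant (C : category) (E : mclass C) :=
  forall (A B A' B' : C) (f : hom A B) (f' : hom A' B') (i : hom A A')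
    (j : hom B B'), is_iso i -> is_iso j -> f' ∘ i = j ∘ f -> E _ _ f -> E _ _ f'.

Definition replete (C : category) (D : C -> Prop) :=
  forall (A B : C) (f : hom A B), is_iso f -> D A -> D B.

Lemma setting_iso_invariant (C : pcategory) (E : mclass C) (B : C -> Prop) :
  birkhoff_setting E B -> iso_invariant E.
Proof. by move=> [_ hE _] *; exact: (ext_conj hE). Qed.

Lemma setting_replete (C : pcategory) (E : mclass C) (B : C -> Prop) :
  birkhoff_setting E B -> replete B.
Proof.
move=> [_ hE hB] A A' f fi BA; apply: (sb_replete hB _ fi BA).
exact: (ends_iso hE fi (sb_sub hB BA)).
Qed.

Section IsoChange.
Variable C : category.
Implicit Types A B D P T : C.

Lemma pb_conj A B D P A' B' D' (f : hom A B) (g : hom D B) (p : hom P A)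
  (q : hom P D) (f' : hom A' B') (g' : hom D' B') (a : hom A A') (b : hom B B')
  (d : hom D D') :
  is_iso a -> is_iso b -> is_iso d -> f' ∘ a = b ∘ f -> g' ∘ d = b ∘ g ->
  is_pullback f g p q -> is_pullback f' g' (a ∘ p) (d ∘ q).
Proof.
move=> ai bi di fa gd pb; have [a' [a'a aa']] := ai; have [d' [d'd dd']] := di.
apply: pb_intro.
- by rewrite !compmA fa gd -!compmA (pb_comm pb).
- move=> T x y xy; have [|t [tx ty]] := pb_lift pb (a := a' ∘ x) (d := d' ∘ y).
    apply: (iso_mono bi); rewrite !compmA -fa -gd -!compmA.
    by rewrite (comp_eq aa') (comp_eq dd') !comp1m.
  exists t; rewrite -!compmA tx ty.
  by rewrite (comp_eq aa') (comp_eq dd') !comp1m.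
- move=> T u v; rewrite -!compmA => /(iso_mono ai) e /(iso_mono di).
  exact: (pb_mono pb).
Qed.

Lemma pb_apex A B D P Q (f : hom A B) (g : hom D B) (p : hom P A)
  (q : hom P D) (h : hom Q P) :
  is_iso h -> is_pullback f g p q -> is_pullback f g (p ∘ h) (q ∘ h).
Proof.
move=> hi pb; have [k [kh hk]] := hi; apply: pb_intro.
- by rewrite !compmA (pb_comm pb).
- move=> T x y /(pb_lift pb) [t [<- <-]]; exists (k ∘ t).
  by rewrite -!compmA (comp_eq hk) comp1m.
- move=> T u v; rewrite -!compmA => e e'; apply: (iso_mono hi).
  exact: (pb_mono pb).
Qed.

Lemma reflection_conj (D : C -> Prop) A I A' I' (eta : hom A I)
  (zeta : hom A' I') (i : hom A A') (j : hom I I') :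
  replete D -> is_iso i -> is_iso j -> zeta ∘ i = j ∘ eta ->
  is_reflection D eta -> is_reflection D zeta.
Proof.
move=> hD ii ji e [DI uI]; split; first exact: hD ji DI.
have [i' [i'i ii']] := ii; have [j' [j'j jj']] := ji.
have ez : zeta = j ∘ (eta ∘ i') by rewrite compmA -e -compmA ii' compm1.
move=> Y f DY; have [g [ge gU]] := uI _ (f ∘ i) DY.
exists (g ∘ j'); split.
  by rewrite ez -compmA (comp_eq j'j) comp1m compmA ge -compmA ii' compm1.
move=> h hz; rewrite (gU (h ∘ j)); first by rewrite -compmA jj' compm1.
by rewrite -compmA -e compmA hz.
Qed.

Lemma trivial_ext_conj (E : mclass C) (D : C -> Prop) A B A' B' (f : hom A B)
  (f' : hom A' B') (i : hom A A') (j : hom B B') :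
  iso_invariant E -> replete D -> is_iso i -> is_iso j -> f' ∘ i = j ∘ f ->
  trivial_ext E D f -> trivial_ext E D f'.
Proof.
move=> hE hD ii ji e [Ef [IA [IB [eA [eB [g [rA rB pb]]]]]]].
have [i' [i'i ii']] := ii; have [j' [j'j jj']] := ji.
split; first exact: hE ii ji e Ef.
exists IA, IB, (eA ∘ i'), (eB ∘ j'), g; split.
- apply: (reflection_conj hD ii (iso_id _) _ rA).
  by rewrite -compmA i'i compm1 comp1m.
- apply: (reflection_conj hD ji (iso_id _) _ rB).
  by rewrite -compmA j'j compm1 comp1m.
- have ii'i : is_iso i' by exists i.
  have pb' : is_pullback g (eB ∘ j') (idm IA ∘ eA) (j ∘ f).
    apply: (pb_conj (iso_id IA) (iso_id IB) ji _ _ pb); first by rewrite comp1m compm1.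
    by rewrite -compmA j'j compm1 comp1m.
  have := pb_apex ii'i pb'.
  by rewrite -e -(compmA f') ii' compm1 comp1m.
Qed.

End IsoChange.

Definition arr_fun_map (X Y : category) (F : functor X Y) (a b : Arr X)
  (s : hom a b) :
  @hom (Arr Y) (Arrow (fmap F (amor a))) (Arrow (fmap F (amor b))).
Proof.
apply: (@Square Y (Arrow (fmap F (amor a))) (Arrow (fmap F (amor b)))
  (fmap F (sq1 s)) (fmap F (sq0 s))).
by rewrite /= -!fmapM sqC.
Defined.

Definition arr_fun (X Y : category) (F : functor X Y) : functor (Arr X) (Arr Y).
Proof.
apply: (@Functor (Arr X) (Arr Y) (fun a => Arrow (fmap F (amor a)))
  (@arr_fun_map X Y F)).
- by move=> a; apply: squareP; exact: fmap1.
- by move=> a b c t s; apply: squareP; exact: fmapM.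
Defined.

Lemma fmap_iso (X Y : category) (F : functor X Y) (A B : X) (f : hom A B) :
  is_iso f -> is_iso (fmap F f).
Proof. by move=> [g [gf fg]]; exists (fmap F g); rewrite -!fmapM gf fg !fmap1. Qed.

Section Transport.
Variables (X Y : category) (F : functor X Y).
Hypothesis hF : is_equivalence F.

Lemma equivalence_iso (A B : X) (f : hom A B) : is_iso (fmap F f) -> is_iso f.
Proof.
move=> [g' [gf fg]]; have [g gE] := eqv_full hF g'; exists g; split;
  by apply: (eqv_faithful hF); rewrite fmapM gE fmap1.
Qed.

Lemma equivalence_pb (A B D P : X) (f : hom A B) (g : hom D B) (p : hom P A)
  (q : hom P D) :
  is_pullback f g p q <-> is_pullback (fmap F f) (fmap F g) (fmap F p) (fmap F q).
Proof.
split=> pb; apply: pb_intro.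
- by rewrite -!fmapM (pb_comm pb).
- move=> T x y xy; have [T' [h [h' [h'h hh']]]] := eqv_surj hF T.
  have [x' x'E] := eqv_full hF (x ∘ h); have [y' y'E] := eqv_full hF (y ∘ h).
  have [|t [tx ty]] := pb_lift pb (a := x') (d := y').
    by apply: (eqv_faithful hF); rewrite !fmapM x'E y'E !compmA xy.
  exists (fmap F t ∘ h'); rewrite !compmA -!fmapM tx ty x'E y'E -!compmA hh'.
  by rewrite !compm1.
- move=> T u v pu qu; have [T' [h hi]] := eqv_surj hF T.
  have [u' u'E] := eqv_full hF (u ∘ h); have [v' v'E] := eqv_full hF (v ∘ h).
  apply: (iso_epi hi); rewrite -u'E -v'E; congr (fmap F _).
  by apply: (pb_mono pb); apply: (eqv_faithful hF);
    rewrite !fmapM u'E v'E !compmA ?pu ?qu.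
- by apply: (eqv_faithful hF); rewrite !fmapM (pb_comm pb).
- move=> T x y xy; have [|t' [tx ty]] := pb_lift pb (a := fmap F x) (d := fmap F y).
    by rewrite -!fmapM xy.
  have [t tE] := eqv_full hF t'; exists t; split;
    by apply: (eqv_faithful hF); rewrite fmapM tE.
- move=> T u v pu qu; apply: (eqv_faithful hF).
  by apply: (pb_mono pb); rewrite -!fmapM ?pu ?qu.
Qed.

Section Classes.
Variables (EX : mclass X) (DX : X -> Prop) (EY : mclass Y) (DY : Y -> Prop).
Hypothesis hE : forall (A B : X) (f : hom A B), EX f <-> EY (fmap F f).
Hypothesis hD : forall A : X, DX A <-> DY (F A).
Hypothesis invY : iso_invariant EY.
Hypothesis repY : replete DY.

Lemma equivalence_reflection (A I : X) (eta : hom A I) :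
  is_reflection DX eta <-> is_reflection DY (fmap F eta).
Proof.
split=> [[/hD DI uI]|[/hD DI uI]]; split=> // Z f DZ.
- have [Z' [h hi]] := eqv_surj hF Z; have [h' [h'h hh']] := hi.
  have DZ' : DX Z' by apply/hD; exact: (repY (ex_intro _ h (conj hh' h'h)) DZ).
  have [f' f'E] := eqv_full hF (h' ∘ f).
  have [g [ge gU]] := uI _ f' DZ'; exists (h ∘ fmap F g); split.
    by rewrite -compmA -fmapM ge f'E (comp_eq hh') comp1m.
  move=> k ke; have [k' k'E] := eqv_full hF (h' ∘ k).
  rewrite (gU k'); first by rewrite k'E (comp_eq hh') comp1m.
  by apply: (eqv_faithful hF); rewrite fmapM k'E f'E -compmA ke.
- have [g' [ge gU]] := uI _ (fmap F f) (proj1 (hD Z) DZ).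
  have [g gE] := eqv_full hF g'; exists g; split.
    by apply: (eqv_faithful hF); rewrite fmapM gE.
  move=> k ke; apply: (eqv_faithful hF).
  by rewrite gE; apply: gU; rewrite -fmapM ke.
Qed.

Lemma equivalence_reflection_lift (A : X) (Z : Y) (zeta : hom (F A) Z) :
  is_reflection DY zeta -> exists (I : X) (eta : hom A I) (h : hom (F I) Z),
    [/\ is_iso h, h ∘ fmap F eta = zeta & is_reflection DX eta].
Proof.
move=> r; have [I [h hi]] := eqv_surj hF Z; have [h' [h'h hh']] := hi.
have [eta etaE] := eqv_full hF (h' ∘ zeta).
exists I, eta, h; rewrite etaE (comp_eq hh') comp1m; split=> //.
apply/equivalence_reflection; rewrite etaE.
apply: (reflection_conj repY (iso_id _) _ _ r (j := h')); first by exists h.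
by rewrite compm1.
Qed.

Lemma equivalence_double_ext (a b : Arr X) (s : hom a b) :
  double_ext EX s <-> double_ext EY (fmap (arr_fun F) s).
Proof.
split.
- move=> [/hE ? /hE ? /hE ? /hE ? [P [p0 [p1 [u [pb /hE ? /hE ? [u0 u1] /hE ?]]]]]].
  split=> //; exists (F P), (fmap F p0), (fmap F p1), (fmap F u); split=> //.
  + exact: (proj1 (equivalence_pb _ _ _ _) pb).
  + by rewrite -!fmapM u0 u1.
- move=> [? ? ? ? [P [p0 [p1 [u [pb E0 E1 [u0 u1] Eu]]]]]].
  have [P' [h hi]] := eqv_surj hF P; have [h' [h'h hh']] := hi.
  have h'i : is_iso h' by exists h.
  have [p0' p0E] := eqv_full hF (p0 ∘ h); have [p1' p1E] := eqv_full hF (p1 ∘ h).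
  have [u' uE] := eqv_full hF (h' ∘ u).
  split; try exact/hE; exists P', p0', p1', u'; split.
  + apply/equivalence_pb; rewrite p0E p1E; exact: pb_apex.
  + apply/hE; rewrite p0E; apply: (invY h'i (iso_id _) _ E0).
    by rewrite -compmA hh' compm1 comp1m.
  + apply/hE; rewrite p1E; apply: (invY h'i (iso_id _) _ E1).
    by rewrite -compmA hh' compm1 comp1m.
  + split; apply: (eqv_faithful hF).
    * by rewrite fmapM p0E uE -compmA (comp_eq hh') comp1m.
    * by rewrite fmapM p1E uE -compmA (comp_eq hh') comp1m.
  + by apply/hE; rewrite uE; apply: (invY (iso_id _) h'i _ Eu); rewrite compm1.
Qed.

Lemma equivalence_trivial (A B : X) (f : hom A B) :
  trivial_ext EX DX f <-> trivial_ext EY DY (fmap F f).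
Proof.
split.
- move=> [/hE Ef [IA [IB [eA [eB [g [rA rB pb]]]]]]]; split=> //.
  exists (F IA), (F IB), (fmap F eA), (fmap F eB), (fmap F g); split.
  + exact/equivalence_reflection.
  + exact/equivalence_reflection.
  + exact: (proj1 (equivalence_pb _ _ _ _) pb).
- move=> [/hE Ef [IA' [IB' [eA' [eB' [g' [rA' rB' pb]]]]]]]; split=> //.
  have [IA [eA [h [hi he rA]]]] := equivalence_reflection_lift rA'.
  have [IB [eB [k [ki ke rB]]]] := equivalence_reflection_lift rB'.
  have [h' [h'h hh']] := hi; have [k' [k'k kk']] := ki.
  have [g gE] := eqv_full hF (k' ∘ (g' ∘ h)).
  exists IA, IB, eA, eB, g; split=> //; apply/equivalence_pb.
  have h'i : is_iso h' by exists h.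
  have k'i : is_iso k' by exists k.
  have := pb_conj (f' := fmap F g) (g' := fmap F eB) h'i k'i (iso_id _) _ _ pb.
  rewrite -he (comp_eq h'h) comp1m [idm _ ∘ fmap F f]comp1m; apply.
  + by rewrite gE -!compmA hh' compm1.
  + by rewrite -ke (comp_eq k'k) comp1m compm1.
Qed.

Lemma equivalence_central (A B : X) (f : hom A B) :
  central_ext EX DX f <-> central_ext EY DY (fmap F f).
Proof.
split.
- move=> [/hE Ef [Z [g [P [pA [pZ [/hE Eg pb /equivalence_trivial t]]]]]]].
  split=> //; exists (F Z), (fmap F g), (F P), (fmap F pA), (fmap F pZ).
  by split=> //; exact: (proj1 (equivalence_pb _ _ _ _) pb).
- move=> [/hE Ef [Z' [g' [P' [pA' [pZ' [Eg' pb t]]]]]]]; split=> //.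
  have [Z [h hi]] := eqv_surj hF Z'; have [h' [h'h hh']] := hi.
  have [P [k ki]] := eqv_surj hF P'; have [k' [k'k kk']] := ki.
  have h'i : is_iso h' by exists h.
  have k'i : is_iso k' by exists k.
  have [g gE] := eqv_full hF (g' ∘ h).
  have [pA pAE] := eqv_full hF (pA' ∘ k).
  have [pZ pZE] := eqv_full hF (h' ∘ (pZ' ∘ k)).
  exists Z, g, P, pA, pZ; split.
  + apply/hE; rewrite gE; apply: (invY h'i (iso_id _) _ Eg').
    by rewrite -compmA hh' compm1 comp1m.
  + apply/equivalence_pb; rewrite pAE pZE compmA.
    rewrite -(comp1m pA'); apply: (pb_apex ki).
    apply: (pb_conj (iso_id _) (iso_id _) h'i _ _ pb); first by rewrite compm1 comp1m.
    by rewrite gE -compmA hh' compm1 comp1m.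
  + apply/equivalence_trivial; rewrite pZE.
    apply: (trivial_ext_conj invY repY k'i h'i _ t).
    by rewrite -!compmA kk' compm1.
Qed.

End Classes.

Lemma arr_equivalence : is_equivalence (arr_fun F).
Proof.
split.
- move=> a b s; have [f1 f1E] := eqv_full hF (sq1 s).
  have [f0 f0E] := eqv_full hF (sq0 s).
  have sC : b ∘ f1 = f0 ∘ a.
    by apply: (eqv_faithful hF); rewrite !fmapM f1E f0E; exact: (sqC s).
  by exists (Square sC); apply: squareP.
- move=> a b s t e; apply: squareP; apply: (eqv_faithful hF).
  + exact: (sq1_congr e).
  + exact: (sq0_congr e).
- move=> b; have [A1 [h1 hi1]] := eqv_surj hF (adom b).
  have [A0 [h0 hi0]] := eqv_surj hF (acod b); have [h0' [h'h hh']] := hi0.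
  have [a aE] := eqv_full hF (h0' ∘ (b ∘ h1)).
  have sC : b ∘ h1 = h0 ∘ fmap F a by rewrite aE (comp_eq hh') comp1m.
  exists (Arrow a), (@Square Y (Arrow (fmap F a)) b h1 h0 sC).
  exact: arr_iso_intro.
Qed.

End Transport.

(** The relation between two settings under which their central extensions
correspond too: by [transports_arr] it passes to arrows. *)
Record transports (X Y : category) (F : functor X Y) (EX : mclass X)
  (DX : X -> Prop) (EY : mclass Y) (DY : Y -> Prop) : Prop := Transports {
  tr_eqv : is_equivalence F;
  tr_ext : forall (A B : X) (f : hom A B), EX _ _ f <-> EY _ _ (fmap F f);
  tr_obj : forall A : X, DX A <-> DY (F A) }.

Definition natural_iso (X Y : category) (F G : functor X Y) :=
  exists theta : nattrans F G, forall A, is_iso (theta A).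

Section TransportCalculus.
Variables X Y Z : category.

Lemma equivalence_comp (G : functor Y Z) (F : functor X Y) :
  is_equivalence G -> is_equivalence F -> is_equivalence (fcomp G F).
Proof.
move=> hG hF; split.
- move=> A B g; have [g' <-] := eqv_full hG g.
  by have [f <-] := eqv_full hF g'; exists f.
- by move=> A B f g /(eqv_faithful hG) /(eqv_faithful hF).
- move=> W; have [V [h hi]] := eqv_surj hG W; have [U [k ki]] := eqv_surj hF V.
  exists U, (h ∘ fmap G k); apply: iso_comp => //; exact: fmap_iso.
Qed.

Lemma transports_comp (G : functor Y Z) (F : functor X Y) EX DX EY DY EZ DZ :
  transports G EY DY EZ DZ -> transports F EX DX EY DY ->
  transports (fcomp G F) EX DX EZ DZ.
Proof.
move=> hG hF; split.
- exact: equivalence_comp (tr_eqv hG) (tr_eqv hF).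
- by move=> A B f; rewrite (tr_ext hF) (tr_ext hG).
- by move=> A; rewrite (tr_obj hF) (tr_obj hG).
Qed.

Lemma transports_cancel (G : functor Y Z) (F : functor X Y) EX DX EY DY EZ DZ :
  is_equivalence F -> transports G EY DY EZ DZ ->
  transports (fcomp G F) EX DX EZ DZ -> transports F EX DX EY DY.
Proof.
move=> hF hG hGF; split=> // [A B f|A].
- by rewrite (tr_ext hGF) (tr_ext hG).
- by rewrite (tr_obj hGF) (tr_obj hG).
Qed.

Lemma transports_natural_iso (F G : functor X Y) EX DX EY DY :
  iso_invariant EY -> replete DY -> natural_iso F G ->
  transports F EX DX EY DY -> transports G EX DX EY DY.
Proof.
move=> invY repY [t ti] hF.
have inv A : exists2 t' : hom (G A) (F A), is_iso t' &
    t' ∘ t A = idm _ /\ t A ∘ t' = idm _ by exact: iso_inv.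
have nat A B (f : hom A B) t' : t A ∘ t' = idm _ ->
    fmap G f = t B ∘ fmap F f ∘ t'.
  by move=> e; rewrite nt_nat -compmA e compm1.
split; first split.
- move=> A B g; have [t' _ [e1 e2]] := inv A; have [u' _ [e3 e4]] := inv B.
  have [f fE] := eqv_full (tr_eqv hF) (u' ∘ (g ∘ t A)); exists f.
  by rewrite (nat _ _ _ _ e2) fE (comp_eq e4) comp1m -compmA e2 compm1.
- move=> A B f g e; apply: (eqv_faithful (tr_eqv hF)).
  by apply: (iso_mono (ti B)); rewrite !nt_nat e.
- move=> W; have [A [h hi]] := eqv_surj (tr_eqv hF) W.
  have [t' t'i _] := inv A; exists A, (h ∘ t'); exact: iso_comp.
- move=> A B f; rewrite (tr_ext hF).
  have [t' t'i [e1 e2]] := inv A; have [u' u'i [e3 e4]] := inv B.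
  split; first exact: (invY _ _ _ _ _ _ _ _ (ti A) (ti B) (esym (nt_nat t f))).
  apply: (invY _ _ _ _ _ _ _ _ t'i u'i).
  by rewrite (nat _ _ f _ e2) !compmA e3 comp1m.
- move=> A; rewrite (tr_obj hF); have [t' t'i _] := inv A.
  by split; [exact: repY (ti A) | exact: repY t'i].
Qed.

Lemma transports_arr (F : functor X Y) EX DX EY DY :
  iso_invariant EY -> replete DY -> transports F EX DX EY DY ->
  transports (arr_fun F) (double_ext EX) (CExt EX DX) (double_ext EY) (CExt EY DY).
Proof.
move=> invY repY [hF hE hD]; split.
- exact: arr_equivalence.
- by move=> a b s; exact: equivalence_double_ext.
- by move=> a; exact: (equivalence_central hF hE hD invY repY (amor a)).
Qed.

Lemma transports_iso_invariant (F : functor X Y) EX DX EY DY :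
  transports F EX DX EY DY -> iso_invariant EY -> iso_invariant EX.
Proof.
move=> hF invY A B A' B' f f' i j ii ji e; rewrite !(tr_ext hF).
apply: (invY _ _ _ _ _ _ _ _ (fmap_iso F ii) (fmap_iso F ji)).
by rewrite -!fmapM e.
Qed.

Lemma transports_replete (F : functor X Y) EX DX EY DY :
  transports F EX DX EY DY -> replete DY -> replete DX.
Proof.
move=> hF repY A B f fi; rewrite !(tr_obj hF).
exact: repY (fmap_iso F fi).
Qed.

End TransportCalculus.

(** Transposing twice is the identity only up to the eta rule for arrows, hence
the isomorphisms. *)
Lemma transposition_involutive (C : category) (f g : Arr (Arr C)) (s : hom f g) :
  exists h, is_iso h /\ exists k, is_iso k /\
    s ∘ h = k ∘ fmap (transposition C) (fmap (transposition C) s).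
Proof.
have ex (x : Arr (Arr C)) : exists h : hom (transpose_obj (transpose_obj x)) x,
    [/\ sq1 (sq1 h) = idm _, sq0 (sq1 h) = idm _, sq1 (sq0 h) = idm _ &
      sq0 (sq0 h) = idm _].
  pose d := @Square C (adom (transpose_obj (transpose_obj x))) (adom x) (idm _)
    (idm _) (etrans (compm1 _) (esym (comp1m _))).
  pose c := @Square C (acod (transpose_obj (transpose_obj x))) (acod x) (idm _)
    (idm _) (etrans (compm1 _) (esym (comp1m _))).
  have e : @compm (Arr C) _ _ _ (amor x) d =
      @compm (Arr C) _ _ _ c (amor (transpose_obj (transpose_obj x))).
    by apply: squareP => /=; rewrite compm1 comp1m.
  by exists (@Square (Arr C) (transpose_obj (transpose_obj x)) x d c e).
have ii (x : Arr (Arr C)) (h : hom (transpose_obj (transpose_obj x)) x) :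
    [/\ sq1 (sq1 h) = idm _, sq0 (sq1 h) = idm _, sq1 (sq0 h) = idm _ &
      sq0 (sq0 h) = idm _] -> is_iso h.
  move=> [e11 e01 e10 e00].
  apply: arr_iso_intro; apply: arr_iso_intro; rewrite ?e11 ?e01 ?e10 ?e00;
    exact: iso_id.
have [h hE] := ex f; have [k kE] := ex g; exists h; split; first exact: ii.
exists k; split; first exact: ii.
case: hE kE => h11 h01 h10 h00 [k11 k01 k10 k00].
by apply: squareP; apply: squareP;
  rewrite /= ?h11 ?h01 ?h10 ?h00 ?k11 ?k01 ?k10 ?k00 compm1 comp1m.
Qed.

Lemma transposition_equivalence (C : category) : is_equivalence (transposition C).
Proof.
split.
- move=> f g s.
  pose t1 := @Square C (adom f) (adom g) (sq1 (sq1 s)) (sq1 (sq0 s))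
    (sq1_congr (sqC s)).
  pose t0 := @Square C (acod f) (acod g) (sq0 (sq1 s)) (sq0 (sq0 s))
    (sq0_congr (sqC s)).
  have tC : @compm (Arr C) _ _ _ (amor g) t1 = @compm (Arr C) _ _ _ t0 (amor f).
    by apply: squareP => /=; [exact: (sqC (sq1 s)) | exact: (sqC (sq0 s))].
  by exists (@Square (Arr C) f g t1 t0 tC); apply: squareP; apply: squareP.
- move=> f g s t e; apply: squareP; apply: squareP.
  + exact: (sq1_congr (sq1_congr e)).
  + exact: (sq1_congr (sq0_congr e)).
  + exact: (sq0_congr (sq1_congr e)).
  + exact: (sq0_congr (sq0_congr e)).
- move=> f; have [h [hi _]] := transposition_involutive (idm f).
  by exists (transpose_obj f), h.
Qed.

Lemma transposition_transports (C : pcategory) (E : mclass C) (B : C -> Prop) :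
  birkhoff_setting E B ->
  transports (transposition C) (double_ext (double_ext E))
    (CExt (double_ext E) (CExt E B)) (double_ext (double_ext E))
    (CExt (double_ext E) (CExt E B)).
Proof.
move=> hG; have [hC hE hB] := hG; split; first exact: transposition_equivalence.
- move=> f g s; split=> [|/(transpose_map_ext hC hE) sD].
    exact: transpose_map_ext.
  have [h [hi [k [ki e]]]] := transposition_involutive s.
  exact: (setting_iso_invariant (setting_arr (setting_arr hG)) hi ki e sD).
- move=> f; split=> [|/(central_transpose hC hE hB) fD].
    exact: central_transpose.
  have [h [hi _]] := transposition_involutive (idm f).
  exact: (setting_replete (setting_arr (setting_arr hG)) hi fD).
Qed.

(** * Arrows of functors as functors to arrows *)

Section NatIso.
Variables J C : category.
Implicit Types F G : functor J C.

Lemma nt_congr F G (s t : nattrans F G) : s = t -> forall j, s j = t j.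
Proof. by move->. Qed.

Lemma nattrans_iso F G (t : nattrans F G) :
  (forall j, is_iso (t j)) -> @is_iso (Fun J C) F G t.
Proof.
move=> ti; pose u j := sval (cid (ti j)).
have uK j : u j ∘ t j = idm _ /\ t j ∘ u j = idm _ := proj2_sig (cid (ti j)).
have un (i j : J) (f : hom i j) : u j ∘ fmap G f = fmap F f ∘ u i.
  rewrite -[fmap G f]compm1 -(proj2 (uK i)) (compmA (fmap G f)) -nt_nat.
  by rewrite -!compmA (compmA (u j)) (proj1 (uK j)) comp1m.
by exists (NatTrans un); split; apply: nattransP => j; case: (uK j).
Qed.

Lemma nattrans_iso_at F G (t : nattrans F G) j :
  @is_iso (Fun J C) F G t -> is_iso (t j).
Proof.
move=> [u [ut tu]]; exists (u j); split.
- by rewrite -[idm (F j)]/(nt_id F j) -[nt_id F]ut.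
- by rewrite -[idm (G j)]/(nt_id G j) -[nt_id G]tu.
Qed.

End NatIso.

Section Pack.
Variables J C : category.

Definition arrows_inside_obj (a : Arr (Fun J C)) : Fun J (Arr C).
Proof.
apply: (@Functor J (Arr C) (fun j => Arrow (nt_at (amor a) j))
  (fun i j f => @Square C (Arrow (nt_at (amor a) i)) (Arrow (nt_at (amor a) j))
     (fmap (adom a) f) (fmap (acod a) f) (nt_nat (amor a) f))).
- by move=> j; apply: squareP; exact: fmap1.
- by move=> i j k g f; apply: squareP; exact: fmapM.
Defined.

Lemma arrows_inside_sqC (a b : Arr (Fun J C)) (s : hom a b) j :
  nt_at (amor b) j ∘ nt_at (sq1 s) j = nt_at (sq0 s) j ∘ nt_at (amor a) j.
Proof. exact: (nt_congr (sqC s) j). Qed.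

Definition arrows_inside_map (a b : Arr (Fun J C)) (s : hom a b) :
  hom (arrows_inside_obj a) (arrows_inside_obj b).
Proof.
apply: (@NatTrans J (Arr C) (arrows_inside_obj a) (arrows_inside_obj b)
  (fun j => @Square C (Arrow (nt_at (amor a) j)) (Arrow (nt_at (amor b) j))
     _ _ (arrows_inside_sqC s j))).
by move=> i j f; apply: squareP; exact: nt_nat.
Defined.

Definition arrows_inside : functor (Arr (Fun J C)) (Fun J (Arr C)).
Proof.
apply: (@Functor (Arr (Fun J C)) (Fun J (Arr C)) arrows_inside_obj arrows_inside_map).
- by move=> a; apply: nattransP => j; apply: squareP.
- by move=> a b c t s; apply: nattransP => j; apply: squareP.
Defined.

Lemma arrows_inside_equivalence : is_equivalence arrows_inside.
Proof.
split.
- move=> a b t.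
  pose t1 := @NatTrans J C (adom a) (adom b) (fun j => sq1 (nt_at t j))
    (fun i j f => sq1_congr (nt_nat t f)).
  pose t0 := @NatTrans J C (acod a) (acod b) (fun j => sq0 (nt_at t j))
    (fun i j f => sq0_congr (nt_nat t f)).
  have e : @compm (Fun J C) _ _ _ (amor b) t1 = @compm (Fun J C) _ _ _ t0 (amor a).
    by apply: nattransP => j; exact: (sqC (nt_at t j)).
  exists (@Square (Fun J C) a b t1 t0 e).
  by apply: nattransP => j; apply: squareP.
- move=> a b s t e; have ej j : nt_at (arrows_inside_map s) j = nt_at (arrows_inside_map t) j.
    by rewrite -[arrows_inside_map s]/(fmap arrows_inside s) e.
  apply: squareP; apply: nattransP => j.
  + exact: (sq1_congr (ej j)).
  + exact: (sq0_congr (ej j)).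
- move=> F.
  pose F1 := @Functor J C (fun j => adom (F j)) (fun i j f => sq1 (fmap F f))
    (fun j => sq1_congr (fmap1 F j)) (fun i j k g f => sq1_congr (fmapM F g f)).
  pose F0 := @Functor J C (fun j => acod (F j)) (fun i j f => sq0 (fmap F f))
    (fun j => sq0_congr (fmap1 F j)) (fun i j k g f => sq0_congr (fmapM F g f)).
  pose u := @NatTrans J C F1 F0 (fun j => amor (F j)) (fun i j f => sqC (fmap F f)).
  pose a : Arr (Fun J C) := @Arrow (Fun J C) F1 F0 u.
  pose c j := @Square C (Arrow (amor (F j))) (F j) (idm _) (idm _)
    (etrans (compm1 _) (esym (comp1m _))).
  have cn (i j : J) (f : hom i j) : @compm (Arr C) _ _ _ (c j) (fmap (arrows_inside_obj a) f) =
      @compm (Arr C) _ _ _ (fmap F f) (c i).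
    by apply: squareP => /=; rewrite compm1 comp1m.
  exists a, (@NatTrans J (Arr C) (arrows_inside_obj a) F c cn).
  by apply: nattrans_iso => j; apply: arr_iso_intro; exact: iso_id.
Qed.

End Pack.

(** * Faces of cubes *)

(** A common retraction of [face i] and of [fun S => i |: face i S]. *)
Definition coface (n : nat) (i : 'I_n.+1) (S : {set 'I_n.+1}) : {set 'I_n} :=
  [set j | lift i j \in S].

Section Faces.
Variables (n : nat) (i : 'I_n.+1).
Implicit Types S T : {set 'I_n}.

Lemma notin_face S : i \in face i S = false.
Proof.
by apply/negP => /imsetP [j _ ij]; have := neq_lift i j; rewrite -ij eqxx.
Qed.

Lemma in_faceU S : i \in i |: face i S.
Proof. exact: setU11. Qed.

Lemma lift_in_face S j : (lift i j \in face i S) = (j \in S).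
Proof. exact: mem_imset (@lift_inj _ i). Qed.

Lemma lift_in_faceU S j : (lift i j \in i |: face i S) = (j \in S).
Proof. by rewrite in_setU1 lift_in_face eq_sym (negbTE (neq_lift i j)). Qed.

Lemma coface_face S : coface i (face i S) = S.
Proof. by apply/setP => j; rewrite inE lift_in_face. Qed.

Lemma coface_faceU S : coface i (i |: face i S) = S.
Proof. by apply/setP => j; rewrite inE lift_in_faceU. Qed.

Lemma coface_sub (S T : {set 'I_n.+1}) : S \subset T -> coface i S \subset coface i T.
Proof. by move=> /subsetP st; apply/subsetP => j; rewrite !inE => /st. Qed.

Lemma face_coface (S : {set 'I_n.+1}) : i \notin S -> face i (coface i S) = S.
Proof.
move=> iS; apply/setP => k; case: (unliftP i k) => [j|] ->.
- by rewrite lift_in_face inE.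
- by rewrite notin_face (negbTE iS).
Qed.

Lemma faceU_coface (S : {set 'I_n.+1}) : i \in S -> i |: face i (coface i S) = S.
Proof.
move=> iS; apply/setP => k; case: (unliftP i k) => [j|] ->.
- by rewrite lift_in_faceU inE.
- by rewrite in_faceU iS.
Qed.

Lemma face_cases (S : {set 'I_n.+1}) :
  (exists S', S = i |: face i S') \/ (exists S', S = face i S').
Proof.
case: (boolP (i \in S)) => iS; [left | right]; exists (coface i S).
- by rewrite faceU_coface.
- by rewrite face_coface.
Qed.

End Faces.

Section Nmap.
Variables (C : category) (n : nat) (A : nArr n C).
Implicit Types S T U : {set 'I_n}.

Lemma nmap_square S T T' U (st : S \subset T) (tu : T \subset U)
  (st' : S \subset T') (t'u : T' \subset U) :
  nmap A st ∘ nmap A tu = nmap A st' ∘ nmap A t'u.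
Proof.
have su := subset_trans st tu.
by rewrite -(nmapM A st tu su) -(nmapM A st' t'u su).
Qed.

Lemma nmap_iso S T (st : S \subset T) : T \subset S -> is_iso (nmap A st).
Proof.
move=> ts; exists (nmap A ts).
by rewrite -(nmapM A ts st (subxx T)) -(nmapM A st ts (subxx S)) !nmap1.
Qed.

End Nmap.

(** In direction [ord_max] this is [delta], up to a proof of commutativity. *)
Definition direction_map (n : nat) (C : category) (i : 'I_n.+1)
  (A B : nArr n.+1 C) (f : hom A B) :
  @hom (Arr (nArr n C)) (@Arrow (nArr n C) _ _ (face_arrow i A))
    (@Arrow (nArr n C) _ _ (face_arrow i B)).
Proof.
apply: (@Square (nArr n C) (@Arrow (nArr n C) _ _ (face_arrow i A))
  (@Arrow (nArr n C) _ _ (face_arrow i B))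
  (upper_face_map i f) (lower_face_map i f)).
by apply: nattransP => S; exact: (esym (nmap_nat f (face_faceU i S))).
Defined.

Definition direction (n : nat) (C : category) (i : 'I_n.+1) :
  functor (nArr n.+1 C) (Arr (nArr n C)).
Proof.
apply: (@Functor (nArr n.+1 C) (Arr (nArr n C))
  (fun A => @Arrow (nArr n C) _ _ (face_arrow i A)) (@direction_map n C i)).
- by move=> A; apply: squareP; apply: nattransP.
- by move=> A B D g f; apply: squareP; apply: nattransP.
Defined.

Arguments direction {n C} i.

Section Direction.
Variables (n : nat) (C : category) (i : 'I_n.+1).

Lemma direction_faithful (A B : nArr n.+1 C) (f g : hom A B) :
  fmap (direction i) f = fmap (direction i) g -> f = g.
Proof.
move=> e; apply: nattransP => S.
case: (face_cases i S) => [[S' ->]|[S' ->]].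
- exact: (nt_congr (sq1_congr e) S').
- exact: (nt_congr (sq0_congr e) S').
Qed.

(** A vertex lies on exactly one of the two faces.  Its component is described
relative to all sets of coordinates equal to it, so that no transport along
equations between sets is needed. *)
Lemma direction_full (A B : nArr n.+1 C)
  (s : hom (direction i A) (direction i B)) : exists f, fmap (direction i) f = s.
Proof.
pose s1 S : hom (fobj A (i |: face i S)) (fobj B (i |: face i S)) := nt_at (sq1 s) S.
pose s0 S : hom (fobj A (face i S)) (fobj B (face i S)) := nt_at (sq0 s) S.
have ex S : exists x : hom (fobj A S) (fobj B S),
    (forall S' (h : S \subset i |: face i S') (h' : i |: face i S' \subset S),
       x = nmap B h ∘ (s1 S' ∘ nmap A h')) /\
    (forall S' (h : S \subset face i S') (h' : face i S' \subset S),
       x = nmap B h ∘ (s0 S' ∘ nmap A h')).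
  case: (face_cases i S) => [[S0 ->]|[S0 ->]].
  - exists (s1 S0); split=> S' h h'.
    + have e : S' = S0.
        by rewrite -(coface_faceU i S') -(coface_faceU i S0); congr coface;
          apply/eqP; rewrite eqEsubset h h'.
      by subst S'; rewrite !nmap1 comp1m compm1.
    + by have := subsetP h _ (in_faceU i S0); rewrite notin_face.
  - exists (s0 S0); split=> S' h h'.
    + by have := subsetP h' _ (in_faceU i S'); rewrite notin_face.
    + have e : S' = S0.
        by rewrite -(coface_face i S') -(coface_face i S0); congr coface;
          apply/eqP; rewrite eqEsubset h h'.
      by subst S'; rewrite !nmap1 comp1m compm1.
pose f S := sval (cid (ex S)).
have fU S : f (i |: face i S) = s1 S.
  rewrite /f; case: cid => x /= [/(_ S (subxx _) (subxx _)) -> _].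
  by rewrite !nmap1 comp1m compm1.
have fL S : f (face i S) = s0 S.
  rewrite /f; case: cid => x /= [_ /(_ S (subxx _) (subxx _)) ->].
  by rewrite !nmap1 comp1m compm1.
have fN (S T : {set 'I_n.+1}) (h : S \subset T) : f S ∘ nmap A h = nmap B h ∘ f T.
  move: h; case: (face_cases i S) => [[S' ->]|[S' ->]];
    case: (face_cases i T) => [[T' ->]|[T' ->]] h; rewrite ?fU ?fL.
  - have h' : S' \subset T'.
      by rewrite -(coface_faceU i S') -(coface_faceU i T'); exact: coface_sub.
    rewrite (bool_irrelevance h (faceU_sub i h')).
    exact: (@nt_nat _ _ _ _ (sq1 s) T' S' h').
  - by have := subsetP h _ (in_faceU i S'); rewrite notin_face.
  - have h' : S' \subset T'.
      by rewrite -(coface_face i S') -(coface_faceU i T'); exact: coface_sub.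
    have sS' : nmap B (face_faceU i S') ∘ s1 S' = s0 S' ∘ nmap A (face_faceU i S').
      exact: (nt_congr (sqC s) S').
    have s1n : s1 S' ∘ nmap A (faceU_sub i h') = nmap B (faceU_sub i h') ∘ s1 T'.
      exact: (@nt_nat _ _ _ _ (sq1 s) T' S' h').
    rewrite (nmapM A (face_faceU i S') (faceU_sub i h')) compmA -sS' -compmA s1n.
    by rewrite compmA -nmapM.
  - have h' : S' \subset T'.
      by rewrite -(coface_face i S') -(coface_face i T'); exact: coface_sub.
    rewrite (bool_irrelevance h (face_sub i h')).
    exact: (@nt_nat _ _ _ _ (sq0 s) T' S' h').
exists (@NatTrans (op (powerset_cat n.+1)) C A B f (fun T S h => fN S T h)).
by apply: squareP; apply: nattransP => S; [exact: fU | exact: fL].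
Qed.

Section Assemble.
Variables (U L : nArr n C) (u : hom U L).

Definition assemble_vertex (S : {set 'I_n.+1}) : C :=
  if i \in S then fobj U (coface i S) else fobj L (coface i S).

Lemma mem_imply (S T : {set 'I_n.+1}) : S \subset T -> (i \in S) ==> (i \in T).
Proof. by move=> st; apply/implyP; exact: (subsetP st). Qed.

Definition assemble_edge (T S : {set 'I_n.+1}) (h : S \subset T) :
  hom (assemble_vertex T) (assemble_vertex S) :=
  match i \in T as b, i \in S as b'
    return (b' ==> b) -> hom (if b then fobj U (coface i T) else fobj L (coface i T))
                        (if b' then fobj U (coface i S) else fobj L (coface i S)) with
  | true, true => fun _ => nmap U (coface_sub i h)
  | true, false => fun _ => nmap L (coface_sub i h) ∘ nt_at u (coface i T)
  | false, false => fun _ => nmap L (coface_sub i h)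
  | false, true => fun e => False_rect _ (notF e)
  end (mem_imply h).

Definition assemble : nArr n.+1 C.
Proof.
apply: (@Functor (op (powerset_cat n.+1)) C assemble_vertex assemble_edge).
- move=> S; rewrite /= /assemble_edge /assemble_vertex.
  move: (mem_imply _); case: (i \in S) => e; exact: nmap1.
- move=> V T S st tu; rewrite /= /assemble_edge /assemble_vertex.
  move: (mem_imply _) (mem_imply _) (mem_imply _).
  case: (i \in V); case: (i \in T); case: (i \in S) => //= _ _ _.
  + exact: nmapM.
  + rewrite -compmA nmap_nat compmA; congr (_ ∘ _); exact: nmapM.
  + rewrite compmA; congr (_ ∘ _); exact: nmapM.
  + exact: nmapM.
Defined.

Lemma sub_coface_faceU (S : {set 'I_n}) : S \subset coface i (i |: face i S).
Proof. by rewrite coface_faceU. Qed.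

Lemma sub_coface_face (S : {set 'I_n}) : S \subset coface i (face i S).
Proof. by rewrite coface_face. Qed.

Definition assemble_upper (S : {set 'I_n}) :
  hom (assemble_vertex (i |: face i S)) (fobj U S) :=
  match i \in i |: face i S as b return b = true ->
    hom (if b then fobj U (coface i (i |: face i S))
         else fobj L (coface i (i |: face i S))) (fobj U S) with
  | true => fun _ => nmap U (sub_coface_faceU S)
  | false => fun e => False_rect _ (Bool.diff_false_true e)
  end (in_faceU i S).

Definition assemble_lower (S : {set 'I_n}) :
  hom (assemble_vertex (face i S)) (fobj L S) :=
  match i \in face i S as b return b = false ->
    hom (if b then fobj U (coface i (face i S))
         else fobj L (coface i (face i S))) (fobj L S) with
  | true => fun e => False_rect _ (Bool.diff_true_false e)
  | false => fun _ => nmap L (sub_coface_face S)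
  end (notin_face i S).

Lemma assemble_upper_nat (T S : {set 'I_n}) (h : S \subset T) :
  assemble_upper S ∘ assemble_edge (faceU_sub i h) = nmap U h ∘ assemble_upper T.
Proof.
rewrite /assemble_upper /assemble_edge /assemble_vertex.
move: (in_faceU i S) (in_faceU i T) (mem_imply _).
by case: (i \in i |: face i S) => //; case: (i \in i |: face i T) => // _ _ _;
  exact: nmap_square.
Qed.

Lemma assemble_lower_nat (T S : {set 'I_n}) (h : S \subset T) :
  assemble_lower S ∘ assemble_edge (face_sub i h) = nmap L h ∘ assemble_lower T.
Proof.
rewrite /assemble_lower /assemble_edge /assemble_vertex.
move: (notin_face i S) (notin_face i T) (mem_imply _).
by case: (i \in face i S) => //; case: (i \in face i T) => // _ _ _;
  exact: nmap_square.
Qed.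

Lemma assemble_comm (S : {set 'I_n}) :
  nt_at u S ∘ assemble_upper S = assemble_lower S ∘ assemble_edge (face_faceU i S).
Proof.
rewrite /assemble_lower /assemble_upper /assemble_edge /assemble_vertex.
move: (in_faceU i S) (notin_face i S) (mem_imply _).
case: (i \in i |: face i S) => //; case: (i \in face i S) => // _ _ _.
rewrite nmap_nat compmA; congr (_ ∘ _).
by rewrite -(nmapM L _ _ (sub_coface_faceU S)).
Qed.

Lemma assemble_upper_iso (S : {set 'I_n}) : is_iso (assemble_upper S).
Proof.
rewrite /assemble_upper /assemble_vertex; move: (in_faceU i S).
case: (i \in i |: face i S) => // _.
by apply: nmap_iso; rewrite coface_faceU.
Qed.

Lemma assemble_lower_iso (S : {set 'I_n}) : is_iso (assemble_lower S).
Proof.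
rewrite /assemble_lower /assemble_vertex; move: (notin_face i S).
case: (i \in face i S) => // _.
by apply: nmap_iso; rewrite coface_face.
Qed.

End Assemble.

Lemma direction_equivalence : is_equivalence (@direction n C i).
Proof.
split; [exact: direction_full | exact: direction_faithful |] => -[U L u].
pose d1 := @NatTrans (op (powerset_cat n)) C (upper_face i (assemble u)) U
  (assemble_upper U L) (fun T S h => assemble_upper_nat u h).
pose d0 := @NatTrans (op (powerset_cat n)) C (lower_face i (assemble u)) L
  (assemble_lower U L) (fun T S h => assemble_lower_nat u h).
have e : @compm (nArr n C) _ _ _ u d1 =
    @compm (nArr n C) _ _ _ d0 (face_arrow i (assemble u)).
  by apply: nattransP => S; exact: assemble_comm.
exists (assemble u), (@Square (nArr n C) (direction i (assemble u))
  (@Arrow (nArr n C) U L u) d1 d0 e).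
apply: arr_iso_intro; apply: nattrans_iso => S.
- exact: assemble_upper_iso.
- exact: assemble_lower_iso.
Qed.

End Direction.

Definition eval0 (C : category) : functor (nArr 0 C) C :=
  @Functor (nArr 0 C) C (fun A => fobj A set0) (fun A B f => nt_at f set0)
    (fun A => erefl) (fun A B D g f => erefl).

Lemma subset_of_set0 (S T : {set 'I_0}) : S \subset T.
Proof. by apply/subsetP => -[]. Qed.

Lemma eval0_equivalence (C : category) : is_equivalence (eval0 C).
Proof.
split.
- move=> A B g.
  pose f S := nmap B (subset_of_set0 S set0) ∘ (g ∘ nmap A (subset_of_set0 set0 S)).
  have fN (T S : {set 'I_0}) (h : S \subset T) : f S ∘ nmap A h = nmap B h ∘ f T.
    rewrite /f -!compmA -(nmapM A _ _ (subset_of_set0 _ _)) compmA.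
    by rewrite (compmA (nmap B h)) -(nmapM B _ _ (subset_of_set0 _ _)) compmA.
  exists (@NatTrans (op (powerset_cat 0)) C A B f fN).
  by rewrite /= /f !nmap1 comp1m compm1.
- move=> A B f g e; apply: nattransP => S.
  have -> : S = set0 by apply/setP => -[].
  exact: e.
- move=> X; exists (@Functor (op (powerset_cat 0)) C (fun=> X) (fun _ _ _ => idm X)
    (fun=> erefl) (fun _ _ _ _ _ => esym (comp1m (idm X)))), (idm X).
  exact: iso_id.
Qed.

Lemma delta_equivalence (n : nat) (C : category) : is_equivalence (delta n C).
Proof.
have hd := @direction_equivalence n C ord_max.
have e (A B : nArr n.+1 C) (f : hom A B) :
    fmap (delta n C) f = fmap (direction ord_max) f by exact: squareP.
split.
- move=> A B s; have [f <-] := eqv_full hd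
    (s : hom (direction ord_max A) (direction ord_max B)).
  by exists f.
- by move=> A B f g; rewrite !e; exact: (eqv_faithful hd).
- exact: (eqv_surj hd).
Qed.

(** * Exchanges of directions *)

Section FaceFace.
Variables (n : nat) (j : 'I_n.+1) (S : {set 'I_n}).
Notation i := (lift ord_max j).

Lemma lift_max : lift i (@ord_max n) = ord_max :> 'I_n.+2.
Proof.
by apply: val_inj; rewrite /= /bump ltnNge leq_ord add0n leq_ord.
Qed.

Lemma face_face_max : face i (face ord_max S) = face ord_max (face j S).
Proof.
rewrite /face -!imset_comp; apply: eq_imset => k; apply: val_inj => /=.
have kn : (n <= k) = false by rewrite leqNgt ltn_ord.
have jn : (n < j) = false by rewrite ltnNge leq_ord.
rewrite /bump kn jn !add0n ltnNge.
by have -> : (j <= k) + k <= n by case: (j <= k); rewrite ?add0n ?add1n // ltnW.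
Qed.

Lemma face_faceU_max :
  face i (ord_max |: face ord_max S) = ord_max |: face ord_max (face j S).
Proof. by rewrite -face_face_max /face imsetU1 -/(face _ _) lift_max. Qed.

Lemma faceU_face_max :
  i |: face i (face ord_max S) = face ord_max (j |: face j S).
Proof. by rewrite face_face_max /face imsetU1. Qed.

Lemma faceU_faceU_max :
  i |: face i (ord_max |: face ord_max S) =
  ord_max |: face ord_max (j |: face j S).
Proof. by rewrite face_faceU_max /face imsetU1 setUCA. Qed.

End FaceFace.

Lemma transposition_natural (X Y : category) (F : functor X Y) :
  natural_iso (fcomp (transposition Y) (arr_fun (arr_fun F)))
    (fcomp (arr_fun (arr_fun F)) (transposition X)).
Proof.
pose G := fcomp (transposition Y) (arr_fun (arr_fun F)).
pose H := fcomp (arr_fun (arr_fun F)) (transposition X).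
have e1 (f : Arr (Arr X)) : amor (adom (H f)) ∘ idm _ = idm _ ∘ amor (adom (G f)).
  by rewrite compm1 comp1m.
have e0 (f : Arr (Arr X)) : amor (acod (H f)) ∘ idm _ = idm _ ∘ amor (acod (G f)).
  by rewrite compm1 comp1m.
pose t1 f := @Square Y (adom (G f)) (adom (H f)) _ _ (e1 f).
pose t0 f := @Square Y (acod (G f)) (acod (H f)) _ _ (e0 f).
have e f : @compm (Arr Y) _ _ _ (amor (H f)) (t1 f) =
    @compm (Arr Y) _ _ _ (t0 f) (amor (G f)).
  by apply: squareP => /=; rewrite compm1 comp1m.
pose t f := @Square (Arr Y) (G f) (H f) (t1 f) (t0 f) (e f).
have tN (f g : Arr (Arr X)) (s : hom f g) : @compm (Arr (Arr Y)) _ _ _ (t g) (fmap G s) =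
    @compm (Arr (Arr Y)) _ _ _ (fmap H s) (t f).
  by apply: squareP; apply: squareP => /=; rewrite compm1 comp1m.
exists (@NatTrans _ _ G H t tN) => f.
by apply: arr_iso_intro; apply: arr_iso_intro; exact: iso_id.
Qed.

(** * Cubes as iterated arrows *)

Fixpoint to_iter_arr (n : nat) (C : pcategory) : functor (nArr n C) (iter_arr n C) :=
  match n return functor (nArr n C) (iter_arr n C) with
  | 0 => eval0 C
  | m.+1 => fcomp (arr_fun (to_iter_arr m C)) (delta m C)
  end.

Lemma delta_transports (n : nat) (C : category) (E : mclass C) (B : C -> Prop) :
  transports (delta n C) (@Ecls C E n.+1) (nCExt E B n.+1)
    (double_ext (@Ecls C E n)) (CExt (@Ecls C E n) (nCExt E B n)).
Proof.
split=> //; first exact: delta_equivalence.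
by move=> A; split=> [[]//|cA]; split=> //; case: cA.
Qed.

Section Cubes.
Variable C : pcategory.
Variable E : mclass C.
Variable B : C -> Prop.
Hypothesis hG : birkhoff_setting E B.

Lemma to_iter_arr_transports n :
  transports (to_iter_arr n C) (@Ecls C E n) (nCExt E B n)
    (@iter_ext C E n) (@iter_central C E B n).
Proof.
elim: n => [|n IHn].
  by split=> //; exact: eval0_equivalence.
have hn := setting_iterated n hG.
apply: (transports_comp (transports_arr _ _ IHn)); last exact: delta_transports.
- exact: setting_iso_invariant hn.
- exact: setting_replete hn.
Qed.

Lemma Ecls_iso_invariant n : iso_invariant (@Ecls C E n).
Proof.
apply: (transports_iso_invariant (to_iter_arr_transports n)).
exact: setting_iso_invariant (setting_iterated n hG).
Qed.

Lemma nCExt_replete n : replete (nCExt E B n).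
Proof.
apply: (transports_replete (to_iter_arr_transports n)).
exact: setting_replete (setting_iterated n hG).
Qed.

Lemma to_iter_arr_arr_transports n :
  transports (arr_fun (to_iter_arr n C)) (double_ext (@Ecls C E n))
    (CExt (@Ecls C E n) (nCExt E B n))
    (@iter_ext C E n.+1) (@iter_central C E B n.+1).
Proof.
have hn := setting_iterated n hG.
apply: transports_arr (to_iter_arr_transports n).
- exact: setting_iso_invariant hn.
- exact: setting_replete hn.
Qed.

Lemma nArr_transposition_transports n :
  transports (transposition (nArr n C)) (double_ext (double_ext (@Ecls C E n)))
    (CExt (double_ext (@Ecls C E n)) (CExt (@Ecls C E n) (nCExt E B n)))
    (double_ext (double_ext (@Ecls C E n)))
    (CExt (double_ext (@Ecls C E n)) (CExt (@Ecls C E n) (nCExt E B n))).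
Proof.
have h1 := setting_iterated n.+1 hG; have h2 := setting_iterated n.+2 hG.
have hF := transports_arr (setting_iso_invariant h1) (setting_replete h1)
  (to_iter_arr_arr_transports n).
apply: (transports_cancel (transposition_equivalence _) hF).
apply: (transports_natural_iso _ _ (transposition_natural (to_iter_arr n C))).
- exact: setting_iso_invariant h2.
- exact: setting_replete h2.
- apply: (transports_comp _ hF).
  exact: (transposition_transports (setting_iterated n hG)).
Qed.

Lemma nExt_ends n (A : nArr n C) :
  nExt E n A <-> ends (@iter_ext C E n) (to_iter_arr n C A).
Proof.
case: n A => [|n] A //; have [hC hE _] := setting_iterated n hG.
rewrite (ends_double_ext hE (to_iter_arr n.+1 C A)).
exact: (tr_ext (to_iter_arr_transports n) (amor (delta n C A))).
Qed.

Lemma nExt_idm n (A : nArr n C) : nExt E n A <-> Ecls E n (idm A).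
Proof.
have [hC hE _] := setting_iterated n hG.
rewrite nExt_ends (tr_ext (to_iter_arr_transports n)) fmap1.
by split=> [/(ext_id hE)|/ends_dom].
Qed.

End Cubes.

Section Pack.
Variable C : pcategory.
Variable E : mclass C.
Variable B : C -> Prop.
Hypothesis hG : birkhoff_setting E B.
Notation E1 := (double_ext E).
Notation B1 := (CExt E B).

Lemma arrows_inside_delta_natural n :
  natural_iso
    (fcomp (arr_fun (arrows_inside (op (powerset_cat n)) C))
      (fcomp (transposition (nArr n C)) (arr_fun (delta n C))))
    (fcomp (delta n (Arr C)) (arrows_inside (op (powerset_cat n.+1)) C)).
Proof.
pose G := fcomp (arr_fun (arrows_inside (op (powerset_cat n)) C))
      (fcomp (transposition (nArr n C)) (arr_fun (delta n C))).
pose H := fcomp (delta n (Arr C)) (arrows_inside (op (powerset_cat n.+1)) C).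
have t1N (a : Arr (nArr n.+1 C)) (i j : op (powerset_cat n)) (f : hom i j) :
    @compm (Arr C) _ _ _ (idm (fobj (adom (H a)) j)) (fmap (adom (G a)) f) =
    @compm (Arr C) _ _ _ (fmap (adom (H a)) f) (idm (fobj (adom (H a)) i)).
  by apply: squareP => /=; rewrite compm1 comp1m.
have t0N (a : Arr (nArr n.+1 C)) (i j : op (powerset_cat n)) (f : hom i j) :
    @compm (Arr C) _ _ _ (idm (fobj (acod (H a)) j)) (fmap (acod (G a)) f) =
    @compm (Arr C) _ _ _ (fmap (acod (H a)) f) (idm (fobj (acod (H a)) i)).
  by apply: squareP => /=; rewrite compm1 comp1m.
pose t1 a := @NatTrans _ _ (adom (G a)) (adom (H a)) _ (t1N a).
pose t0 a := @NatTrans _ _ (acod (G a)) (acod (H a)) _ (t0N a).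
have e a : @compm (nArr n (Arr C)) _ _ _ (amor (H a)) (t1 a) =
    @compm (nArr n (Arr C)) _ _ _ (t0 a) (amor (G a)).
  by apply: nattransP => S; apply: squareP => /=; rewrite compm1 comp1m.
pose t a := @Square (nArr n (Arr C)) (G a) (H a) (t1 a) (t0 a) (e a).
have tN (a b : Arr (nArr n.+1 C)) (s : hom a b) :
    @compm (Arr (nArr n (Arr C))) _ _ _ (t b) (fmap G s) =
    @compm (Arr (nArr n (Arr C))) _ _ _ (fmap H s) (t a).
  by apply: squareP; apply: nattransP => S; apply: squareP => /=; rewrite compm1 comp1m.
exists (@NatTrans _ _ G H t tN) => a.
by apply: arr_iso_intro; apply: nattrans_iso => S; exact: iso_id.
Qed.

(** By induction: the symmetry of double central extensions exchanges the
outermost of the [n] directions with that of the arrows. *)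
Lemma arrows_inside_transports n :
  transports (arrows_inside (op (powerset_cat n)) C) (double_ext (@Ecls C E n))
    (CExt (@Ecls C E n) (nCExt E B n))
    (@Ecls (Arr C) E1 n) (@nCExt (Arr C) E1 B1 n).
Proof.
have hG1 := setting_arr hG.
elim: n => [|n IHn].
- apply: (transports_cancel (arrows_inside_equivalence _ _) (to_iter_arr_transports hG1 0)).
  have h0 := to_iter_arr_arr_transports hG 0.
  apply: (transports_natural_iso (setting_iso_invariant hG1) (setting_replete hG1) _ h0).
  pose G := arr_fun (eval0 C).
  pose H := fcomp (eval0 (Arr C)) (arrows_inside (op (powerset_cat 0)) C).
  have tN (a b : Arr (nArr 0 C)) (s : hom a b) :
      @compm (Arr C) _ _ _ (idm (H b)) (fmap G s) =
      @compm (Arr C) _ _ _ (fmap H s) (idm (H a)).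
    by apply: squareP => /=; rewrite compm1 comp1m.
  by exists (@NatTrans _ _ G H _ tN) => a; exact: iso_id.
- have hEn := @Ecls_iso_invariant _ _ _ hG1 n; have hDn := @nCExt_replete _ _ _ hG1 n.
  have hd := delta_transports n E1 B1.
  apply: (transports_cancel (arrows_inside_equivalence _ _) hd).
  have hA := to_iter_arr_arr_transports hG1 n.
  have h1 := setting_iterated n.+1 hG1.
  apply: (transports_natural_iso
    (transports_iso_invariant hA (setting_iso_invariant h1))
    (transports_replete hA (setting_replete h1)) (arrows_inside_delta_natural n)).
  apply: (transports_comp (transports_arr hEn hDn IHn)).
  apply: (transports_comp (nArr_transposition_transports hG n)).
  have hA0 := to_iter_arr_arr_transports hG n.
  have h0 := setting_iterated n.+1 hG.
  apply: transports_arr (delta_transports n E B).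
  + exact: (transports_iso_invariant hA0 (setting_iso_invariant h0)).
  + exact: (transports_replete hA0 (setting_replete h0)).
Qed.

End Pack.

Section Directions.
Variable C : pcategory.
Variable E : mclass C.
Variable B : C -> Prop.
Hypothesis hG : birkhoff_setting E B.

Lemma direction_max_natural n :
  natural_iso (delta n C) (@direction n C ord_max).
Proof.
have tN (A A' : nArr n.+1 C) (f : hom A A') :
    @compm (Arr (nArr n C)) _ _ _ (idm (direction ord_max A')) (fmap (delta n C) f) =
    @compm (Arr (nArr n C)) _ _ _ (fmap (direction ord_max) f) (idm (direction ord_max A)).
  rewrite comp1m compm1; exact: squareP.
by exists (@NatTrans _ _ (delta n C) (@direction n C ord_max) _ tN) => a; exact: iso_id.
Qed.

Lemma direction_exchange_natural n (j : 'I_n.+1) :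
  natural_iso
    (fcomp (transposition (nArr n C))
      (fcomp (arr_fun (@direction n C j)) (delta n.+1 C)))
    (fcomp (arr_fun (delta n C)) (@direction n.+1 C (lift ord_max j))).
Proof.
set i := lift ord_max j.
pose G := fcomp (transposition (nArr n C))
      (fcomp (arr_fun (@direction n C j)) (delta n.+1 C)).
pose H := fcomp (arr_fun (delta n C)) (@direction n.+1 C i).
have s11 S : i |: face i (ord_max |: face ord_max S) \subset
    ord_max |: face ord_max (j |: face j S) by rewrite faceU_faceU_max.
have s10 S : i |: face i (face ord_max S) \subset
    face ord_max (j |: face j S) by rewrite faceU_face_max.
have s01 S : face i (ord_max |: face ord_max S) \subset
    ord_max |: face ord_max (face j S) by rewrite face_faceU_max.
have s00 S : face i (face ord_max S) \subset
    face ord_max (face j S) by rewrite face_face_max.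
have N11 A (T S : {set 'I_n}) (h : S \subset T) :
    nmap A (s11 S) ∘ @fmap _ _ (adom (adom (G A))) T S h =
    @fmap _ _ (adom (adom (H A))) T S h ∘ nmap A (s11 T).
  exact: (nmap_square A (s11 S) (faceU_sub ord_max (faceU_sub j h))
    (faceU_sub i (faceU_sub ord_max h))
    (s11 T)).
have N10 A (T S : {set 'I_n}) (h : S \subset T) :
    nmap A (s10 S) ∘ @fmap _ _ (acod (adom (G A))) T S h =
    @fmap _ _ (acod (adom (H A))) T S h ∘ nmap A (s10 T).
  exact: (nmap_square A (s10 S) (face_sub ord_max (faceU_sub j h))
    (faceU_sub i (face_sub ord_max h))
    (s10 T)).
have N01 A (T S : {set 'I_n}) (h : S \subset T) :
    nmap A (s01 S) ∘ @fmap _ _ (adom (acod (G A))) T S h =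
    @fmap _ _ (adom (acod (H A))) T S h ∘ nmap A (s01 T).
  exact: (nmap_square A (s01 S) (faceU_sub ord_max (face_sub j h))
    (face_sub i (faceU_sub ord_max h))
    (s01 T)).
have N00 A (T S : {set 'I_n}) (h : S \subset T) :
    nmap A (s00 S) ∘ @fmap _ _ (acod (acod (G A))) T S h =
    @fmap _ _ (acod (acod (H A))) T S h ∘ nmap A (s00 T).
  exact: (nmap_square A (s00 S) (face_sub ord_max (face_sub j h))
    (face_sub i (face_sub ord_max h))
    (s00 T)).
pose t11 A := @NatTrans _ _ (adom (adom (G A))) (adom (adom (H A)))
  (fun S => nmap A (s11 S)) (N11 A).
pose t10 A := @NatTrans _ _ (acod (adom (G A))) (acod (adom (H A)))
  (fun S => nmap A (s10 S)) (N10 A).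
pose t01 A := @NatTrans _ _ (adom (acod (G A))) (adom (acod (H A)))
  (fun S => nmap A (s01 S)) (N01 A).
pose t00 A := @NatTrans _ _ (acod (acod (G A))) (acod (acod (H A)))
  (fun S => nmap A (s00 S)) (N00 A).
have e1 A : @compm (nArr n C) _ _ _ (amor (adom (H A))) (t11 A) =
    @compm (nArr n C) _ _ _ (t10 A) (amor (adom (G A))).
  apply: nattransP => S; exact: (nmap_square A
    (faceU_sub i (face_faceU ord_max S)) (s11 S)
    (s10 S) (face_faceU ord_max (j |: face j S))).
have e0 A : @compm (nArr n C) _ _ _ (amor (acod (H A))) (t01 A) =
    @compm (nArr n C) _ _ _ (t00 A) (amor (acod (G A))).
  apply: nattransP => S; exact: (nmap_square A
    (face_sub i (face_faceU ord_max S)) (s01 S)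
    (s00 S) (face_faceU ord_max (face j S))).
pose t1 A := @Square (nArr n C) (adom (G A)) (adom (H A)) _ _ (e1 A).
pose t0 A := @Square (nArr n C) (acod (G A)) (acod (H A)) _ _ (e0 A).
have e A : @compm (Arr (nArr n C)) _ _ _ (amor (H A)) (t1 A) =
    @compm (Arr (nArr n C)) _ _ _ (t0 A) (amor (G A)).
  apply: squareP; apply: nattransP => S.
  + exact: (nmap_square A (face_faceU i (ord_max |: face ord_max S)) (s11 S)
      (s01 S) (faceU_sub ord_max (face_faceU j S))).
  + exact: (nmap_square A (face_faceU i (face ord_max S)) (s10 S)
      (s00 S) (face_sub ord_max (face_faceU j S))).
pose t A := @Square (Arr (nArr n C)) (G A) (H A) (t1 A) (t0 A) (e A).
have tN A A' (f : hom A A') :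
    @compm (Arr (Arr (nArr n C))) _ _ _ (t A') (fmap G f) =
    @compm (Arr (Arr (nArr n C))) _ _ _ (fmap H f) (t A).
  apply: squareP; apply: squareP; apply: nattransP => S.
  + exact: (esym (nmap_nat f (s11 S))).
  + exact: (esym (nmap_nat f (s10 S))).
  + exact: (esym (nmap_nat f (s01 S))).
  + exact: (esym (nmap_nat f (s00 S))).
exists (@NatTrans _ _ G H t tN) => A.
apply: arr_iso_intro; apply: arr_iso_intro; apply: nattrans_iso => S.
- by apply: (@nmap_iso _ _ A _ _ (s11 S)); rewrite faceU_faceU_max.
- by apply: (@nmap_iso _ _ A _ _ (s10 S)); rewrite faceU_face_max.
- by apply: (@nmap_iso _ _ A _ _ (s01 S)); rewrite face_faceU_max.
- by apply: (@nmap_iso _ _ A _ _ (s00 S)); rewrite face_face_max.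
Qed.

(** All directions of a cube play the same role: an earlier direction is moved
to the last place by induction on a face and one exchange with [ord_max], which
the symmetry of double central extensions permits. *)
Lemma direction_transports n (i : 'I_n.+1) :
  transports (@direction n C i) (@Ecls C E n.+1) (nCExt E B n.+1)
    (double_ext (@Ecls C E n)) (CExt (@Ecls C E n) (nCExt E B n)).
Proof.
have inv m : iso_invariant (double_ext (@Ecls C E m)).
  apply: (transports_iso_invariant (to_iter_arr_arr_transports hG m)).
  exact: setting_iso_invariant (setting_iterated m.+1 hG).
have rep m : replete (CExt (@Ecls C E m) (nCExt E B m)).
  apply: (transports_replete (to_iter_arr_arr_transports hG m)).
  exact: setting_replete (setting_iterated m.+1 hG).
elim: n i => [|n IHn] i; case: (unliftP ord_max i) => [j|] ->.
- by case: j.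
- exact: transports_natural_iso (direction_max_natural 0) (delta_transports 0 E B).
- have hd := transports_arr (inv n) (rep n) (delta_transports n E B).
  apply: (transports_cancel (direction_equivalence _ _) hd).
  have h1 := setting_iterated n.+1 hG; have h2 := setting_iterated n.+2 hG.
  have hA := transports_arr (setting_iso_invariant h1) (setting_replete h1)
    (to_iter_arr_arr_transports hG n).
  apply: (transports_natural_iso
    (transports_iso_invariant hA (setting_iso_invariant h2))
    (transports_replete hA (setting_replete h2)) (direction_exchange_natural j)).
  apply: (transports_comp (nArr_transposition_transports hG n)).
  apply: (transports_comp (transports_arr (inv n) (rep n) (IHn j))).
  exact: delta_transports.
- exact: transports_natural_iso (direction_max_natural n.+1) (delta_transports n.+1 E B).
Qed.

Lemma rho_natural n (i : 'I_n.+1) :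
  natural_iso (fcomp (arrows_inside (op (powerset_cat n)) C) (@direction n C i)) (@rho n C i).
Proof.
pose G := fcomp (arrows_inside (op (powerset_cat n)) C) (@direction n C i).
have cN A (T S : op (powerset_cat n)) (h : hom T S) :
    @compm (Arr C) _ _ _ (idm (rho_obj i A S)) (fmap (G A) h) =
    @compm (Arr C) _ _ _ (fmap (rho_obj i A) h) (idm (rho_obj i A T)).
  by apply: squareP => /=; rewrite compm1 comp1m.
pose t A := @NatTrans _ _ (G A) (rho_obj i A) _ (cN A).
have tN A A' (f : hom A A') :
    @compm (nArr n (Arr C)) _ _ _ (t A') (fmap G f) =
    @compm (nArr n (Arr C)) _ _ _ (fmap (rho i) f) (t A).
  by apply: nattransP => S; apply: squareP => /=; rewrite compm1 comp1m.
exists (@NatTrans _ _ G (rho i) t tN) => A.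
by apply: nattrans_iso => S; exact: iso_id.
Qed.

(** [rho i] singles out the direction [i] and then moves it inside the cube. *)
Theorem rho_transports n (i : 'I_n.+1) :
  transports (@rho n C i) (@Ecls C E n.+1) (nCExt E B n.+1)
    (@Ecls (Arr C) (double_ext E) n) (@nCExt (Arr C) (double_ext E) (CExt E B) n).
Proof.
have hG1 := setting_arr hG.
apply: (transports_natural_iso (@Ecls_iso_invariant _ _ _ hG1 n) (@nCExt_replete _ _ _ hG1 n)
  (rho_natural i)).
exact: (transports_comp (arrows_inside_transports hG n) (direction_transports i)).
Qed.

End Directions.

(** * Semi-abelian categories *)

Definition cospan_hom (x y : option bool) : bool := (x == y) || (y == None).

Lemma cospan_trans x y z : cospan_hom y z -> cospan_hom x y -> cospan_hom x z.
Proof. by case: x y z => [[]|] [[]|] [[]|]. Qed.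

Lemma cospan_refl x : cospan_hom x x.
Proof. by rewrite /cospan_hom eqxx. Qed.

Definition cospan_cat : category.
Proof.
apply: (@Category (option bool) cospan_hom cospan_refl
  (fun x y z g f => cospan_trans g f)); move=> *; exact: bool_irrelevance.
Defined.

Lemma cospan_finite : finite_category cospan_cat.
Proof.
split; first by exists [:: None; Some true; Some false] => -[[]|] /=; auto.
move=> x y; case e : (cospan_hom x y).
- by exists [:: e] => h /=; left; exact: bool_irrelevance.
- by exists [::] => h /=; move: (h : cospan_hom x y); rewrite e.
Qed.

Section Cospan.
Variables (C : category) (A B D : C) (f : hom A B) (g : hom D B).

Definition cospan_obj (x : option bool) : C :=
  match x with Some true => A | Some false => D | None => B end.

Definition cospan_map (x y : option bool) :
  cospan_hom x y -> hom (cospan_obj x) (cospan_obj y) :=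
  match x, y return cospan_hom x y -> hom (cospan_obj x) (cospan_obj y) with
  | None, None => fun _ => idm B
  | Some true, None => fun _ => f
  | Some false, None => fun _ => g
  | Some true, Some true => fun _ => idm A
  | Some false, Some false => fun _ => idm D
  | Some true, Some false => fun e => False_rect _ (notF e)
  | Some false, Some true => fun e => False_rect _ (notF e)
  | None, Some _ => fun e => False_rect _ (notF e)
  end.

Definition cospan : functor cospan_cat C.
Proof.
apply: (@Functor cospan_cat C cospan_obj cospan_map); first by case=> [[]|].
by case=> [[]|] [[]|] [[]|] //= *; rewrite ?comp1m ?compm1.
Defined.

End Cospan.

Lemma finitely_complete_pullbacks (C : category) :
  finitely_complete C -> has_pullbacks C.
Proof.
move=> hl A B D f g; have [L [p [pc pl]]] := hl _ cospan_finite (cospan f g).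
have fp : f ∘ p (Some true) = p None := pc (Some true) None isT.
have gp : g ∘ p (Some false) = p None := pc (Some false) None isT.
exists L, (p (Some true)), (p (Some false)); split; first by rewrite fp gp.
move=> T a d e.
pose q (x : cospan_cat) : hom T (cospan f g x) :=
  match x return hom T (cospan_obj A B D x) with
  | Some true => a | Some false => d | None => f ∘ a end.
have [|t [tq tU]] := pl T q.
  by case=> [[]|] [[]|] //= u; rewrite ?comp1m.
exists t; split; first by split; [exact: tq (Some true) | exact: tq (Some false)].
move=> t' [t1 t0]; apply: tU => -[[]|] //=.
by rewrite -fp -compmA t1.
Qed.

Lemma semi_abelian_exact_protomodular (C : pcategory) :
  is_semi_abelian C -> exact_protomodular C.
Proof.
move=> hC; have [hr hx] := sab_exact hC; split.
- exact: finitely_complete_pullbacks (sab_complete hC).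
- exact: sab_protomodular hC.
- move=> R A d0 d1 /hx [Z [f kp]]; have [Q [q co]] := reg_coeq hr kp.
  exists Q, q; split=> //; have [m [mq _]] := proj2 co _ f (pb_comm kp).
  apply: pb_intro; first exact: (proj1 co).
  + by move=> T a d e; apply: (pb_lift kp); rewrite -mq -!compmA e.
  + by move=> T u v; exact: (pb_mono kp).
Qed.

(** * Brackets *)

Section Iota.
Variables (n : nat) (C : pcategory).
Implicit Types X : C.

Lemma iota_off_from X (S : {set 'I_n}) (Y : C) (f g : hom (niota n X S) Y) :
  S != setT -> f = g.
Proof.
move: f g; rewrite /= /iota_vertex; case: (S == setT) => // f g _.
exact: from0_eq.
Qed.

Lemma iota_off_to X (S : {set 'I_n}) (Y : C) (f g : hom Y (niota n X S)) :
  S != setT -> f = g.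
Proof.
move: f g; rewrite /= /iota_vertex; case: (S == setT) => // f g _.
exact: to0_eq.
Qed.

Lemma iota_top_iso X : is_iso (iota_top n X).
Proof.
rewrite /iota_top /= /iota_vertex; move: (eqxx (setT : {set 'I_n})).
by case: (setT == setT) => // _; exact: iso_id.
Qed.

Lemma sub_of_top (S : {set 'I_n}) : (S == setT) = true -> setT \subset S.
Proof. by move/eqP->. Qed.

Definition from_niota_at X (A : nArr n C) (x : hom X (fobj A setT))
  (S : {set 'I_n}) : hom (iota_vertex X S) (fobj A S) :=
  match S == setT as b return hom (if b then X else zero) (fobj A S) with
  | true => nmap A (subsetT S) ∘ x
  | false => from0 _
  end.

(** A map from [niota X] amounts to a map from [X] to the initial vertex that
vanishes at all other vertices. *)
Lemma from_niota_exists X (A : nArr n C) (x : hom X (fobj A setT)) :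
  (forall S, S != setT -> nmap A (subsetT S) ∘ x = zerom _ _) ->
  exists k : @hom (nArr n C) (niota n X) A, nt_at k setT ∘ iota_top n X = x.
Proof.
move=> x0.
have kN (T S : {set 'I_n}) (h : S \subset T) :
    from_niota_at x S ∘ iota_edge X h = nmap A h ∘ from_niota_at x T.
  have hT : (S == setT) ==> (T == setT).
    by apply/implyP => /eqP e; rewrite -subTset -e.
  rewrite /from_niota_at /iota_edge /iota_vertex.
  have xM : nmap A (subsetT S) ∘ x = nmap A h ∘ (nmap A (subsetT T) ∘ x).
    by rewrite compmA -(nmapM A h (subsetT T) (subsetT S)).
  move: hT (x0 S) xM.
  case: (T == setT); case: (S == setT) => //= _ xS xM.
  - by rewrite compm1.
  - by rewrite zerom_r -xM xS.
  - exact: from0_eq.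
exists (@NatTrans (op (powerset_cat n)) C (niota n X) A (from_niota_at x)
  (fun T S h => kN T S h)).
rewrite /= /from_niota_at /iota_top /iota_vertex.
move: (eqxx (setT : {set 'I_n})).
by case: (setT == setT) => // _; rewrite nmap1 comp1m compm1.
Qed.

Lemma from_niota_eq X (A : nArr n C) (k l : @hom (nArr n C) (niota n X) A) :
  nt_at k setT ∘ iota_top n X = nt_at l setT ∘ iota_top n X -> k = l.
Proof.
move=> e; apply: nattransP => S; case: (eqVneq S setT) => [->|ST].
- exact: iso_epi (iota_top_iso X) _ _ _ e.
- exact: iota_off_from.
Qed.

Definition to_niota_at (F : nArr n C) X (x : hom (fobj F setT) X)
  (S : {set 'I_n}) : hom (fobj F S) (iota_vertex X S) :=
  match S == setT as b return (b = true -> setT \subset S) ->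
    hom (fobj F S) (if b then X else zero) with
  | true => fun e => x ∘ nmap F (e erefl)
  | false => fun _ => to0 _
  end (@sub_of_top S).

Lemma to_niota_exists (F : nArr n C) X (x : hom (fobj F setT) X) :
  exists k : @hom (nArr n C) F (niota n X), nt_at k setT = iota_top n X ∘ x.
Proof.
have kN (T S : {set 'I_n}) (h : S \subset T) :
    to_niota_at x S ∘ nmap F h = iota_edge X h ∘ to_niota_at x T.
  have hT : (S == setT) ==> (T == setT).
    by apply/implyP => /eqP e; rewrite -subTset -e.
  rewrite /to_niota_at /iota_edge /iota_vertex.
  move: hT (@sub_of_top S) (@sub_of_top T).
  case: (S == setT); case: (T == setT) => //= _ s t.
  - by rewrite comp1m -compmA -(nmapM F (s erefl) h (t erefl)).
  - exact: to0_eq.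
  - exact: to0_eq.
exists (@NatTrans (op (powerset_cat n)) C F (niota n X) (to_niota_at x)
  (fun T S h => kN T S h)).
rewrite /= /to_niota_at /iota_top /iota_vertex.
move: (eqxx (setT : {set 'I_n})) (@sub_of_top setT).
by case: (setT == setT) => // _ s; rewrite nmap1 comp1m compm1.
Qed.

End Iota.

(** An element of the kernel of [eta] vanishes wherever [eta] is invertible, so
the kernel is concentrated at the initial vertex. *)
Lemma niota_kernel (n : nat) (C : pcategory) (A I : nArr n C)
  (eta : @hom (nArr n C) A I) (X : C) (x : hom X (fobj A setT)) :
  (forall S, S != setT -> is_iso (nt_at eta S)) ->
  (exists k : @hom (nArr n C) (niota n X) A,
     @is_kernel (pnArr n C) _ _ _ k eta /\ nt_at k setT ∘ iota_top n X = x) <->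
  is_kernel x (nt_at eta setT).
Proof.
move=> ei; have x0 W (w : hom W (fobj A setT)) :
    nt_at eta setT ∘ w = zerom W _ ->
    forall S, S != setT -> nmap A (subsetT S) ∘ w = zerom _ _.
  move=> ew S ST; apply: (iso_mono (ei S ST)).
  by rewrite compmA nmap_nat -compmA ew !zerom_r.
split=> [[k [kk <-]]|kx].
- have ek : nt_at eta setT ∘ nt_at k setT = zerom _ _ := nt_congr (proj1 kk) setT.
  apply: ker_intro; first by rewrite compmA ek zerom_l.
  + move=> W w ew; have [l lw] := from_niota_exists (x0 _ _ ew).
    have [|v kv] := ker_lift (C := pnArr n C) kk (t := l).
      apply: from_niota_eq => /=; rewrite -compmA lw ew -/(zerom _ _).
      by rewrite zerom_l.
    have [i [_ ji]] := iota_top_iso n X.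
    have kvT : nt_at k setT ∘ nt_at v setT = nt_at l setT := nt_congr kv setT.
    exists (i ∘ (nt_at v setT ∘ iota_top n W)).
    by rewrite -compmA (comp_eq ji) comp1m compmA kvT.
  + move=> W w w'; rewrite -!compmA => kww'.
    have ext (z : hom W X) : exists l : @hom (nArr n C) (niota n W) (niota n X),
        nt_at l setT ∘ iota_top n W = iota_top n X ∘ z.
      by apply: from_niota_exists => S ST; exact: iota_off_to.
    have [l lE] := ext w; have [l' l'E] := ext w'.
    have ll' : l = l'.
      apply: (ker_mono (C := pnArr n C) kk); apply: from_niota_eq => /=.
      by rewrite -!compmA lE l'E.
    by apply: (iso_mono (iota_top_iso n X)); rewrite -lE -l'E ll'.
- have [k kE] := from_niota_exists (x0 _ _ (proj1 kx)); exists k; split=> //.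
  have [i [ij ji]] := iota_top_iso n X.
  have kT : nt_at k setT = x ∘ i by rewrite -kE -compmA ji compm1.
  apply: ker_intro.
  + by apply: from_niota_eq => /=; rewrite -compmA kE (proj1 kx) -/(zerom _ _) zerom_l.
  + move=> F t et; have etS S : nt_at eta S ∘ nt_at t S = zerom _ _ := nt_congr et S.
    have [u xu] := ker_lift kx (etS setT); have [v vE] := to_niota_exists u.
    exists v; apply: nattransP => S; case: (eqVneq S setT) => [->|ST] /=.
    * by rewrite vE kT -compmA (comp_eq ij) comp1m.
    * apply: (iso_mono (ei S ST)).
      rewrite etS (iota_off_to (nt_at v S) (zerom _ _) ST).
      by rewrite !zerom_r.
  + move=> F u v uv; apply: nattransP => S; case: (eqVneq S setT) => [->|ST].
    * have ii : is_iso i by exists (iota_top n X).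
      apply: (iso_mono ii); apply: (ker_mono kx); rewrite !compmA -kT.
      exact: (nt_congr uv setT).
    * exact: iota_off_to.
Qed.

Lemma iso_off_top_at (n : nat) (C : pcategory) (E : mclass C) (B : C -> Prop)
  (A A' : nArr n C) (f : hom A A') :
  birkhoff_setting E B -> iso_off_top n (fmap (to_iter_arr n C) f) ->
  forall S, S != setT -> is_iso (nt_at f S).
Proof.
move=> hG; elim: n A A' f => [|n IHn] A A' f /=.
  by move=> _ S /eqP []; apply/setP => -[].
move=> [f0 f1] S ST; case: (face_cases ord_max S) ST => [[S' ->]|[S' ->]] ST.
- apply: (IHn _ _ (upper_face_map ord_max f)) => //; apply: contraNneq ST => ->.
  apply/eqP/setP => k; rewrite [RHS]inE; case: (unliftP ord_max k) => [j|] ->.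
  + by rewrite lift_in_faceU inE.
  + by rewrite in_faceU.
- have li := equivalence_iso (tr_eqv (to_iter_arr_transports hG n))
    (f := lower_face_map ord_max f) f0.
  exact (@nattrans_iso_at _ _ _ _ (lower_face_map ord_max f) S' li).
Qed.

Section Reflections.
Variable C : pcategory.
Variable E : mclass C.
Variable B : C -> Prop.
Hypothesis hG : birkhoff_setting E B.
Variable n : nat.

Lemma nArr_reflection_exists (A : nArr n C) : nExt E n A ->
  exists (I : nArr n C) (eta : hom A I), is_reflection (nCExt E B n) eta.
Proof.
move/(nExt_ends hG); have [_ _ hB] := setting_iterated n hG.
have hn := setting_iterated n hG; have [hF hE hD] := to_iter_arr_transports hG n.
move/(reflection_exists hB) => [Z [zeta r]].
have [I [eta [_ [_ _ re]]]] :=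
  equivalence_reflection_lift hF hD (setting_replete hn) r.
by exists I, eta.
Qed.

Lemma nArr_reflector : inhabited (reflector (nExt E n) (nCExt E B n)).
Proof.
have ch (A : full (nExt E n)) :
    {x : {I : nArr n C & hom (sval A) I} | is_reflection (nCExt E B n) (projT2 x)}.
  apply: cid; have [I [eta r]] := nArr_reflection_exists (proj2_sig A).
  by exists (existT _ I eta).
exact: (inhabits (@reflector_of_choice (nArr n C) _ (nCExt E B n)
  (fun A => projT1 (sval (ch A))) (fun A => projT2 (sval (ch A)))
  (fun A => proj2_sig (ch A)))).
Qed.

Lemma nArr_reflection_iso (A I : nArr n C) (eta : hom A I) :
  nExt E n A -> is_reflection (nCExt E B n) eta ->
  forall S, S != setT -> is_iso (nt_at eta S).
Proof.
move=> /(nExt_ends hG) eA r; apply: (iso_off_top_at hG).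
have hn := setting_iterated n hG; have [hF hE hD] := to_iter_arr_transports hG n.
apply: (reflection_iso_off_top hG eA).
exact: (proj1 (equivalence_reflection hF hD (setting_replete hn) eta) r).
Qed.

Lemma is_bracketP (I : reflector (nExt E n) (nCExt E B n)) (A : full (nExt E n))
  (X : C) (x : hom X (fobj (sval A) setT)) :
  is_bracket I x <-> is_kernel x (nt_at (refl_unit I A) setT).
Proof.
apply: niota_kernel; apply: nArr_reflection_iso; first exact: proj2_sig A.
exact: (@reflP _ _ _ I A).
Qed.

Lemma bracket_exists (I : reflector (nExt E n) (nCExt E B n)) (A : full (nExt E n)) :
  exists (X : C) (x : hom X (fobj (sval A) setT)), is_bracket I x.
Proof.
have [hC _ _] := hG.
have [X [x kx]] := ker_exists (nt_at (refl_unit I A) setT) (ep_pb hC).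
by exists X, x; apply/is_bracketP.
Qed.

End Reflections.

Theorem theorem4p5 (C : pcategory) (hC : is_semi_abelian C)
  (E : mclass C) (hE : is_class_of_extensions E)
  (B : C -> Prop) (hB : is_strongly_birkhoff E B)
  (n : nat) (i : 'I_n.+1) :
  let E1 : mclass (pArr C) := @double_ext C E in
  let B1 : pArr C -> Prop := CExt E B in
  (exists hrho : forall A : nArr n.+1 C, nExt E n.+1 A -> nExt E1 n (rho i A),
    inhabited (reflector (nExt E n.+1) (nCExt E B n.+1)) /\
    inhabited (reflector (nExt E1 n) (nCExt E1 B1 n)) /\
    forall (I : reflector (nExt E n.+1) (nCExt E B n.+1))
      (J : reflector (nExt E1 n) (nCExt E1 B1 n)),
    let rhoX := restrict hrho in
    (forall A : full (nExt E n.+1),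
      (exists (X : C) (x : hom X (fobj (sval A) setT)), is_bracket I x) /\
      (exists (Y : pArr C) (y : hom Y (fobj (sval (rhoX A)) setT)),
        is_bracket J y) /\
      forall (X : C) (x : hom X (fobj (sval A) setT))
        (Y : pArr C) (y : hom Y (fobj (sval (rhoX A)) setT)),
        is_bracket I x -> is_bracket J y ->
        exists m : square (arr_iota X) (rho i (sval A) setT),
          sq1 m = nmap (sval A) (subsetT (i |: face i setT)) ∘ x /\
          @same_subobject (pArr C) _ _ _ m y) /\
    exists phi : nattrans (fcomp (rho i) I) (fcomp J rhoX),
      @is_iso (Fun _ _) _ _ phi /\
      forall A : full (nExt E n.+1),
        phi A ∘ fmap (rho i) (refl_unit I A) = refl_unit J (rhoX A)) /\
  forall A : nArr n.+1 C, nCExt E B n.+1 A <-> nCExt E1 B1 n (rho i A).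
Proof.
move=> E1 B1; have hG : birkhoff_setting E B.
  by split=> //; exact: semi_abelian_exact_protomodular.
have hG1 : birkhoff_setting E1 B1 := setting_arr hG.
have [hr hrE hrD] := rho_transports hG i.
split; last exact: hrD.
have hrho (A : nArr n.+1 C) : nExt E n.+1 A -> nExt E1 n (rho i A).
  by move=> /(nExt_idm hG) /hrE; rewrite fmap1 => /(nExt_idm hG1).
exists hrho; split; first exact: nArr_reflector.
split; first exact: nArr_reflector.
move=> I J rhoX.
have rI (A : full (nExt E n.+1)) :
    is_reflection (nCExt E1 B1 n) (fmap (rho i) (refl_unit I A)).
  apply/(equivalence_reflection hr hrD (@nCExt_replete _ _ _ hG1 n)).
  exact: (@reflP _ _ _ I A).
have rJ (A : full (nExt E n.+1)) :
    is_reflection (nCExt E1 B1 n) (refl_unit J (rhoX A)).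
  exact: (@reflP _ _ _ J (rhoX A)).
split.
- move=> A; split; first exact: bracket_exists.
  split; first exact: (bracket_exists hG1).
  move=> X x Y y /(is_bracketP hG) kx /(is_bracketP hG1) ky.
  have offI := nArr_reflection_iso hG (proj2_sig A) (@reflP _ _ _ I A).
  pose eta := refl_unit I A.
  have fT : face i setT != setT.
    by apply/eqP => e; have := notin_face i setT; rewrite e inE.
  have UT : setT \subset i |: face i setT.
    apply/subsetP => k _; case: (unliftP i k) => [j|] ->.
    + by rewrite lift_in_faceU inE.
    + exact: in_faceU.
  pose m1 := nmap (sval A) (subsetT (i |: face i setT)) ∘ x.
  have mC : amor (rho i (sval A) setT) ∘ m1 = from0 _ ∘ to0 X.
    rewrite /m1 /= compmA -(nmapM _ _ _ (subsetT _)) -/(zerom _ _).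
    apply: (iso_mono (offI _ fT)).
    by rewrite compmA nmap_nat -compmA (proj1 kx) !zerom_r.
  pose m := @Square C (arr_iota X) (rho i (sval A) setT) m1 (from0 _) mC.
  exists m; split=> //.
  (* At the initial vertex of [rho i A] the unit [rho i eta] has an invertible
     second component, so its kernel lives in the domain. *)
  have km : @is_kernel (pArr C) _ _ _ m (nt_at (fmap (rho i) eta) setT).
    apply: arr_ker_intro => /=.
    + apply: (ker_conj _ _ _ kx).
      * exact: nmap_iso.
      * exact: (nmap_iso (I A) (subsetT (i |: face i setT)) UT).
      * exact: nmap_nat.
    + apply: ker_intro; first exact: from0_eq.
      * move=> T t et; exists (to0 T); apply: (iso_mono (offI _ fT)).
        by rewrite et -/(zerom T _) zerom_r.
      * by move=> T u v _; exact: to0_eq.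
  have [h hi he] := reflection_iso (rI A) (rJ A).
  have km' : @is_kernel (pArr C) _ _ _ m (nt_at (refl_unit J (rhoX A)) setT).
    have hT := @nattrans_iso_at (op (powerset_cat n)) (Arr C) _ _ h setT hi.
    have heT := @nt_congr (op (powerset_cat n)) (Arr C) _ _ _ _ he setT.
    have := @ker_conj (pArr C) _ _ _ _ _ _ _ _ _ _ (iso_id _) hT _ km.
    by rewrite comp1m; apply; rewrite compm1 -heT.
  split; first exact: (ker_mono km').
  split; first exact: (ker_mono ky).
  exact: ker_unique km' ky.
- pose phi A := sval (cid2 (reflection_iso (rI A) (rJ A))).
  have phiE A : phi A ∘ fmap (rho i) (refl_unit I A) = refl_unit J (rhoX A).
    by rewrite /phi; case: cid2.
  have phiI A : is_iso (phi A) by rewrite /phi; case: cid2.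
  have phiN (A A' : full (nExt E n.+1)) (f : hom A A') :
      phi A' ∘ fmap (fcomp (rho i) I) f = fmap (fcomp J rhoX) f ∘ phi A.
    have [g [_ gU]] := proj2 (rI A) _ (refl_unit J (rhoX A') ∘ fmap (rho i) f)
      (proj1 (rJ A')).
    transitivity g; [apply/esym|]; apply: gU.
    + rewrite -compmA -fmapM -(nt_nat (refl_unit I) f) fmapM compmA phiE //.
    + by rewrite -compmA phiE -(nt_nat (refl_unit J) (fmap rhoX f)).
  exists (@NatTrans _ _ (fcomp (rho i) I) (fcomp J rhoX) phi phiN); split=> //.
  exact: nattrans_iso.
Qed.
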